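(* Let $\alpha\in(1/2,1)$. (i) Let $f\in C_\alpha$ and let $(c_k)_{k\ge1}$ be a sequence of real numbers such that $$\sum_{k=1}^\infty c_k^2 \exp\left(\frac{K(\log k)^{1-\alpha}}{\log\log k}\right)<\infty,\qquad\text{where } K=\frac{3}{1-\alpha}+\frac{4}{\sqrt{2\alpha-1}}.$$ Then the series $\sum_{k=1}^\infty c_k f(kx)$ converges in $L^2(0,1)$ norm and converges for almost every $x$. (ii) Conversely, there exist a function $f\in C_\alpha$ and a sequence $(c_k)_{k\ge1}$ of real numbers such that, for any $0<\varepsilon<1$, $$\sum_{k=1}^\infty c_k^2 \exp\left(\frac{1-\varepsilon}{1-\alpha}\cdot\frac{(\log k)^{1-\alpha}}{\log\log k}\right)<\infty,$$ but the series $\sum_{k=1}^\infty c_k f(kx)$ is not convergent in $L^2(0,1)$ norm.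
   Context: Convention on logarithms: throughout, $\log x$ is read as $\max\{1,\log x\}$ (including in iterated logarithms), so that all iterated logarithms are defined and nonzero. The class $C_\alpha$: for $\alpha>1/2$, $C_\alpha$ is the class of measurable functions $f:\mathbb{R}\to\mathbb{R}$ with $f(x+1)=f(x)$, $\int_0^1 f(x)\,dx=0$, $\int_0^1 f^2(x)\,dx<\infty$, whose Fourier series is $\sum_{j=1}^\infty (a_j\sin 2\pi jx+b_j\cos 2\pi jx)$ with $a_j=\mathcal{O}(j^{-\alpha})$ and $b_j=\mathcal{O}(j^{-\alpha})$ as $j\to\infty$. Convergence of a series means convergence of its partial sums $\sum_{k=1}^N$ as $N\to\infty$. *)

(* Defs.v *)
From HB Require Import structures.
From mathcomp Require Import all_boot all_order all_algebra.
From mathcomp Require Import all_classical all_reals all_analysis.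
Import Order.TTheory GRing.Theory Num.Theory.
Import numFieldNormedType.Exports.

Set Implicit Arguments.
Unset Strict Implicit.
Unset Printing Implicit Defensive.

Local Open Scope classical_set_scope.
Local Open Scope ring_scope.

(* The real line with the sigma-algebra of Lebesgue measurable sets (not just
   the Borel sets), which is the domain of [completed_lebesgue_measure]. *)
Definition lebesgueType (R : realType) :=
  caratheodory_type (@wlength R idfun)^*%mu.

Definition lebesgue_measurable_fun (R : realType) (D : set R) (f : R -> R) :=
  @measurable_fun _ _ (lebesgueType R) (measurableTypeR R) D f.

(* All logarithms are truncated from below at 1; in particular log log k is
   [logm (logm k%:R)]. *)
Definition logm (R : realType) (x : R) : R := Num.max 1 (ln x).

Section fourier.
Context {R : realType}.
Local Notation lambda := (@completed_lebesgue_measure R).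

Definition fourier_sin (f : R -> R) (j : nat) : R :=
  2 * \int[lambda]_(x in `[0, 1]) (f x * sin (2 * pi * j%:R * x)).

Definition fourier_cos (f : R -> R) (j : nat) : R :=
  2 * \int[lambda]_(x in `[0, 1]) (f x * cos (2 * pi * j%:R * x)).

(* Finiteness of [class_sqint] makes f integrable on [0, 1], so that
   [class_mean0] and the Fourier coefficients are honest integrals. *)
Record class_C (alpha : R) (f : R -> R) : Prop := ClassC {
  class_measurable : lebesgue_measurable_fun setT f ;
  class_periodic : periodic f 1 ;
  class_mean0 : \int[lambda]_(x in `[0, 1]) f x = 0 ;
  class_sqint : (\int[lambda]_(x in `[0%R, 1%R]) (f x ^+ 2)%:E < +oo)%E ;
  class_sin : fourier_sin f =O_\oo (fun j : nat => j%:R `^ (- alpha)) ;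
  class_cos : fourier_cos f =O_\oo (fun j : nat => j%:R `^ (- alpha)) }.

Definition dilated_sum (c : nat -> R) (f : R -> R) (N : nat) (x : R) : R :=
  \sum_(1 <= k < N.+1) c k * f (k%:R * x).

(* The function is extended by 0 outside of (0, 1). *)
Definition norm_L2_01 (g : R -> R) : \bar R :=
  ('N[lambda]_2%:E [EFin \o (g \_ `]0%R, 1%R[)])%E.

Definition cvg_L2_01 (S : nat -> R -> R) : Prop :=
  exists g : R -> R,
    [/\ lebesgue_measurable_fun `]0, 1[ g,
        (norm_L2_01 g < +oo)%E &
        norm_L2_01 (S N \- g) @[N --> \oo] --> 0%E].

End fourier.

(* Main.v *)
(** Convergence.  Writing f as the sum of its Fourier series, the square norm of a
    block of the series sum c_k f(kx) over N <= k < 2N is at most a constant times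
    sum_(k,l) |c_k c_l| gcd(k,l)^(2 alpha) (k l)^(-alpha).  A weighted
    Cauchy-Schwarz inequality turns this form into a product of two Euler products,
    with weight 1 at the primes up to y ~ log N and sqrt(2 alpha - 1) (y/p)^alpha at
    the larger ones; Chebyshev's bound theta(n) <= n log 4 then gives
    exp(K' (log N)^(1 - alpha) / log log N) sum c_k^2 for some K' < K, because
    log 4 < 3/2.  The difference K - K' absorbs the powers of log N lost in a
    Rademacher-Menshov argument over dyadic blocks.

    Divergence.  Take f = sum j^(-alpha) sin(2 pi j x) and let the c_k^2 be a sum of
    masses, each spread evenly over the divisors of a primorial P = prod_(p <= y) p.
    Testing against sum_(n | P) sin(2 pi n x) bounds the norm of a partial sum from
    below by a multiple of prod_(p <= y) (1 + p^(-alpha) / 2), while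
    log k <= theta(y) for k | P.  Hence one needs
    sum_(p <= y) p^(-alpha) >= (1 - o(1)) theta(y)^(1 - alpha) /
    ((1 - alpha) log theta(y)), which Mertens' theorem provides along a sequence of
    y, and the prime number theorem is not required. *)

Require Import Defs.
From HB Require Import structures.
From mathcomp Require Import all_boot all_order all_algebra.
From mathcomp Require Import all_classical all_reals all_analysis.
From mathcomp Require Import measurable_realfun.
From mathcomp Require Import ring lra zify.
Import Order.TTheory GRing.Theory Num.Theory.
Import numFieldNormedType.Exports.

Set Implicit Arguments.
Unset Strict Implicit.
Unset Printing Implicit Defensive.

Local Open Scope classical_set_scope.
Local Open Scope ring_scope.

(** * Sums over primes *)

(** The class is defined through Fourier coefficients, so [f] must first be identified almost
    everywhere with the sum of its Fourier series. The coefficients are O(j^-alpha) with alpha >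
    1/2, so the dyadic block sums of their squares decay geometrically, and the Rademacher-Menshov
    argument that serves sum c_k f(kx) also makes the Fourier series converge almost everywhere.
    Uniqueness avoids summation kernels: for 0 < c <= 1 the trigonometric polynomial 1/2 + sin(pi x)
    sin(pi (c - x)) / 2 exceeds 1/2 on (0, 1) exactly for x < c, and polynomials in it tend to the
    indicator of that ray. Both constants in K rest on log 4 < 3/2. The 3 majorizes 2 log 4, since
    the primes up to y enter both Euler products. The 4 majorizes 2 log 4 + 1, where 2 log 4 bounds
    the primes beyond y in one product and 1 the prime factors of k beyond y in the other. In the
    divergent example level i uses the constant 1 - 1 / (i + 2), which tends to 1, so that one
    sequence c serves every epsilon. *)

Lemma prod_primes_dvd (a b M : nat) :
  (forall p, prime p -> (a <= p < b)%N -> (p %| M)%N) ->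
  (\prod_(a <= p < b | prime p) p %| M)%N.
Proof.
elim: b => [|b IHb] hM; first by rewrite big_geq.
have [lab|lba] := leqP a b; last by rewrite big_geq // ?dvd1n.
rewrite big_mkcond big_nat_recr //= -big_mkcond /=.
have IH : (\prod_(a <= p < b | prime p) p %| M)%N.
  apply: IHb => p pp /andP[ap pb]; apply: hM => //.
  by rewrite ap ltnS ltnW.
case: ifPn => pb; last by rewrite muln1.
rewrite Gauss_dvd; first by rewrite IH hM // lab leqnn.
rewrite big_nat_cond; elim/big_rec: _ => [|p x /andP[/andP[_ ltpb] pp] cx].
  by rewrite coprime1n.
rewrite coprimeMl cx andbT prime_coprime // dvdn_prime2 //.
by rewrite neq_ltn ltpb.
Qed.

(** By symmetry this coefficient occurs twice in the expansion of (1 + 1)^(2m + 1). *)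
Lemma central_bin_le (m : nat) : ('C(m.*2.+1, m) <= 4 ^ m)%N.
Proof.
have : (2 * 'C(m.*2.+1, m) <= 2 ^ (m.*2.+1))%N.
  rewrite -[X in (_ <= X ^ _)%N]/(1 + 1)%N expnDn.
  have mN : (m < m.*2.+1.+1)%N by lia.
  have mN1 : (m.+1 < m.*2.+1.+1)%N by lia.
  rewrite (bigD1 (Ordinal mN)) //= (bigD1 (Ordinal mN1)) /=; last first.
    by apply/eqP => /(congr1 val) /=; lia.
  rewrite !exp1n !muln1 addnA.
  have -> : 'C(m.*2.+1, m.+1) = 'C(m.*2.+1, m).
    by rewrite -bin_sub; [congr ('C(_, _)); lia|lia].
  lia.
have -> : (2 ^ m.*2.+1 = 2 * 4 ^ m)%N by rewrite expnS -mul2n expnM.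
by rewrite leq_pmul2l.
Qed.

(** Erdos's induction: an even n > 2 adds no prime, and for n = 2m + 1 the primes in (m + 1, n] all
    divide ['C(n, m)], which is at most 4^m. *)
Lemma primorial_le (n : nat) : (\prod_(1 <= p < n.+1 | prime p) p <= 4 ^ n)%N.
Proof.
elim/ltn_ind: n => n IHn.
have [n0|] := leqP n 2.
  by case: n n0 IHn => [|[|[|]]] // _ _; rewrite unlock.
move=> n2; have [nodd|neven] := boolP (odd n); last first.
  rewrite big_mkcond big_nat_recr ?(ltn_trans _ n2) //= -big_mkcond /=.
  rewrite ifN; last first.
    apply/negP => pn; case: (even_prime pn) => [n_2|]; last exact/negP.
    by rewrite n_2 in n2.
  rewrite muln1 -{1}(@prednK n) ?(ltn_trans _ n2) //.
  apply: leq_trans (IHn n.-1 _) _; first by lia.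
  by rewrite leq_pexp2l // leq_pred.
have [m nE] : exists m, n = m.*2.+1.
  by exists n./2; rewrite -[LHS]odd_double_half nodd.
have m1 : (0 < m)%N by lia.
rewrite (@big_cat_nat _ _ _ m.+2) /=; [|lia..].
have -> : (4 ^ n = 4 ^ m.+1 * 4 ^ m)%N by rewrite -expnD; congr (_ ^ _)%N; lia.
apply: leq_mul; first by apply: IHn; lia.
apply: leq_trans (central_bin_le m).
rewrite dvdn_leq ?bin_gt0 //; first by lia.
apply: prod_primes_dvd => p pp /andP[mp pn].
have := bin_fact (n := n) (m := m) ltac:(lia); rewrite -nE => nf.
have : (p %| n`!)%N by rewrite dvdn_fact // prime_gt0 //; lia.
have pfact k : (k < p)%N -> ~~ (p %| k`!)%N.
  move=> kp; elim: k kp => [|k IHk] kp.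
    by rewrite fact0 dvdn1 neq_ltn (prime_gt1 pp) orbT.
  by rewrite factS Euclid_dvdM // negb_or IHk ?(ltnW kp) // andbT gtnNdvd.
rewrite -nf !Euclid_dvdM //.
have /negbTE-> := pfact m ltac:(lia).
have /negbTE-> := pfact (n - m)%N ltac:(lia).
by rewrite !orbF.
Qed.

(** * Power sums, compared with integrals by telescoping *)

Section PowerSums.
Context {R : realType}.
Implicit Types (x s b : R) (n : nat).

(** Weighted AM-GM. The bound e^u >= 1 + u is used at u = (1 - b) ln x and at u = - b ln x;
    weighting the results by b and 1 - b cancels the logarithm. *)
Lemma powR_le_affine x b : 0 < x -> 0 <= b -> b <= 1 ->
  x `^ b <= b * x + (1 - b).
Proof.
move=> x0 b0 b1; set m := x `^ b.
have m0 : 0 < m by exact: powR_gt0.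
have xneq0 : x != 0 by rewrite gt_eqF.
have h1 : x >= m * (1 + (1 - b) * ln x).
  have {2}-> : x = m * x `^ (1 - b).
    by rewrite -powRD ?xneq0 ?implybT // addrCA subrr addr0 powRr1 // ltW.
  by rewrite ler_wpM2l ?(ltW m0) // /powR (negbTE xneq0) expR_ge1Dx.
have h2 : 1 >= m * (1 - b * ln x).
  have {2}-> : 1 = m * x `^ (- b).
    by rewrite -powRD ?xneq0 ?implybT // subrr powRr0.
  by rewrite ler_wpM2l ?(ltW m0) // /powR (negbTE xneq0) -mulNr expR_ge1Dx.
have h3 := ler_wpM2l b0 h1.
have h4 : (1 - b) * (m * (1 - b * ln x)) <= (1 - b) * 1.
  by rewrite ler_wpM2l // subr_ge0.
move: h3 h4; set l := ln x; lra.
Qed.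

Lemma powR_ge_affine x b : 0 < x -> 0 <= b -> 1 - b * (x - 1) <= x `^ (- b).
Proof.
move=> x0 b0; rewrite /powR gt_eqF // (le_trans _ (expR_ge1Dx _)) //.
rewrite mulNr lerD2l lerN2 ler_wpM2l //.
by have := @le_ln1Dx R (x - 1); rewrite addrCA subrr addr0; apply; lra.
Qed.

Lemma ln_le_subr1 x : 0 < x -> ln x <= x - 1.
Proof.
move=> x0; have := @le_ln1Dx R (x - 1).
by rewrite addrCA subrr addr0; apply; lra.
Qed.

Lemma half_le_ln2 : 1 / 2 <= ln 2 :> R.
Proof.
by have := @ln_le_subr1 2^-1 ltac:(by rewrite invr_gt0); rewrite lnV ?posrE //; lra.
Qed.

Lemma powR_natN (n : nat) s : (0 < n)%N ->
  n%:R * (n%:R `^ (- s)) = n%:R `^ (1 - s) :> R.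
Proof.
move=> n0; have nn0 : n%:R != 0 :> R by rewrite pnatr_eq0 -lt0n.
by rewrite powRD ?nn0 ?implybT // powRr1.
Qed.

Lemma sum_powRN_le s n : 0 <= s -> s < 1 ->
  \sum_(1 <= k < n.+1) k%:R `^ (- s) <= n%:R `^ (1 - s) / (1 - s) :> R.
Proof.
move=> s0 s1; have t0 : 0 < 1 - s by lra.
rewrite ler_pdivlMr //; elim: n => [|n IHn].
  by rewrite big_geq // mul0r powR0 // gt_eqF.
rewrite big_nat_recr //= mulrDl; apply: (le_trans (lerD IHn (lexx _))).
have [->|n0] := posnP n.
  by rewrite powR0 ?gt_eqF // add0r !powR1 mul1r; lra.
set N := n.+1%:R : R; have N0 : 0 < N by rewrite ltr0n.
have nN : n%:R = N * (n%:R / N) :> R by rewrite mulrC divfK // gt_eqF.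
have q0 : 0 < n%:R / N :> R by rewrite divr_gt0 // ltr0n.
rewrite nN powRM ?(ltW N0) ?(ltW q0) // -(@powR_natN n.+1) // -/N.
have : (n%:R / N) `^ (1 - s) <= (1 - s) * (n%:R / N) + (1 - (1 - s)).
  by apply: powR_le_affine => //; lra.
have e : N * (n%:R / N) = N - 1.
  by rewrite mulrC divfK ?gt_eqF // /N -natr1 addrK.
set q := n%:R / N in q0 e *; set m := N `^ (- s).
have m0 : 0 <= m by exact: powR_ge0.
move=> h; have h2 := ler_wpM2l (mulr_ge0 (ltW N0) m0) h.
have e2 : N * m * q = m * (N - 1) by rewrite -e; ring.
have : N * m * ((1 - s) * q + (1 - (1 - s))) =
  (1 - s) * (m * (N - 1)) + N * m * s by rewrite -e2; ring.
by move=> e3; rewrite e3 in h2; nra.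
Qed.

Lemma sum_powRN_tail_le s (m n : nat) : 1 < s -> (0 < m)%N ->
  \sum_(m.+1 <= k < n) k%:R `^ (- s) <= m%:R `^ (1 - s) / (s - 1) :> R.
Proof.
move=> s1 m0; have t0 : 0 < s - 1 by lra.
rewrite ler_pdivlMr //.
(* The subtracted term makes the bound telescope; [maxn m n.-1] gives the right side the value 0 on
   empty ranges. *)
suff : \sum_(m.+1 <= k < n) k%:R `^ (- s) * (s - 1) <=
    m%:R `^ (1 - s) - (maxn m n.-1)%:R `^ (1 - s) :> R.
  rewrite mulr_suml => /le_trans; apply.
  by rewrite gerBl powR_ge0.
elim: n => [|n IHn]; first by rewrite big_geq //= maxn0 subrr.
have [lmn|lnm] := leqP m.+1 n; last first.
  by rewrite big_geq // (maxn_idPl _) //= ?subrr.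
rewrite big_nat_recr //=; apply: (le_trans (lerD IHn (lexx _))).
have -> : (maxn m n.-1 = n.-1)%N by apply/maxn_idPr; lia.
have -> : (maxn m n = n)%N by apply/maxn_idPr; lia.
case: n lmn {IHn} => // n; rewrite ltnS /= => lmn.
have n0 : (0 < n)%N by lia.
set N := n.+1%:R : R; have N0 : 0 < N by rewrite ltr0n.
have nN : n%:R = N * (n%:R / N) :> R by rewrite mulrC divfK // gt_eqF.
have q0 : 0 < n%:R / N :> R by rewrite divr_gt0 // ltr0n.
have -> : n%:R `^ (1 - s) = N `^ (1 - s) * (n%:R / N) `^ (1 - s) :> R.
  by rewrite {1}nN powRM ?(ltW N0) ?(ltW q0).
rewrite -(@powR_natN n.+1) // -/N.
have : 1 - (s - 1) * (n%:R / N - 1) <= (n%:R / N) `^ (- (s - 1)).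
  by apply: powR_ge_affine => //; lra.
rewrite opprB.
have e : N * (n%:R / N) = N - 1.
  by rewrite mulrC divfK ?gt_eqF // /N -natr1 addrK.
set q := n%:R / N in q0 e *; set m' := N `^ (- s).
have m'0 : 0 <= m' by exact: powR_ge0.
move=> h; have h2 := ler_wpM2l (mulr_ge0 (ltW N0) m'0) h.
have e2 : N * m' * q = m' * (N - 1) by rewrite -e; ring.
have e3 : N * m' * (1 - (s - 1) * (q - 1)) =
  N * m' * s - (s - 1) * (m' * (N - 1)) by rewrite -e2; ring.
rewrite e3 in h2.
move: h2; set z := q `^ (1 - s).
rewrite -mulrA => h2; lra.
Qed.

Lemma sum_powRN_ge b (m n : nat) : 0 < b -> (0 < m)%N -> (m <= n)%N ->
  (m%:R `^ (- b) - n%:R `^ (- b)) / b <=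
  \sum_(m <= k < n) k%:R `^ (- b - 1) :> R.
Proof.
move=> b0 m0 mn; rewrite ler_pdivrMr // mulr_suml.
elim: n mn => [|n IHn] mn; first by lia.
have [lmn|lnm] := leqP m n; last first.
  have -> : m = n.+1 by lia.
  by rewrite subrr big_geq.
rewrite big_nat_recr //=; have := IHn lmn.
have n0 : (0 < n)%N by lia.
have nn0 : n%:R != 0 :> R by rewrite pnatr_eq0 -lt0n.
have np : 0 < n%:R :> R by rewrite ltr0n.
suff : n%:R `^ (- b) - n.+1%:R `^ (- b) <= n%:R `^ (- b - 1) * b :> R by lra.
have : 1 - b * ((n.+1%:R / n%:R) - 1) <= (n.+1%:R / n%:R) `^ (- b) :> R.
  by apply: powR_ge_affine; rewrite ?divr_gt0 ?ltW.
have -> : n.+1%:R `^ (- b) = n%:R `^ (- b) * (n.+1%:R / n%:R) `^ (- b) :> R.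
  by rewrite -powRM ?divr_ge0 // mulrC divfK.
rewrite powRD ?nn0 ?implybT // powR_inv1 //.
have -> : n.+1%:R / n%:R - 1 = n%:R^-1 :> R.
  by rewrite -natr1 mulrDl divff // mul1r; ring.
set z := _ `^ (- b); set w := n%:R `^ (- b).
have w0 : 0 <= w by exact: powR_ge0.
move=> /(ler_wpM2l w0); set i := n%:R^-1; lra.
Qed.

(** Summation by parts without forming the differences of [g]: the induction keeps the surplus of
    the partial sums of [b], weighted by the current value of [g]. *)
Lemma abel_le (a b g : nat -> R) (n : nat) :
  (forall i, (0 < i)%N -> 0 <= g i) ->
  (forall i, (0 < i)%N -> g i.+1 <= g i) ->
  (forall m, \sum_(1 <= i < m.+1) a i <= \sum_(1 <= i < m.+1) b i) ->
  \sum_(1 <= i < n.+1) a i * g i <= \sum_(1 <= i < n.+1) b i * g i.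
Proof.
move=> g0 gdec ab.
have [->|n0] := posnP n; first by rewrite !big_geq.
suff : (\sum_(1 <= i < n.+1) b i - \sum_(1 <= i < n.+1) a i) * g n <=
    \sum_(1 <= i < n.+1) b i * g i - \sum_(1 <= i < n.+1) a i * g i.
  move=> h; rewrite -subr_ge0 (le_trans _ h) // mulr_ge0 ?g0 //.
  by rewrite subr_ge0 ab.
elim: n n0 => // n IHn _.
have [->|n0] := posnP n; first by rewrite !big_nat1; lra.
have := IHn n0.
rewrite ![\sum_(1 <= i < n.+2) _]big_nat_recr //=.
have := ab n; have := gdec _ n0; have := g0 _ n0.
set A := \sum_(1 <= i < _) _; set B := \sum_(1 <= i < _) _.
set C := \sum_(1 <= i < _) _; set D := \sum_(1 <= i < _) _.
move=> h1 h2 h3 h4.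
have : (B - A) * g n.+1 <= (B - A) * g n by rewrite ler_wpM2l // subr_ge0.
lra.
Qed.

End PowerSums.

(** * Chebyshev's theta function and Mertens' first theorem *)

Section Chebyshev.
Context {R : realType}.
Implicit Types (n m p : nat).

(** Primality is a numerical factor, so that sums over primes range over all integers and need no
    filter when ranges are split, swapped or compared. *)
Definition lnp (p : nat) : R := (prime p)%:R * ln p%:R.

Lemma lnp_ge0 p : 0 <= lnp p.
Proof.
rewrite /lnp; have [pp|] := boolP (prime p); last by rewrite mul0r.
by rewrite mul1r ln_ge0 // ler1n prime_gt0.
Qed.

Lemma lnpM p (x : R) : lnp p * x = if prime p then ln p%:R * x else 0.
Proof. by rewrite /lnp; case: ifP; rewrite ?mul1r // mul0r mul0r. Qed.

Definition theta n : R := \sum_(1 <= p < n.+1) lnp p.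

Lemma theta_primorial n :
  theta n = ln (\prod_(1 <= p < n.+1 | prime p) p)%N%:R.
Proof.
rewrite /theta; elim: n => [|n IHn]; first by rewrite !big_geq // ln1.
rewrite big_nat_recr //= IHn [in RHS]big_mkcond /= big_nat_recr //=.
rewrite -[in RHS]big_mkcond /= /lnp; case: ifP => pn; last first.
  by rewrite mul0r addr0 muln1.
rewrite mul1r natrM lnM ?posrE ?ltr0n //.
by rewrite prodn_cond_gt0 // => p; exact: prime_gt0.
Qed.

Lemma theta_le n : theta n <= n%:R * ln 4%:R.
Proof.
rewrite theta_primorial mulr_natl -lnXn ?ltr0n // -natrX.
rewrite ler_ln ?posrE ?ltr0n ?expn_gt0 ?ler_nat ?primorial_le //.
by rewrite prodn_cond_gt0 // => p; exact: prime_gt0.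
Qed.

Lemma ln_sum_logn n m : (0 < m)%N -> (m <= n)%N ->
  ln m%:R = \sum_(1 <= p < n.+1) lnp p * (logn p m)%:R.
Proof.
move=> m0 mn.
have -> : m%:R = (\prod_(1 <= p < n.+1) p ^ logn p m)%N%:R :> R.
  rewrite -{1}(partnT m0) (widen_partn _ mn).
  by rewrite (eq_bigl predT) // [in LHS]big_ltn // [X in (X * _)%N](_ : _ = 1%N) ?mul1n // lognE.
have -> : (\prod_(1 <= p < n.+1) p ^ logn p m)%N%:R =
    \prod_(1 <= p < n.+1) (p%:R ^+ logn p m) :> R.
  by rewrite natr_prod; apply: eq_bigr => p _; rewrite natrX.
elim: {mn} n => [|n IHn]; first by rewrite !big_geq // ln1.
rewrite !(big_nat_recr n.+1) //= lnM ?posrE ?exprn_gt0 ?ltr0n //; last first.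
  rewrite big_nat_cond; apply: prodr_gt0 => p /andP[/andP[p0 _] _].
  by rewrite exprn_gt0 // ltr0n.
rewrite IHn lnXn ?ltr0n // /lnp; congr (_ + _).
have [pp|np] := boolP (prime n.+1); first by rewrite mul1r mulr_natr.
by rewrite !mul0r lognE (negbTE np) mulr0n.
Qed.

Lemma ln_fact n : ln n`!%:R =
  \sum_(1 <= p < n.+1) lnp p * (\sum_(1 <= k < n.+1) n %/ p ^ k)%N%:R.
Proof.
have -> : ln n`!%:R = \sum_(1 <= p < n.+1) lnp p * (logn p n`!)%:R.
  suff h m : (m <= n)%N ->
      ln m`!%:R = \sum_(1 <= p < n.+1) lnp p * (logn p m`!)%:R by apply: h.
  elim: m => [|m IHm] mn.
    by rewrite fact0 ln1 big1 // => p _; rewrite logn1 mulr0.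
  rewrite factS natrM lnM ?posrE ?ltr0n ?fact_gt0 // IHm; last by lia.
  rewrite (@ln_sum_logn n) // -big_split /=; apply: eq_bigr => p _.
  by rewrite lognM ?fact_gt0 // natrD mulrDr.
apply: eq_bigr => p _; rewrite !lnpM; case: ifP => // pp.
by rewrite logn_fact.
Qed.

Definition mert n : R := \sum_(1 <= p < n.+1) lnp p * p%:R^-1.

Lemma ln_fact_ge n : (0 < n)%N -> n%:R * ln n%:R - n%:R <= ln n`!%:R :> R.
Proof.
elim: n => // n IHn _; have [->|n0] := posnP n.
  by rewrite ln1 mulr0 sub0r; lra.
have := IHn n0; rewrite factS natrM lnM ?posrE ?ltr0n ?fact_gt0 //.
have : ln (n.+1%:R / n%:R) <= n.+1%:R / n%:R - 1 :> R.
  by apply: ln_le_subr1; rewrite divr_gt0 ?ltr0n.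
have n0' : 0 < n%:R :> R by rewrite ltr0n.
rewrite ln_div ?posrE ?ltr0n // => h.
have := ler_wpM2l (ltW n0') h.
have -> : n%:R * (n.+1%:R / n%:R - 1) = 1 :> R.
  by rewrite mulrBr mulrC divfK ?gt_eqF // mulr1 -natr1; ring.
rewrite -natr1; set l := ln _; set L := ln _; lra.
Qed.

Lemma ln_fact_le n : ln n`!%:R <= n%:R * ln n%:R :> R.
Proof.
have [->|n0] := posnP n; first by rewrite mul0r ln1.
rewrite mulr_natl -lnXn ?ltr0n // -natrX ler_ln ?posrE ?ltr0n ?fact_gt0 //; last first.
  by rewrite expn_gt0 n0.
rewrite ler_nat; elim: n n0 => // n IHn _; rewrite factS expnS leq_pmul2l //.
have [->//|n0] := posnP n.
by apply: leq_trans (IHn n0) _; rewrite leq_exp2r.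
Qed.

(** Only the terms k = 1 of Legendre's formula are kept; undoing the rounding in n / p costs at most
    [theta n], hence n log 4. *)
Lemma mert_le n : (0 < n)%N -> mert n <= ln n%:R + ln 4%:R.
Proof.
move=> n0; have np : 0 < n%:R :> R by rewrite ltr0n.
rewrite -(ler_pM2l np) mulrDr.
have h1 : n%:R * mert n - theta n <= ln n`!%:R.
  rewrite ln_fact mulr_sumr -sumrB ler_sum_nat // => p /andP[p0 pn].
  have -> : n%:R * (lnp p * p%:R^-1) - lnp p = lnp p * (n%:R / p%:R - 1) by ring.
  rewrite ler_wpM2l ?lnp_ge0 //.
  apply: (@le_trans _ _ (n %/ p)%N%:R); last first.
    by rewrite ler_nat big_ltn //= expn1 leq_addr.
  have : (n < (n %/ p).+1 * p)%N by rewrite ltn_ceil.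
  rewrite -(ltr_nat R) natrM -natr1 => h.
  have pp : 0 < p%:R :> R by rewrite ltr0n.
  by rewrite lerBlDr ler_pdivrMr // ltW.
have := ln_fact_le n; have := theta_le n; lra.
Qed.

Lemma sum_ln_le2 n : \sum_(2 <= m < n.+1) ln m%:R / (m%:R * (m%:R - 1)) <= 2 :> R.
Proof.
have [n1|n1] := leqP n 1; first by rewrite big_geq.
(* The bound 2 - (2 + log n) / n telescopes and so survives the induction, unlike the constant 2. *)
suff : \sum_(2 <= m < n.+1) ln m%:R / (m%:R * (m%:R - 1)) <=
    2 - (2 + ln n%:R) / n%:R :> R.
  move=> /le_trans; apply; rewrite gerBl divr_ge0 // addr_ge0 // ln_ge0 // ler1n.
  by lia.
elim: n n1 => // n IHn; rewrite ltnS leq_eqVlt => /orP[/eqP<-|n1].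
  rewrite big_nat1; have := @ln_le_subr1 R 2 ltac:(lra).
  by rewrite (_ : 2%:R * (2%:R - 1) = 2%:R :> R); lra.
rewrite big_nat_recr //=; last by lia.
apply: (le_trans (lerD (IHn n1) (lexx _))).
have n0 : 0 < n%:R :> R by rewrite ltr0n; lia.
have n10 : 0 < n.+1%:R :> R by rewrite ltr0n; lia.
have : ln (n.+1%:R / n%:R) <= n.+1%:R / n%:R - 1 :> R.
  by apply: ln_le_subr1; rewrite divr_gt0.
rewrite ln_div ?posrE // => h.
have h2 := ler_wpM2l (ltW n10) h.
have e : n.+1%:R * (n.+1%:R / n%:R - 1) = n.+1%:R / n%:R :> R.
  by rewrite -[n.+1%:R]natr1; field; rewrite gt_eqF.
have h3 : n.+1%:R / n%:R <= 2 :> R.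
  by rewrite ler_pdivrMr // -natrM ler_nat; lia.
rewrite e in h2.
have -> : n.+1%:R - 1 = n%:R :> R by rewrite -natr1 addrK.
have e1 : n.+1%:R = n%:R + 1 :> R by rewrite -natr1.
move: h2 h3; rewrite e1 in n10 *.
set L := ln (n%:R + 1); set l := ln n%:R => h2 h3.
have : (L + (2 + L) * n%:R) <= (2 + l) * (n%:R + 1) by lra.
move=> h4.
suff : L / ((n%:R + 1) * n%:R) + (2 + L) / (n%:R + 1) <= (2 + l) / n%:R by lra.
rewrite -subr_ge0.
have -> : (2 + l) / n%:R - (L / ((n%:R + 1) * n%:R) + (2 + L) / (n%:R + 1)) =
  ((2 + l) * (n%:R + 1) - (L + (2 + L) * n%:R)) / ((n%:R + 1) * n%:R) :> R.
  by field; rewrite !gt_eqF.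
by rewrite divr_ge0 ?subr_ge0 // ltW // mulr_gt0.
Qed.

Lemma sum_lnp_le2 n :
  \sum_(1 <= p < n.+1) lnp p / (p%:R * (p%:R - 1)) <= 2 :> R.
Proof.
have [->|n0] := posnP n; first by rewrite big_geq.
rewrite big_ltn // /lnp [X in X + _](_ : _ = 0) ?add0r; last by rewrite mul0r mul0r.
apply: le_trans (sum_ln_le2 n); apply: ler_sum_nat => m /andP[m2 _].
have h : 0 <= ln m%:R / (m%:R * (m%:R - 1)) :> R.
  rewrite divr_ge0 ?ln_ge0 ?ler1n //; first by lia.
  by rewrite mulr_ge0 // subr_ge0 ler1n; lia.
by case: (prime m); rewrite ?mul1r // !mul0r.
Qed.

Lemma sum_divn_le n p : (1 < p)%N ->
  (\sum_(1 <= k < n.+1) n %/ p ^ k)%N%:R <= n%:R / (p%:R - 1) :> R.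
Proof.
move=> p1; have p0 : 0 < p%:R :> R by rewrite ltr0n; lia.
have q0 : 0 < p%:R - 1 :> R by rewrite subr_gt0 ltr1n.
rewrite natr_sum.
have h m : \sum_(1 <= k < m.+1) (n %/ p ^ k)%N%:R <=
    n%:R / (p%:R - 1) * (1 - (p%:R ^+ m)^-1) :> R.
  elim: m => [|m IHm]; first by rewrite big_geq // expr0 invr1 subrr mulr0.
  rewrite big_nat_recr //=; apply: (le_trans (lerD IHm (lexx _))).
  have : (n %/ p ^ m.+1)%N%:R <= n%:R / p%:R ^+ m.+1 :> R.
    by rewrite ler_pdivlMr ?exprn_gt0 // -natrX -natrM ler_nat leq_divM.
  move=> h; apply: (le_trans (lerD (lexx _) h)).
  rewrite le_eqVlt; apply/orP; left; apply/eqP.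
  rewrite exprS; field; rewrite expf_neq0 gt_eqF // gt_eqF //.
apply: le_trans (h n) _; rewrite -[leRHS]mulr1 ler_wpM2l //.
by rewrite divr_ge0 // ltW.
Qed.

(** Of the constant 3, one unit comes from log n! >= n log n - n, and two bound the higher prime
    powers in Legendre's formula. *)
Lemma mert_ge n : (0 < n)%N -> ln n%:R - 3 <= mert n.
Proof.
move=> n0; have np : 0 < n%:R :> R by rewrite ltr0n.
have h1 : ln n`!%:R <= n%:R * (mert n + 2).
  rewrite ln_fact.
  apply: (@le_trans _ _ (n%:R * (mert n +
      \sum_(1 <= p < n.+1) lnp p / (p%:R * (p%:R - 1))))); last first.
    by rewrite ler_wpM2l // lerD2l sum_lnp_le2.
  rewrite -big_split /= mulr_sumr ler_sum_nat // => p /andP[p0 pn].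
  rewrite !lnpM; case: ifP => pp; last by rewrite addr0 mulr0.
  have p1 := prime_gt1 pp.
  have l0 : 0 <= ln p%:R :> R by rewrite ln_ge0 // ler1n.
  apply: (le_trans (ler_wpM2l l0 (sum_divn_le n p1))).
  rewrite le_eqVlt; apply/orP; left; apply/eqP; field.
  by rewrite subr_eq0 pnatr_eq0 -lt0n p0 andbT (eqr_nat _ p 1); lia.
rewrite -(ler_pM2l np); have := ln_fact_ge n0; lra.
Qed.

End Chebyshev.
Arguments lnp {R}.
Arguments theta {R}.
Arguments mert {R}.

Section Growth.
Context {R : realType}.
Implicit Types (x a b c : R).

Lemma ln_le_powR x a : 0 < x -> 0 < a -> ln x <= x `^ a / a.
Proof.
move=> x0 a0; rewrite ler_pdivlMr // mulrC -ln_powR.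
by apply: (le_trans (ln_le_subr1 (powR_gt0 _ x0))); rewrite gerBl.
Qed.

Lemma near_powR_ge a c : 0 < a -> \forall x \near +oo, c <= x `^ a.
Proof.
move=> a0; near=> x.
have x1 : 1 <= x by near: x; exact: nbhs_pinfty_ge.
have x0 : 0 < x by rewrite (lt_le_trans ltr01).
have [c0|c0] := leP c 0; first by rewrite (le_trans c0) // powR_ge0.
have : c `^ a^-1 <= x by near: x; exact: nbhs_pinfty_ge.
move=> /(@ge0_ler_powR _ a (ltW a0) _ _ _ _); rewrite !nnegrE -powRrM mulVf ?gt_eqF //.
by rewrite powRr1 ?(ltW c0) //; apply; rewrite ?powR_ge0 // ltW.
Unshelve. all: by end_near. Qed.

(** Half of b - a absorbs the logarithm, the other half the constant. *)
Lemma near_powR_ln a b c : a < b ->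
  \forall x \near +oo, c * (x `^ a * ln x) <= x `^ b.
Proof.
move=> ab; pose d := (b - a) / 2; have d0 : 0 < d by rewrite /d; lra.
near=> x.
have x1 : 1 <= x by near: x; exact: nbhs_pinfty_ge.
have x0 : 0 < x by rewrite (lt_le_trans ltr01).
have xn0 : x != 0 by rewrite gt_eqF.
have h : `|c| / d <= x `^ d by near: x; exact: near_powR_ge.
have -> : x `^ b = x `^ a * (x `^ d * x `^ d).
  by rewrite -!powRD ?xn0 ?implybT //; congr (_ `^ _); rewrite /d; lra.
rewrite mulrCA ler_wpM2l ?powR_ge0 //.
apply: (@le_trans _ _ (`|c| * ln x)).
  by rewrite ler_wpM2r ?ln_ge0 // ler_norm.
apply: (@le_trans _ _ (`|c| * (x `^ d / d))).
  by rewrite ler_wpM2l // ln_le_powR.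
by rewrite mulrCA mulrC ler_wpM2r // powR_ge0.
Unshelve. all: by end_near. Qed.

Lemma near_ln_ge c : \forall x \near +oo, c <= ln x :> R.
Proof.
near=> x.
have x0 : 0 < x by near: x; exact: nbhs_pinfty_gt.
have h : expR c <= x by near: x; exact: nbhs_pinfty_ge.
by rewrite -[leLHS]expRK ler_ln ?posrE ?expR_gt0.
Unshelve. all: by end_near. Qed.

Lemma near_natP (P : R -> Prop) : (\forall x \near +oo, P x) ->
  exists N : nat, forall n, (N <= n)%N -> P n%:R.
Proof.
move=> [A [_ hA]]; exists (Num.truncn (`|A|)).+1 => n hn; apply: hA.
apply: (@lt_le_trans _ _ ((Num.truncn `|A|).+1)%:R); last by rewrite ler_nat.
exact: (le_lt_trans (ler_norm _) (truncnS_gt _)).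
Qed.

Lemma sum_triangle (F : nat -> nat -> R) n :
  \sum_(1 <= y < n.+1) \sum_(1 <= p < y.+1) F p y =
  \sum_(1 <= p < n.+1) \sum_(p <= y < n.+1) F p y.
Proof.
elim: n => [|n IHn]; first by rewrite !big_geq.
rewrite big_nat_recr //= IHn [RHS]big_nat_recr //= big_nat1.
rewrite [X in _ + X]big_nat_recr //= addrA; congr (_ + _).
rewrite -big_split /=; apply: eq_big_nat => p /andP[p0 pn].
by rewrite [RHS]big_nat_recr //= ltnW.
Qed.

Lemma sum_inv_le n : (0 < n)%N ->
  \sum_(1 <= k < n.+1) k%:R^-1 <= 1 + ln n%:R :> R.
Proof.
elim: n => // n IHn _; have [->|n0] := posnP n.
  by rewrite big_nat1 ln1 invr1 addr0.
rewrite big_nat_recr //=; apply: (le_trans (lerD (IHn n0) (lexx _))).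
have n0' : 0 < n%:R :> R by rewrite ltr0n.
have := @ln_le_subr1 R (n%:R / n.+1%:R); rewrite divr_gt0 ?ltr0n // => /(_ isT).
rewrite ln_div ?posrE ?ltr0n //.
have -> : n%:R / n.+1%:R - 1 = - n.+1%:R^-1 :> R.
  by rewrite -natr1; field; rewrite natr1 pnatr_eq0.
set L := ln _; set l := ln _; set i := _^-1 => h; lra.
Qed.

End Growth.

Section PrimeSums.
Context {R : realType}.
Implicit Types (n m p : nat) (s a b d : R).

Definition psum (g : nat -> R) n : R := \sum_(1 <= p < n.+1) (prime p)%:R * g p.

(** By [theta_le], Abel summation replaces the weight [lnp] by the constant log 4. *)
Lemma sum_lnp_powRN_le s n : 0 <= s -> s < 1 ->
  \sum_(1 <= p < n.+1) lnp p * p%:R `^ (- s) <= ln 4 * (n%:R `^ (1 - s) / (1 - s)).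
Proof.
move=> s0 s1.
apply: (@le_trans _ _ (\sum_(1 <= p < n.+1) ln 4 * p%:R `^ (- s))).
  apply: (@abel_le _ _ (fun=> ln 4)) => [i _|i i0|m].
  - exact: powR_ge0.
  - rewrite !powRN lef_pV2 ?posrE ?powR_gt0 ?ltr0n //.
    by rewrite ge0_ler_powR ?nnegrE // ler_nat.
  - rewrite sumr_const_nat subSS subn0 -[leRHS]mulr_natl.
    exact: theta_le.
rewrite -mulr_sumr ler_wpM2l ?ln_ge0 ?ler1n //.
exact: sum_powRN_le.
Qed.

Lemma ln_prime_gt0 p : prime p -> 0 < ln p%:R :> R.
Proof. by move=> pp; rewrite ln_gt0 // ltr1n prime_gt1. Qed.

(* Primes with [ln p <= d * ln n] are estimated trivially; for the others the
   weight [ln p] can be inserted at the cost of a factor [1 / (d * ln n)]. *)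
Lemma psum_powRN_le a d n : 0 < a -> a < 1 -> 0 < d -> d < 1 -> (1 < n)%N ->
  psum (fun p => p%:R `^ (- a)) n <=
  2 / (1 - a) * n%:R `^ ((1 - a) * (1 + d) / 2) +
  ln 4 / ((1 - a) * d) * (n%:R `^ (1 - a) / ln n%:R).
Proof.
move=> a0 a1 d0 d1 n1; set b := 1 - a; have b0 : 0 < b by rewrite /b; lra.
have ln0 : 0 < ln n%:R :> R by rewrite ln_gt0 // ltr1n.
have np : 0 < n%:R :> R by rewrite ltr0n; lia.
have nn0 : n%:R != 0 :> R by rewrite gt_eqF.
(* For p <= n^d the factor p^(b / 2) taken out of p^(-a) is at most n^(d b / 2), and what remains
   may be summed over all integers up to n. *)
pose S1 : R := \sum_(1 <= p < n.+1) p%:R `^ (- (1 - b / 2)).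
pose S2 : R := \sum_(1 <= p < n.+1) lnp p * p%:R `^ (- a).
have hS1 : S1 <= n%:R `^ (b / 2) / (b / 2).
  have := @sum_powRN_le R (1 - b / 2) n.
  by rewrite (_ : 1 - (1 - b / 2) = b / 2); [apply; rewrite /b; lra|ring].
have hS2 : S2 <= ln 4 * (n%:R `^ b / b) by apply: sum_lnp_powRN_le => //; lra.
apply: (@le_trans _ _ (n%:R `^ (d * (b / 2)) * S1 + (d * ln n%:R)^-1 * S2)); last first.
  apply: lerD.
    apply: (le_trans (ler_wpM2l (powR_ge0 _ _) hS1)).
    rewrite mulrA -powRD ?nn0 ?implybT //.
    have -> : d * (b / 2) + b / 2 = b * (1 + d) / 2 by field.
    by rewrite le_eqVlt; apply/orP; left; apply/eqP; field; rewrite gt_eqF.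
  have dl0 : 0 <= (d * ln n%:R)^-1 by rewrite invr_ge0 ltW // mulr_gt0.
  apply: (le_trans (ler_wpM2l dl0 hS2)).
  by rewrite le_eqVlt; apply/orP; left; apply/eqP; field; rewrite !gt_eqF.
rewrite /psum /S1 /S2 !mulr_sumr -big_split /=; apply: ler_sum_nat => p /andP[p0 pn].
have p0' : 0 < p%:R :> R by rewrite ltr0n.
have pn0 : p%:R != 0 :> R by rewrite gt_eqF.
rewrite lnpM; case: ifP => pp; last first.
  by rewrite mul0r mulr0 addr0 mulr_ge0 // powR_ge0.
rewrite mul1r; have lp0 := ln_prime_gt0 pp.
have [hl|hl] := leP (ln p%:R) (d * ln n%:R).
  rewrite -[leLHS]addr0; apply: lerD; last first.
    by rewrite mulr_ge0 ?mulr_ge0 ?powR_ge0 ?invr_ge0 ?mulr_ge0 // ltW.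
  have -> : - a = b / 2 + - (1 - b / 2) by rewrite /b; field.
  rewrite [leLHS]powRD ?pn0 ?implybT // ler_wpM2r ?powR_ge0 //.
  rewrite powRrM ge0_ler_powR ?nnegrE ?powR_ge0 ?(ltW p0') //; first by lra.
  by rewrite -ler_ln ?posrE ?powR_gt0 // ln_powR.
rewrite -[leLHS]add0r; apply: lerD; first by rewrite mulr_ge0 // powR_ge0.
rewrite mulrA -[leLHS]mul1r ler_wpM2r ?powR_ge0 //.
by rewrite mulrC ler_pdivlMr ?mulr_gt0 // mul1r ltW.
Qed.

Lemma psum_powRN_tail_le s y n : 1 < s -> (1 < y)%N ->
  \sum_(y.+1 <= p < n.+1) (prime p)%:R * p%:R `^ (- s) <=
  ln 4 * (s / (s - 1)) * (y%:R `^ (1 - s) / ln y%:R).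
Proof.
move=> s1 y1; have t0 : 0 < s - 1 by lra.
have ly0 : 0 < ln y%:R :> R by rewrite ln_gt0 // ltr1n.
have yp : 0 < y%:R :> R by rewrite ltr0n; lia.
have [ny|yn] := leqP n y.
  rewrite big_geq // mulr_ge0 //; last by rewrite divr_ge0 ?powR_ge0 // ltW.
  by rewrite mulr_ge0 ?ln_ge0 ?ler1n // divr_ge0 // ltW // (lt_trans _ s1).
pose a p : R := if (y < p)%N then lnp p else 0.
(* Only an upper bound for theta is used, so the primes up to y cannot be subtracted from it; the
   mass y log 4 that they might lack is placed at y + 1. This turns the factor 1 / (s - 1) into s /
   (s - 1). *)
pose bb (p : nat) : R := if (y < p)%N then ln 4 + (p == y.+1)%:R * (y%:R * ln 4) else 0.
have l4 : 0 <= ln 4 :> R by rewrite ln_ge0 ?ler1n.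
have h : \sum_(1 <= p < n.+1) a p * p%:R `^ (- s) <=
         \sum_(1 <= p < n.+1) bb p * p%:R `^ (- s).
  apply: abel_le => [i _|i i0|m].
  - exact: powR_ge0.
  - rewrite !powRN lef_pV2 ?posrE ?powR_gt0 ?ltr0n //.
    by rewrite ge0_ler_powR ?nnegrE ?ler_nat //; lra.
  - have [my|my] := leqP m y.
      rewrite !big_nat !big1 // => i /andP[_ im]; rewrite /a /bb ltnNge (_ : (i <= y)%N) //; lia.
    apply: (@le_trans _ _ (m%:R * ln 4)).
      apply: le_trans (theta_le m); apply: ler_sum => i _; rewrite /a.
      by case: ifP => // _; exact: lnp_ge0.
    rewrite (@big_cat_nat _ _ _ y.+1) //=; last by lia.
    rewrite [X in _ <= X + _]big_nat big1 ?add0r; last first.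
      by move=> i /andP[_ iy]; rewrite /bb ltnNge (_ : (i <= y)%N) //; lia.
    rewrite big_ltn; last by lia.
    rewrite /bb ltnSn eqxx mul1r.
    rewrite (eq_big_nat _ _ (F2 := fun=> ln 4)); last first.
      move=> i /andP[yi _].
      by rewrite (ltn_trans (ltnSn _) yi) gtn_eqF // mul0r addr0.
    rewrite sumr_const_nat -[X in _ <= _ + X]mulr_natl -[X in _ <= X + _ + _]mul1r -!mulrDl.
    rewrite ler_wpM2r // -[1]/(1%:R) -!natrD ler_nat; lia.
have hb : \sum_(1 <= p < n.+1) bb p * p%:R `^ (- s) <=
    ln 4 * (s / (s - 1)) * y%:R `^ (1 - s).
  rewrite (@big_cat_nat _ _ _ y.+1) //=; last by lia.
  rewrite [X in X + _ <= _]big_nat big1 ?add0r; last first.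
    by move=> i /andP[_ iy]; rewrite /bb ltnNge (_ : (i <= y)%N) ?mul0r //; lia.
  have e : \sum_(y.+1 <= p < n.+1) bb p * p%:R `^ (- s) =
     ln 4 * (\sum_(y.+1 <= p < n.+1) p%:R `^ (- s)) +
     ln 4 * (y%:R * y.+1%:R `^ (- s)).
    rewrite [in LHS]big_ltn; last by lia.
    rewrite [in RHS]big_ltn; last by lia.
    rewrite /bb ltnSn eqxx mul1r mulrDr mulr_sumr.
    rewrite (eq_big_nat _ _ (F2 := fun i => ln 4 * i%:R `^ (- s))); last first.
      move=> i /andP[yi _].
      by rewrite (ltn_trans (ltnSn _) yi) gtn_eqF // mul0r addr0.
    set Z := \sum_(_ <= _ < _) _; ring.
  rewrite e -mulrDr -mulrA ler_wpM2l //.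
  have -> : s / (s - 1) = 1 / (s - 1) + 1 by field; rewrite gt_eqF.
  rewrite mulrDl mul1r; apply: lerD; rewrite ?mul1r.
    by rewrite mulrC; apply: sum_powRN_tail_le => //; lia.
  rewrite -powR_natN; last by lia.
  rewrite ler_wpM2l // !powRN lef_pV2 ?posrE ?powR_gt0 ?ltr0n //.
    by rewrite ge0_ler_powR ?nnegrE ?ler_nat //; lra.
  lia.
rewrite mulrA ler_pdivlMr //; apply: le_trans hb; apply: le_trans h.
rewrite [leRHS](@big_cat_nat _ _ _ y.+1) //=; last by lia.
rewrite [X in _ <= X + _]big_nat [X in _ <= X + _]big1 ?add0r; last first.
  by move=> i /andP[_ iy]; rewrite /a ltnNge (_ : (i <= y)%N) ?mul0r //; lia.
rewrite mulr_suml; apply: ler_sum_nat => p /andP[yp' pn].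
rewrite /a (_ : (y < p)%N) // lnpM; case: ifP => pp; last by rewrite !mul0r.
rewrite mul1r mulrC ler_wpM2r ?powR_ge0 // ler_ln ?posrE ?ltr0n ?ler_nat //; lia.
Qed.

Lemma theta_homo m n : (m <= n)%N -> theta m <= theta n :> R.
Proof.
move=> mn; rewrite /theta [leRHS](@big_cat_nat _ _ _ m.+1) //=.
by rewrite lerDl sumr_ge0 // => i _; exact: lnp_ge0.
Qed.

(* The two Mertens bounds show that a fixed proportion of the mass of [mert]
   sits in [(m, C * m]] as soon as C is large. *)
Lemma theta_mul_ge :
  exists2 C : nat, (0 < C)%N & forall m, (0 < m)%N -> m%:R <= theta (C * m) :> R.
Proof.
have l2 := @half_le_ln2 R.
have e2 : ln 4%:R = 2%:R * ln 2 :> R.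
  by rewrite mulr_natl -lnXn // -natrX.
have [C C0 lC] : exists2 C : nat, (0 < C)%N & ln C%:R = 10%:R * ln 2 :> R.
  (* For C = 2^10 the Mertens bounds give mert (C m) - mert m >= log C - 3 - log 4 = 8 log 2 - 3,
     and log 2 >= 1/2 makes this at least 1. *)
  by exists (2 ^ 10)%N; rewrite ?expn_gt0 // natrX lnXn // mulr_natl.
exists C => // m m0; have mp : 0 < m%:R :> R by rewrite ltr0n.
have h1 := @mert_ge R (C * m)%N ltac:(lia); have h2 := @mert_le R m m0.
have mC : (m <= C * m)%N by rewrite leq_pmull.
have : mert (C * m) - mert m <= theta (C * m) / m%:R :> R.
  rewrite /mert /theta (@big_cat_nat _ _ _ m.+1) //=.
  rewrite addrAC subrr add0r.
  rewrite [in leRHS](@big_cat_nat _ _ _ m.+1) //=.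
  rewrite mulrDl -[leLHS]add0r; apply: lerD.
    by rewrite divr_ge0 // sumr_ge0 // => i _; exact: lnp_ge0.
  rewrite mulr_suml; apply: ler_sum_nat => p /andP[mp' _].
  by rewrite ler_wpM2l ?lnp_ge0 // lef_pV2 ?posrE ?ltr0n ?ler_nat //; lia.
rewrite natrM lnM ?posrE ?ltr0n // in h1.
rewrite ler_pdivlMr // => h; rewrite lC in h1; rewrite e2 in h2.
have : 1 <= mert (C * m) - mert m :> R by lra.
by move=> /(ler_wpM2r (ltW mp)); rewrite mul1r => /le_trans; apply.
Qed.

Lemma theta_linear :
  exists2 c : R, 0 < c & exists N : nat, forall n, (N <= n)%N -> c * n%:R <= theta n.
Proof.
have [C C0 hC] := theta_mul_ge; exists (2 * C)%:R^-1.
  by rewrite invr_gt0 ltr0n muln_gt0.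
exists (2 * C)%N => n nC; have d0 : (0 < n %/ C)%N by rewrite divn_gt0 //; lia.
rewrite mulrC; apply: (@le_trans _ _ (n %/ C)%:R).
  rewrite ler_pdivrMr ?ltr0n ?muln_gt0 // -natrM ler_nat.
  have := ltn_ceil n C0; have : (C <= (n %/ C) * C)%N by rewrite leq_pmull.
  by rewrite mulSn mulnCA; lia.
by apply: (le_trans (hC _ d0)); apply: theta_homo; rewrite mulnC leq_divM.
Qed.

End PrimeSums.

(** * Lower bound for sums of p^(-a) along a sequence *)

Section PrimeSumLowerBound.
Context {R : realType}.
Implicit Types (n m p y : nat).

Let F a n : R := \sum_(1 <= p < n.+1) lnp p * p%:R `^ (- a).

Let F_homo a m n : (m <= n)%N -> F a m <= F a n.
Proof.
move=> mn; rewrite /F [leRHS](@big_cat_nat _ _ _ m.+1) //=.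
by rewrite lerDl sumr_ge0 // => i _; rewrite mulr_ge0 ?lnp_ge0 ?powR_ge0.
Qed.

Let F_le_psum a n : F a n <= ln n%:R * psum (fun p => p%:R `^ (- a)) n.
Proof.
rewrite /F /psum mulr_sumr; apply: ler_sum_nat => p /andP[p0 pn].
rewrite lnpM; case: ifP => pp; last by rewrite mul0r mulr0.
rewrite mul1r ler_wpM2r ?powR_ge0 // ler_ln ?posrE ?ltr0n ?ler_nat //; lia.
Qed.

(** After the sums are exchanged, the inner sum over y >= p is about p^(a - 1) / (1 - a), which
    turns p^(-a) into 1 / p and the whole into Mertens' sum. The cut at n costs n^(a - 1) F a n,
    bounded by Chebyshev's estimate. *)
Let sum_F_ge a n : 0 < a -> a < 1 ->
  (mert n - ln 4 / (1 - a)) / (1 - a) <=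
  \sum_(1 <= y < n.+1) y%:R `^ (- (1 - a) - 1) * F a y.
Proof.
move=> a0 a1; set b := 1 - a; have b0 : 0 < b by rewrite /b; lra.
have N0 : 0 < n.+1%:R :> R by rewrite ltr0n.
under eq_bigr do rewrite mulr_sumr.
rewrite (sum_triangle (fun p y => y%:R `^ (- b - 1) * (lnp p * p%:R `^ (- a)))).
apply: (@le_trans _ _ (\sum_(1 <= p < n.+1)
    (p%:R `^ (- b) - n.+1%:R `^ (- b)) / b * (lnp p * p%:R `^ (- a)))); last first.
  apply: ler_sum_nat => p /andP[p0 pn]; rewrite -mulr_suml ler_wpM2r //.
    by rewrite mulr_ge0 ?lnp_ge0 ?powR_ge0.
  by apply: sum_powRN_ge => //; exact: ltnW.
have -> : \sum_(1 <= p < n.+1)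
    (p%:R `^ (- b) - n.+1%:R `^ (- b)) / b * (lnp p * p%:R `^ (- a)) =
    (mert n - n.+1%:R `^ (- b) * F a n) / b.
  rewrite mulrBl [mert n]/mert [F a n]/F mulr_sumr !mulr_suml -sumrB.
  apply: eq_big_nat => p /andP[p0 pn].
  have pn0 : p%:R != 0 :> R by rewrite pnatr_eq0 -lt0n.
  have e : p%:R^-1 = p%:R `^ (- b) * p%:R `^ (- a) :> R.
    rewrite -powRD ?pn0 ?implybT // -powR_inv1 //.
    by congr (_ `^ _); rewrite /b; ring.
  by rewrite e; ring.
rewrite ler_pM2r ?invr_gt0 // lerD2l lerN2.
have h : F a n <= ln 4 * (n%:R `^ b / b).
  by apply: sum_lnp_powRN_le => //; exact: ltW.
apply: (le_trans (ler_wpM2l (powR_ge0 _ _) h)).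
rewrite mulrCA ler_wpM2l ?ln_ge0 ?ler1n // mulrA -[leRHS]mul1r.
rewrite ler_pM2r ?invr_gt0 // powRN mulrC ler_pdivrMr ?powR_gt0 // mul1r.
by rewrite ge0_ler_powR ?nnegrE ?ler_nat // ltW.
Qed.

(** The same exchange of sums; the tail of 1 / y^2 from p on is at most 1 / p + 1 / (p (p - 1)). *)
Let sum_theta_le n : (0 < n)%N ->
  \sum_(1 <= y < n.+1) y%:R `^ (- 2) * theta y <= ln n%:R + ln 4 + 2 :> R.
Proof.
move=> n0; under eq_bigr do rewrite mulr_sumr.
rewrite (sum_triangle (fun p y => y%:R `^ (- 2) * lnp p)).
apply: (@le_trans _ _ (mert n + \sum_(1 <= p < n.+1) lnp p / (p%:R * (p%:R - 1)))).
  rewrite /mert -big_split /=; apply: ler_sum_nat => p /andP[p0 pn].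
  have p0' : 0 < p%:R :> R by rewrite ltr0n.
  rewrite -mulr_suml mulrC -mulrDr /lnp; case: (boolP (prime p)) => [pp|_]; last by rewrite !mul0r.
  rewrite !mul1r ler_wpM2l ?ln_ge0 ?ler1n // big_ltn // addrC.
  have := @sum_powRN_tail_le R 2 p n.+1 ltac:(lra) p0.
  rewrite (_ : 1 - 2 = - 1 :> R); last by ring.
  rewrite (_ : 2 - 1 = 1 :> R); last by ring.
  rewrite divr1 powR_inv1 // => h; apply: lerD => //.
  have p1 : 1 < p%:R :> R by rewrite ltr1n prime_gt1.
  have q0 : 0 < p%:R - 1 :> R by rewrite subr_gt0.
  rewrite powR_invn // lef_pV2 ?posrE ?mulr_gt0 ?exprn_gt0 //.
  by rewrite expr2 ler_wpM2l // gerBl.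
apply: (lerD (mert_le n0)); exact: sum_lnp_le2.
Qed.

(** With b = 1 - a, [powR_le_affine] gives (theta y / y)^b <= b theta y / y + 1 - b. The two weights
    add up to 1, so log n keeps the coefficient 1; the contradiction in [psum_powRN_ge] rests on
    this. *)
Let sum_theta_powR_le a n : 0 < a -> a < 1 -> (0 < n)%N ->
  \sum_(1 <= y < n.+1) y%:R `^ (- (1 - a) - 1) * theta y `^ (1 - a) <=
  ln n%:R + ln 4 + 3 :> R.
Proof.
move=> a0 a1 n0; set b := 1 - a; have b0 : 0 < b by rewrite /b; lra.
have b1 : b < 1 by rewrite /b; lra.
apply: (@le_trans _ _ (b * (\sum_(1 <= y < n.+1) y%:R `^ (- 2) * theta y) +
    (1 - b) * \sum_(1 <= y < n.+1) y%:R^-1)).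
  rewrite !mulr_sumr -big_split /=; apply: ler_sum_nat => y /andP[y0 _].
  have y0' : 0 < y%:R :> R by rewrite ltr0n.
  have yn0 : y%:R != 0 :> R by rewrite gt_eqF.
  have := @theta_homo R 0 y isT; rewrite {1}/theta big_geq //.
  rewrite le_eqVlt => /orP[/eqP<-|th0].
    rewrite powR0 ?gt_eqF // !mulr0 add0r mulr_ge0 ?invr_ge0 //; lra.
  have -> : y%:R `^ (- b - 1) * theta y `^ b = y%:R^-1 * (theta y / y%:R) `^ b.
    rewrite powRM ?invr_ge0 // ?ltW // -[y%:R^-1 in RHS]powR_inv1 //.
    rewrite -powRrM powRD ?yn0 ?implybT // mulN1r; ring.
  have := @powR_le_affine R (theta y / y%:R) b ltac:(by rewrite divr_gt0) (ltW b0) (ltW b1).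
  move=> /(ler_wpM2l (x := y%:R^-1) ltac:(by rewrite invr_ge0)) /le_trans; apply.
  rewrite powR_invn // le_eqVlt; apply/orP; left; apply/eqP; field.
  by rewrite gt_eqF.
have h1 := sum_theta_le n0; have h2 := @sum_inv_le R n n0.
have h3 := ler_wpM2l (ltW b0) h1.
have h4 : (1 - b) * (\sum_(1 <= y < n.+1) y%:R^-1) <= (1 - b) * (1 + ln n%:R).
  by rewrite ler_wpM2l // subr_ge0 ltW.
have l4 : 0 <= ln 4 :> R by rewrite ln_ge0 // ler1n.
have : (1 - b) * (1 + ln n%:R) <= (1 - b) * (ln n%:R + ln 4 + 3).
  rewrite ler_wpM2l ?subr_ge0 ?ltW //; lra.
move: h3 h4; set l := ln n%:R; set u := \sum_(_ <= _ < _) _; set v := \sum_(_ <= _ < _) _.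
lra.
Qed.

(* Without the prime number theorem the bound with constant [q < 1] is only
   obtained along a sequence: if it failed for all large y, summing it against
   y^(a - 2) would contradict Mertens' estimate, by concavity of t^(1 - a). *)
Lemma psum_powRN_ge a q (Y : nat) : 0 < a -> a < 1 -> 0 < q -> q < 1 ->
  exists2 y : nat, (Y <= y)%N &
    q / (1 - a) * (theta y `^ (1 - a) / ln (theta y)) <=
    psum (fun p => p%:R `^ (- a)) y :> R.
Proof.
move=> a0 a1 q0 q1; set b := 1 - a; have b0 : 0 < b by rewrite /b; lra.
apply: contrapT => hN.
have H y : (Y <= y)%N ->
    psum (fun p => p%:R `^ (- a)) y < q / b * (theta y `^ b / ln (theta y)).
  by move=> Yy; rewrite ltNge; apply/negP => h; apply: hN; exists y.
pose q' := (1 + q) / 2; have q'1 : q' < 1 by rewrite /q'; lra.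
have qq' : q < q' by rewrite /q'; lra.
have [c c0 [N hN']] := @theta_linear R.
(* Since theta y >= c y, log y <= log theta y - log c; once log theta y >= L0, the shift by log c is
   absorbed in passing from q to q'. *)
pose L0 := `|ln c| * q / (q' - q).
have [M hM] := near_natP (near_ln_ge (L0 - ln c + 1)).
pose Y1 := (maxn (maxn Y N) (maxn M 1)).
have L00 : 0 <= L0 by rewrite /L0 divr_ge0 ?mulr_ge0 ?subr_ge0 // ltW.
have claim1 y : (Y1 <= y)%N -> F a y <= q' / b * theta y `^ b.
  rewrite !geq_max => /andP[/andP[yY yN] /andP[yM y0]].
  have yp : 0 < y%:R :> R by rewrite ltr0n.
  have hth := hN' _ yN; have cy0 : 0 < c * y%:R by rewrite mulr_gt0.
  have th0 : 0 < theta y :> R by exact: lt_le_trans hth.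
  have hl : ln c + ln y%:R <= ln (theta y) by rewrite -lnM ?posrE // ler_ln ?posrE.
  have := hM _ yM => hl2.
  have lt0 : 0 < ln (theta y) :> R by lra.
  have hL : L0 <= ln (theta y) by lra.
  have ly0 : 0 <= ln y%:R :> R by rewrite ln_ge0 // ler1n.
  apply: (le_trans (F_le_psum a y)).
  apply: (le_trans (ler_wpM2l ly0 (ltW (H _ yY)))).
  have -> : ln y%:R * (q / b * (theta y `^ b / ln (theta y))) =
     (q * ln y%:R / ln (theta y)) / b * theta y `^ b.
    by field; rewrite !gt_eqF.
  rewrite ler_wpM2r ?powR_ge0 // ler_pM2r ?invr_gt0 // ler_pdivrMr //.
  have hq : q * ln y%:R <= q * (ln (theta y) - ln c) by rewrite ler_wpM2l //; lra.
  apply: (le_trans hq).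
  have : `|ln c| * q <= ln (theta y) * (q' - q) by rewrite -ler_pdivrMr // subr_gt0.
  have : - (ln c) * q <= `|ln c| * q by rewrite ler_wpM2r ?(ltW q0) // -normrN ler_norm.
  lra.
pose C1 := F a Y1.
have C10 : 0 <= C1.
  by rewrite /C1 /F sumr_ge0 // => i _; rewrite mulr_ge0 ?lnp_ge0 ?powR_ge0.
have claim2 y : F a y <= q' / b * theta y `^ b + C1.
  have [h|h] := leqP Y1 y; first by rewrite (le_trans (claim1 _ h)) // lerDl.
  rewrite (le_trans (F_homo _ (ltnW h))) // lerDr mulr_ge0 ?powR_ge0 // divr_ge0 ?ltW //.
  by rewrite (lt_trans q0).
(* K0 collects everything that stays bounded in the comparison with Mertens' sum, which becomes (1 -
   q') log X' <= K0. *)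
pose K0 := 3 + ln 4 / b + q' * (ln 4 + 3) + C1 * (1 + 1 / b) * b.
have [X hX] := near_natP (near_ln_ge (K0 / (1 - q') + 1)).
have [X' XX' X'0] : exists2 X', (X <= X')%N & (0 < X')%N by exists X.+1.
have := hX _ XX'.
have h1 := @sum_F_ge a X' a0 a1; have h2 := @mert_ge R _ X'0.
have h3 : \sum_(1 <= y < X'.+1) y%:R `^ (- b - 1) * F a y <=
   q' / b * (ln X'%:R + ln 4 + 3) + C1 * (1 + 1 / b).
  apply: (@le_trans _ _ (q' / b * (\sum_(1 <= y < X'.+1) y%:R `^ (- b - 1) * theta y `^ b) +
     C1 * \sum_(1 <= y < X'.+1) y%:R `^ (- (b + 1)))).
    rewrite !mulr_sumr -big_split /=; apply: ler_sum_nat => y _.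
    apply: (le_trans (ler_wpM2l (powR_ge0 _ _) (claim2 y))).
    rewrite (opprD b 1) le_eqVlt; apply/orP; left; apply/eqP; ring.
  apply: lerD.
    rewrite ler_wpM2l ?sum_theta_powR_le // divr_ge0 ?ltW //.
    by rewrite (lt_trans q0).
  rewrite ler_wpM2l // big_ltn // powR1 lerD2l.
  have := @sum_powRN_tail_le R (b + 1) 1 X'.+1 ltac:(lra) isT.
  by rewrite powR1 addrK.
have l4 : 0 <= ln 4 :> R by rewrite ln_ge0 // ler1n.
have h4 := le_trans h1 h3.
rewrite ler_pdivrMr // in h4.
have e : (q' / b * (ln X'%:R + ln 4 + 3) + C1 * (1 + 1 / b)) * b =
  q' * (ln X'%:R + ln 4 + 3) + C1 * (1 + 1 / b) * b by field; rewrite gt_eqF.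
rewrite e in h4 => h5.
have h6 : K0 / (1 - q') * (1 - q') <= (ln X'%:R - 1) * (1 - q').
  by rewrite ler_wpM2r ?subr_ge0 ?(ltW q'1) //; lra.
rewrite divfK ?gt_eqF ?subr_gt0 // in h6.
rewrite /K0 in h6; rewrite -/b in h4.
move: h6 h4 h2; set z := C1 * _ * b; set w := ln 4 / b; set l := ln _; set m := mert _.
move=> h6 h4 h2; lra.
Qed.

End PrimeSumLowerBound.

(** * Greatest common divisor sums *)

Section GcdSums.
Context {R : realType}.
Implicit Types (k l m n p d N B : nat).

Lemma sum_multiples (V : nmodType) (g : nat -> V) N d : (0 < d)%N ->
  \sum_(1 <= m < N.+1 | (d %| m)%N) g m =
  \sum_(1 <= m < (N %/ d).+1) g (d * m)%N.
Proof.
move=> d0; elim: N => [|N IHN]; first by rewrite div0n !big_geq.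
rewrite big_mkcond big_nat_recr //= -big_mkcond /= IHN divnS //.
case: ifPn => dN; last by rewrite addr0.
rewrite add1n [RHS]big_nat_recr //=; congr (_ + g _).
by have := divnK dN; rewrite divnS // dN; lia.
Qed.

(** Cauchy-Schwarz, by expanding the nonnegative sum of w (x / w - X / U)^2. U need only bound the
    total weight, so truncated sums can share one U. *)
Lemma sqr_sum_le (I : Type) (r : seq I) (P : pred I) (x w : I -> R) (U : R) :
  (forall i, P i -> 0 < w i) -> 0 < U -> \sum_(i <- r | P i) w i <= U ->
  (\sum_(i <- r | P i) x i) ^+ 2 <= U * \sum_(i <- r | P i) (x i ^+ 2 / w i).
Proof.
move=> w0 U0 wU; set X := \sum_(i <- r | P i) x i.
set Q := \sum_(i <- r | P i) _.
have : 0 <= \sum_(i <- r | P i) w i * (x i / w i - X / U) ^+ 2.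
  by apply: sumr_ge0 => i Pi; rewrite mulr_ge0 ?sqr_ge0 // ltW // w0.
have -> : \sum_(i <- r | P i) w i * (x i / w i - X / U) ^+ 2 =
    Q - 2 * (X / U) * X + (X / U) ^+ 2 * \sum_(i <- r | P i) w i.
  rewrite /Q {3}/X !mulr_sumr -sumrB -big_split /=; apply: eq_bigr => i Pi.
  by field; rewrite (gt_eqF (w0 _ Pi)) (gt_eqF U0).
move=> h; have h2 := ler_wpM2l (sqr_ge0 (X / U)) wU.
have e : (X / U) ^+ 2 * U = X ^+ 2 / U by field; rewrite gt_eqF.
have e2 : 2 * (X / U) * X = 2 * (X ^+ 2 / U) by field; rewrite gt_eqF.
rewrite mulrC -ler_pdivrMr //; rewrite e in h2; rewrite e2 in h; lra.
Qed.

Definition smooth B m := all (fun p => p < B)%N (primes m).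

(* Splitting off the multiples of the largest prime B gives
   A (B + 1) <= A B + phi B * A (B + 1) for the partial sums A over B-smooth
   numbers. *)
Lemma sum_le_euler_prod (phi : nat -> R) (S : pred nat) N :
  phi 1%N = 1 -> (forall m, 0 <= phi m) ->
  (forall p m, prime p -> (0 < m)%N -> phi (p * m)%N = phi p * phi m) ->
  (forall p, prime p -> S p -> (p <= N)%N -> phi p < 1) ->
  (forall p m, prime p -> (0 < m)%N -> S (p * m)%N -> S p /\ S m) ->
  \sum_(1 <= m < N.+1 | S m) phi m <=
  \prod_(1 <= p < N.+1 | prime p && S p) (1 - phi p)^-1.
Proof.
move=> phi1 phi0 phiM phip Sdvd.
(* [S] passes to the factors of its elements that occur here, so the argument covers the sum over
   all m as well as the sum over the divisors of a fixed k. *)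
pose A B := \sum_(1 <= m < N.+1 | S m && smooth B m) phi m.
have A0 B : 0 <= A B by rewrite sumr_ge0.
have step B : (B <= N)%N -> A B.+1 <= (if prime B && S B then (1 - phi B)^-1 else 1) * A B.
  move=> BN.
  have smoothS m : smooth B.+1 m -> ~~ ((B \in primes m)) -> smooth B m.
    move=> /allP h /negP hB; apply/allP => p pm; have := h _ pm.
    by rewrite ltnS leq_eqVlt => /orP[/eqP pB|//]; case: hB; rewrite -pB.
  have Adiv m : (0 < m)%N -> prime B -> (B \in primes m) = (B %| m)%N.
    by move=> m0 pB; rewrite mem_primes pB m0.
  case: ifPn => [/andP[pB SB]|nB]; last first.
    rewrite mul1r /A [leLHS]big_nat_cond [leRHS]big_nat_cond.
    rewrite [leLHS]big_mkcond [leRHS]big_mkcond.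
    apply: ler_sum => m _; case: ifPn => [/andP[/andP[m0 mN] /andP[Sm sm]]|_]; last by case: ifP.
    rewrite m0 mN Sm smoothS //=; apply/negP => Bm.
    have [pB Bdvd] : prime B /\ (B %| m)%N by move: Bm; rewrite mem_primes => /and3P[].
    move: nB; rewrite pB /= => /negP; apply.
    have e : m = (B * (m %/ B))%N by rewrite mulnC divnK.
    rewrite e in Sm; apply: (Sdvd _ _ pB _ Sm).1.
    by rewrite divn_gt0 ?prime_gt0 // dvdn_leq.
  have pos : 0 < 1 - phi B by rewrite subr_gt0 phip.
  rewrite mulrC ler_pdivlMr // mulrBr mulr1 lerBlDr.
  rewrite {1}/A (bigID (fun m => ~~ (B %| m)%N)) /=; apply: lerD.
    rewrite /A [leLHS]big_nat_cond [leRHS]big_nat_cond.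
    rewrite [leLHS]big_mkcond [leRHS]big_mkcond.
    apply: ler_sum => m _; case: ifPn => [|_]; last by case: ifP.
    move=> /andP[/andP[m0 mN] /andP[/andP[Sm sm] Bm]].
    by rewrite m0 mN Sm smoothS //= Adiv.
  rewrite [leLHS](eq_bigl (fun m => (B %| m)%N && (S m && smooth B.+1 m))); last first.
    by move=> m; rewrite negbK andbC.
  rewrite big_mkcondr sum_multiples ?prime_gt0 //=.
  rewrite mulrC /A mulr_sumr big_mkcond /=.
  rewrite [leRHS](@big_cat_nat _ _ _ (N %/ B).+1) //=; last first.
    by rewrite ltnS leq_div.
  rewrite -[leLHS]addr0; apply: lerD; last first.
    rewrite big_mkcond; apply: sumr_ge0 => m _; case: ifP => // _.
    by rewrite mulr_ge0.
  rewrite [leRHS]big_mkcond; apply: ler_sum_nat => m /andP[m0 mN].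
  case: ifPn => [/andP[SBm sBm]|_]; last by case: ifP; rewrite ?mulr_ge0.
  rewrite (Sdvd _ _ pB m0 SBm).2 phiM //=.
  rewrite ifT //; apply/allP => p pm; apply: (allP sBm).
  by move: pm; rewrite !mem_primes => /and3P[-> _ pm]; rewrite muln_gt0 m0 prime_gt0 // dvdn_mull.
have A1 : A 1%N <= 1.
  rewrite /A big_mkcond; case: (posnP N) => [->|N0]; first by rewrite big_geq.
  rewrite big_ltn // big_nat big1 ?addr0 => [|m /andP[m1 mN]].
    by rewrite /= addr0; case: ifP => // _; rewrite phi1.
  case: ifPn => // /andP[_ /allP sm].
  have := sm (pdiv m); rewrite mem_primes pdiv_prime // pdiv_dvd (ltn_trans _ m1) //.
  by move=> /(_ isT); rewrite ltnS leqn0 => /eqP h; have := pdiv_prime m1; rewrite h.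
have AB B : (B <= N)%N -> A B.+1 <= \prod_(1 <= p < B.+1 | prime p && S p) (1 - phi p)^-1.
  elim: B => [|B IHB] BN; first by rewrite big_geq.
  apply: (le_trans (step _ BN)); rewrite big_mkcond big_nat_recr //= -big_mkcond mulrC.
  case: ifP => [/andP[pB SB]|_]; last by rewrite !mulr1 IHB // ltnW.
  have h0 : 0 <= (1 - phi B.+1)^-1 by rewrite invr_ge0 subr_ge0 ltW // phip.
  by apply: (ler_wpM2r h0); exact: IHB (ltnW BN).
apply: le_trans (AB _ (leqnn N)); rewrite /A [leLHS]big_nat_cond [leRHS]big_nat_cond.
rewrite [leLHS]big_mkcond [leRHS]big_mkcond.
apply: ler_sum => m _; case: ifPn => [/andP[/andP[m0 mN] Sm]|_]; last by case: ifP.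
rewrite m0 mN Sm /= ifT //; apply/allP => p.
rewrite mem_primes => /and3P[_ _ /dvdn_leq pm].
by rewrite (leq_ltn_trans _ mN) // pm.
Qed.

(** (1 - x) (1 + x + 4 x^2) = 1 + x^2 (3 - 4 x), whence the restriction x <= 3/4. *)
Lemma euler_factor_le (x : R) : 0 <= x -> x <= 3 / 4 -> (1 - x)^-1 <= expR (x + 4 * x ^+ 2).
Proof.
move=> x0 x34; have x1 : 0 < 1 - x by lra.
apply: (@le_trans _ _ (1 + (x + 4 * x ^+ 2))); last exact: expR_ge1Dx.
rewrite -[leLHS]mul1r ler_pdivrMr //.
have : 0 <= x ^+ 2 * (3 - 4 * x) by rewrite mulr_ge0 ?sqr_ge0 //; lra.
by rewrite expr2; lra.
Qed.

Lemma euler_prod_le (phi : nat -> R) (P : pred nat) N :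
  (forall p, P p -> (p <= N)%N -> 0 <= phi p /\ phi p <= 3 / 4) ->
  \prod_(1 <= p < N.+1 | P p) (1 - phi p)^-1 <=
  expR (\sum_(1 <= p < N.+1 | P p) (phi p + 4 * phi p ^+ 2)).
Proof.
move=> h; rewrite expR_sum [leLHS]big_nat_cond [leRHS]big_nat_cond.
apply: ler_prod => p /andP[/andP[p0 pN] Pp]; have [h1 h2] := h _ Pp pN.
by rewrite invr_ge0 euler_factor_le // andbT; lra.
Qed.

(** The completely multiplicative function with prescribed values at the primes below B; [logn]
    vanishes at nonprimes, so the other values of [phi] never enter. *)
Definition cmul (phi : nat -> R) B m : R := \prod_(1 <= p < B) phi p ^+ logn p m.

Lemma cmul1 phi B : cmul phi B 1 = 1.
Proof. by rewrite /cmul big1 // => p _; rewrite logn1 expr0. Qed.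

Lemma cmulM phi B m n : (0 < m)%N -> (0 < n)%N ->
  cmul phi B (m * n) = cmul phi B m * cmul phi B n.
Proof.
move=> m0 n0; rewrite /cmul -big_split; apply: eq_bigr => p _ /=.
by rewrite lognM // exprD.
Qed.

Lemma cmul_gt0 phi B m : (forall p, 0 < phi p) -> 0 < cmul phi B m.
Proof. by move=> h; apply: prodr_gt0 => p _; rewrite exprn_gt0. Qed.

Lemma cmul_prime phi B p : prime p -> (p < B)%N -> cmul phi B p = phi p.
Proof.
move=> pp pB; have p0 := prime_gt0 pp.
rewrite /cmul (@big_cat_nat _ _ _ p) //=; last exact: ltnW.
rewrite [X in _ * X]big_ltn // logn_prime // eqxx expr1.
rewrite big_nat big1 ?mul1r => [|q /andP[_ qp]]; last first.
  by rewrite logn_prime // ltn_eqF.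
rewrite big_nat big1 ?mulr1 => [//|q /andP[pq _]].
by rewrite logn_prime // gtn_eqF.
Qed.

(** gcd(k, l)^(2a) is one term of the sum of d^(2a) over the common divisors d, and with that sum in
    its place the form is a sum of squares indexed by d. Each square is split by Cauchy-Schwarz with
    weights m^(-a) u(m); collecting the pairs with d m = k leaves a divisor sum bounded by V. *)
Lemma gcd_sum_le (a : R) (c u : nat -> R) (U V : R) N : 0 < a ->
  (forall k, 0 <= c k) -> (forall m, 0 < u m) -> 0 < U ->
  \sum_(1 <= m < N.+1) m%:R `^ (- a) * u m <= U ->
  (forall k, (0 < k <= N)%N ->
     \sum_(1 <= m < N.+1 | (m %| k)%N) m%:R `^ (- a) / u m <= V) ->
  \sum_(1 <= k < N.+1) \sum_(1 <= l < N.+1)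
     c k * c l * ((gcdn k l)%:R `^ (2 * a) * (k * l)%:R `^ (- a)) <=
  U * V * \sum_(1 <= k < N.+1) c k ^+ 2.
Proof.
move=> a0 c0 u0 U0 hU hV.
pose s d := \sum_(1 <= k < N.+1 | (d %| k)%N) c k * k%:R `^ (- a).
apply: (@le_trans _ _ (\sum_(1 <= d < N.+1) d%:R `^ (2 * a) * s d ^+ 2)).
  under [leRHS]eq_bigr => d _.
    rewrite expr2 /s big_distrl mulr_sumr /= big_mkcond.
    under eq_bigr => k _.
      rewrite mulr_sumr mulr_sumr big_mkcond /=.
      over.
    over.
  rewrite [leRHS]exchange_big /=; apply: ler_sum_nat => k /andP[k0 kN].
  rewrite [leRHS](eq_bigr (fun d => \sum_(1 <= l < N.+1)
     (if (d %| k)%N && (d %| l)%N then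
        d%:R `^ (2 * a) * (c k * k%:R `^ (- a) * (c l * l%:R `^ (- a))) else 0))); last first.
    move=> d _; case: (d %| k)%N => //=; by rewrite big1.
  rewrite exchange_big /=; apply: ler_sum_nat => l /andP[l0 lN].
  have g0 : (0 < gcdn k l)%N by rewrite gcdn_gt0 k0.
  have gN : (gcdn k l < N.+1)%N by rewrite (leq_ltn_trans _ kN) // dvdn_leq // dvdn_gcdl.
  rewrite (@big_cat_nat _ _ _ (gcdn k l)) //=; last exact: ltnW.
  rewrite [X in _ <= _ + X]big_ltn // dvdn_gcdl dvdn_gcdr /=.
  have h (i j : nat) : 0 <= \sum_(i <= d < j) (if (d %| k)%N && (d %| l)%N then
        d%:R `^ (2 * a) * (c k * k%:R `^ (- a) * (c l * l%:R `^ (- a))) else 0).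
    apply: sumr_ge0 => d _; case: ifP => // _.
    by rewrite !mulr_ge0 ?powR_ge0.
  rewrite -[leLHS]add0r; apply: lerD; first exact: h.
  rewrite -[leLHS]addr0; apply: lerD; last exact: h.
  by rewrite natrM powRM // le_eqVlt; apply/orP; left; apply/eqP; ring.
have sle d : (0 < d)%N -> (d <= N)%N -> d%:R `^ (2 * a) * s d ^+ 2 <=
    U * \sum_(1 <= m < (N %/ d).+1) c (d * m)%N ^+ 2 * (m%:R `^ (- a) / u m).
  move=> d0 dN; have d0' : 0 < d%:R :> R by rewrite ltr0n.
  rewrite /s sum_multiples //.
  have -> : \sum_(1 <= m < (N %/ d).+1) c (d * m)%N * (d * m)%:R `^ (- a) =
     d%:R `^ (- a) * \sum_(1 <= m < (N %/ d).+1) c (d * m)%N * m%:R `^ (- a).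
    rewrite mulr_sumr; apply: eq_bigr => m _.
    by rewrite natrM powRM //; ring.
  rewrite exprMn mulrA.
  have -> : d%:R `^ (2 * a) * (d%:R `^ (- a)) ^+ 2 = 1 :> R.
    rewrite expr2 -!powRD ?(gt_eqF d0') ?implybT //.
    by rewrite (_ : 2 * a + (- a - a) = 0) ?powRr0 //; ring.
  rewrite mul1r big_nat_cond [in leRHS]big_nat_cond.
  apply: (@le_trans _ _ (U * \sum_(1 <= i < (N %/ d).+1 | (0 < i < (N %/ d).+1)%N && true)
     ((c (d * i)%N * i%:R `^ (- a)) ^+ 2 / (i%:R `^ (- a) * u i)))).
    apply: sqr_sum_le => // [m /andP[/andP[m0 _] _]|].
      by rewrite mulr_gt0 // powR_gt0 // ltr0n.
    rewrite -big_nat_cond; apply: le_trans hU.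
    rewrite [leRHS](@big_cat_nat _ _ _ (N %/ d).+1) //=; last by rewrite ltnS leq_div.
    rewrite lerDl sumr_ge0 // => m _; rewrite mulr_ge0 ?powR_ge0 //; exact: ltW.
  rewrite ler_pM2l // le_eqVlt; apply/orP; left; apply/eqP.
  apply: eq_bigr => m /andP[/andP[m0 _] _].
  by field; rewrite (gt_eqF (u0 m)) gt_eqF // powR_gt0 // ltr0n.
apply: (@le_trans _ _ (U * \sum_(1 <= d < N.+1)
    \sum_(1 <= m < (N %/ d).+1) c (d * m)%N ^+ 2 * (m%:R `^ (- a) / u m))).
  by rewrite mulr_sumr; apply: ler_sum_nat => d /andP[d0 dN]; apply: sle.
rewrite -mulrA ler_pM2l //.
have -> : \sum_(1 <= d < N.+1) \sum_(1 <= m < (N %/ d).+1)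
      c (d * m)%N ^+ 2 * (m%:R `^ (- a) / u m) =
   \sum_(1 <= m < N.+1) \sum_(1 <= d < (N %/ m).+1)
      c (m * d)%N ^+ 2 * (m%:R `^ (- a) / u m).
  have e (F : nat -> nat -> R) : \sum_(1 <= d < N.+1) \sum_(1 <= m < (N %/ d).+1) F d m =
     \sum_(1 <= d < N.+1) \sum_(1 <= m < N.+1 | (d * m <= N)%N) F d m.
    apply: eq_big_nat => d /andP[d0 dN].
    rewrite (@big_nat_widen _ _ _ 1 _ N.+1) ?ltnS ?leq_div //.
    by apply: eq_bigl => m; rewrite ltnS leq_divRL // mulnC.
  rewrite !e (exchange_big_dep predT) //=; apply: eq_bigr => d _.
  by apply: eq_big => [m|m _]; rewrite mulnC.
have -> : \sum_(1 <= m < N.+1) \sum_(1 <= d < (N %/ m).+1)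
      c (m * d)%N ^+ 2 * (m%:R `^ (- a) / u m) =
    \sum_(1 <= m < N.+1) \sum_(1 <= k < N.+1 | (m %| k)%N) c k ^+ 2 * (m%:R `^ (- a) / u m).
  apply: eq_big_nat => m /andP[m0 mN].
  by rewrite (sum_multiples (fun k => c k ^+ 2 * (m%:R `^ (- a) / u m))).
rewrite (exchange_big_dep predT) //= mulr_sumr; apply: ler_sum_nat => k /andP[k0 kN].
rewrite -mulr_sumr mulrC ler_wpM2r ?sqr_ge0 //.
by apply: hV; rewrite k0.
Qed.

End GcdSums.

(** * Explicit exponent for the gcd form *)

Section GcdSumBound.
Context {R : realType}.
Implicit Types (k l m n p y N J : nat) (a d x t : R).

Lemma sum_powRN_total_le s N : 1 < s ->
  \sum_(1 <= n < N.+1) n%:R `^ (- s) <= s / (s - 1) :> R.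
Proof.
move=> s1; have s0 : 0 < s - 1 by lra.
have [->|N0] := posnP N; first by rewrite big_geq // divr_ge0 // ltW // (lt_trans _ s1).
rewrite big_ltn // powR1.
have -> : s / (s - 1) = 1 + 1 `^ (1 - s) / (s - 1) by rewrite powR1; field; rewrite gt_eqF.
by rewrite lerD2l; apply: (@sum_powRN_tail_le R s 1).
Qed.

(** 2^(-1/2) < 3/4 brings every prime, 2 included, into the range of [euler_factor_le]. *)
Lemma powRN_half_le a p : 1 / 2 < a -> (1 < p)%N -> p%:R `^ (- a) <= 3 / 4 :> R.
Proof.
move=> a2 p1; have p0 : 0 < p%:R :> R by rewrite ltr0n; lia.
have pn0 : p%:R != 0 :> R by rewrite gt_eqF.
have h : (p%:R `^ (- a)) ^+ 2 <= (3 / 4) ^+ 2.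
  rewrite expr2 -powRD ?pn0 ?implybT //.
  apply: (@le_trans _ _ (p%:R `^ (- 1))).
    by rewrite ler_powR ?ler1n; [|lia|lra].
  rewrite powR_inv1 //; apply: (@le_trans _ _ (2^-1)); last by lra.
  by rewrite lef_pV2 ?posrE // ler_nat.
by rewrite -(@ler_pXn2r _ 2) ?nnegrE ?powR_ge0 //; lra.
Qed.

Lemma sum_split_le (F : nat -> R) y N : (forall n, 0 <= F n) ->
  \sum_(1 <= n < N.+1) F n <= \sum_(1 <= n < y.+1) F n + \sum_(y.+1 <= n < N.+1) F n.
Proof.
move=> F0; have [Ny|yN] := leqP N y.
  rewrite [X in _ <= X + _](@big_cat_nat _ _ _ N.+1) //= -addrA lerDl.
  by rewrite addr_ge0 ?sumr_ge0.
by rewrite (@big_cat_nat _ _ _ y.+1) //=; exact: leqW.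
Qed.

Definition small_prime_expo a d x : R :=
  2 / (1 - a) * x `^ ((1 - a) * (1 + d) / 2) +
  ln 4 / ((1 - a) * d) * (x `^ (1 - a) / ln x).

(** Logarithm of the product U V in [gcd_sum_le]. The primes up to y count once in each factor; 8 is
    twice the 4 of the quadratic term in [euler_factor_le]; in the last line the summand with log 4
    belongs to U, the other two to V. *)
Definition expo a d x : R :=
  2 * small_prime_expo a d x + 8 * (2 * a / (2 * a - 1)) +
  (ln 4 * (2 * a) + 1 + 4 / (Num.sqrt (2 * a - 1) * x `^ a)) /
    Num.sqrt (2 * a - 1) * (x `^ (1 - a) / ln x).

(* The weight 1 on primes up to y and T (y / p) ^ a beyond, T = sqrt (2 a - 1),
   balances the two factors of [gcd_sum_le]. *)
Lemma gcd_sum_expo_le a d (c : nat -> R) y N : 1 / 2 < a -> a < 1 -> 0 < d -> d < 1 ->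
  (1 < y)%N -> 4 / 3 <= Num.sqrt (2 * a - 1) * y%:R `^ a -> ln N%:R <= y%:R :> R ->
  (forall k, 0 <= c k) ->
  \sum_(1 <= k < N.+1) \sum_(1 <= l < N.+1)
     c k * c l * ((gcdn k l)%:R `^ (2 * a) * (k * l)%:R `^ (- a)) <=
  expR (expo a d y%:R) * \sum_(1 <= k < N.+1) c k ^+ 2.
Proof.
move=> a2 a1 d0 d1 y1 hT hN c0; set T := Num.sqrt (2 * a - 1) in hT *.
have T0 : 0 < T by rewrite /T sqrtr_gt0; lra.
have TT : T * T = 2 * a - 1 by rewrite /T -expr2 sqr_sqrtr //; lra.
have T1 : T <= 1 by rewrite -(@ler_pXn2r _ 2) ?nnegrE ?(ltW T0) // expr1n expr2 TT; lra.
have y0 : 0 < y%:R :> R by rewrite ltr0n; lia.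
have ly0 : 0 < ln y%:R :> R by rewrite ln_gt0 // ltr1n.
have ya0 : 0 < y%:R `^ a :> R by rewrite powR_gt0.
pose v0 := (T * y%:R `^ a)^-1.
have v00 : 0 < v0 by rewrite invr_gt0 mulr_gt0.
have v034 : v0 <= 3 / 4.
  by rewrite /v0 -[leRHS]invf_div lef_pV2 ?posrE ?mulr_gt0.
(* [p.-1.+1] is p wherever this branch is taken, and it makes the positivity of [u0] immediate. *)
pose u0 p : R := if (p <= y)%N then 1 else T * y%:R `^ a * p.-1.+1%:R `^ (- a).
have u00 p : 0 < u0 p.
  by rewrite /u0; case: ifP => // _; rewrite !mulr_gt0 // powR_gt0 // ltr0n.
pose u := cmul u0 N.+1.
have u_gt0 m : 0 < u m by apply: cmul_gt0.
pose Z := 2 * a / (2 * a - 1).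
have hZ n : \sum_(1 <= k < n.+1) k%:R `^ (- (2 * a)) <= Z.
  by apply: sum_powRN_total_le; lra.
pose S := small_prime_expo a d y%:R.
have hS : psum (fun p => p%:R `^ (- a)) y <= S.
  by apply: psum_powRN_le => //; lra.
pose small p : R := (prime p && (p <= y)%N)%:R * p%:R `^ (- a).
have small_sum : \sum_(1 <= p < N.+1) small p <= S.
  apply: (le_trans (@sum_split_le small y N _)).
    by move=> n; rewrite mulr_ge0 ?powR_ge0.
  rewrite [X in _ + X]big_nat [X in _ + X]big1 ?addr0; last first.
    by move=> p /andP[yp _]; rewrite /small leqNgt yp andbF mul0r.
  apply: le_trans hS; apply: ler_sum_nat => p /andP[_ py].
  by rewrite /small -ltnS py andbT.
have sqrN p : (0 < p)%N -> (p%:R `^ (- a)) ^+ 2 = p%:R `^ (- (2 * a)) :> R.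
  move=> p0; have pn0 : p%:R != 0 :> R by rewrite pnatr_eq0 -lt0n.
  by rewrite expr2 -powRD ?pn0 ?implybT //; congr (_ `^ _); ring.
pose W1 := ln 4 * (2 * a) / T * (y%:R `^ (1 - a) / ln y%:R).
pose W2 := (1 + 4 * v0) / T * (y%:R `^ (1 - a) / ln y%:R).
(* Beyond y the factors are T y^a p^(-2a); the tail bound has the denominator 2a - 1 = T^2, one T of
   which cancels. *)
have hU : \sum_(1 <= m < N.+1) m%:R `^ (- a) * u m <= expR (S + 4 * Z + W1).
  pose phi m := m%:R `^ (- a) * u m.
  have phip p : prime p -> (p <= N)%N -> phi p = p%:R `^ (- a) * u0 p.
    by move=> pp pN; rewrite /phi /u cmul_prime.
  have phib p : prime p -> (p <= N)%N -> 0 <= phi p /\ phi p <= 3 / 4.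
    move=> pp pN; rewrite phip //; split.
      by rewrite mulr_ge0 ?powR_ge0 // ltW.
    apply: le_trans (powRN_half_le a2 (prime_gt1 pp)).
    rewrite -[leRHS]mulr1 ler_wpM2l ?powR_ge0 // /u0; case: ifPn => //.
    rewrite -ltnNge prednK ?prime_gt0 // => yp.
    rewrite powRN ler_pdivrMr ?powR_gt0 ?ltr0n ?prime_gt0 // mul1r.
    apply: (@le_trans _ _ (y%:R `^ a)); first by rewrite ler_piMl // ltW.
    by rewrite ge0_ler_powR ?nnegrE ?ler_nat 1?ltnW //; lra.
  apply: (@le_trans _ _ (\prod_(1 <= p < N.+1 | prime p && predT p) (1 - phi p)^-1)).
    apply: (sum_le_euler_prod (phi := phi) (S := predT)) => //.
    - by rewrite /phi /u cmul1 powR1 mul1r.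
    - by move=> m; rewrite mulr_ge0 ?powR_ge0 // ltW.
    - move=> p m pp m0; rewrite /phi /u cmulM ?(prime_gt0 pp) // natrM powRM //; ring.
    - by move=> p pp _ pN; have [_] := phib _ pp pN; lra.
  apply: (@le_trans _ _ (expR (\sum_(1 <= p < N.+1 | prime p && predT p) (phi p + 4 * phi p ^+ 2)))).
    by apply: euler_prod_le => p /andP[pp _] pN; exact: phib.
  rewrite ler_expR.
  pose big p : R := ((prime p) && (y < p)%N)%:R * (T * y%:R `^ a * p%:R `^ (- (2 * a))).
  apply: (@le_trans _ _ (\sum_(1 <= p < N.+1) (small p + big p + 4 * p%:R `^ (- (2 * a))))).
    rewrite big_mkcond; apply: ler_sum_nat => p /andP[p0 pN].
    have h0 : 0 <= small p + big p + 4 * p%:R `^ (- (2 * a)).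
      by rewrite !addr_ge0 // ?mulr_ge0 ?powR_ge0 // ltW.
    case: ifPn => //; rewrite andbT => pp.
    rewrite phip // /small /big pp /= -sqrN //; apply: lerD.
      rewrite /u0 ltnNge; case: ifPn => yp /=; first by rewrite mulr1 mul1r mul0r addr0.
      by rewrite prednK // mul0r add0r mul1r expr2 le_eqVlt; apply/orP; left; apply/eqP; ring.
    rewrite ler_wpM2l // ler_pXn2r ?nnegrE ?mulr_ge0 ?powR_ge0 ?(ltW (u00 _)) //.
    rewrite -[leRHS]mulr1 ler_wpM2l ?powR_ge0 // /u0; case: ifPn => //.
    rewrite -ltnNge prednK // => yp.
    rewrite powRN ler_pdivrMr ?powR_gt0 ?ltr0n // mul1r.
    apply: (@le_trans _ _ (y%:R `^ a)); first by rewrite ler_piMl // ltW.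
    by rewrite ge0_ler_powR ?nnegrE ?ler_nat 1?ltnW //; lra.
  rewrite !big_split /= -mulr_sumr.
  have hb : \sum_(1 <= p < N.+1) big p <= W1.
    apply: (le_trans (@sum_split_le big y N _)).
      by move=> n; rewrite !mulr_ge0 ?powR_ge0 // ltW.
    rewrite [X in X + _]big_nat [X in X + _]big1 ?add0r; last first.
      by move=> p /andP[_ py]; rewrite /big ltnNge -ltnS py andbF mul0r.
    apply: (@le_trans _ _ (T * y%:R `^ a * \sum_(y.+1 <= p < N.+1) (prime p)%:R * p%:R `^ (- (2 * a)))).
      rewrite mulr_sumr; apply: ler_sum_nat => p /andP[yp pN].
      by rewrite /big yp andbT mulrCA.
    have h := @psum_powRN_tail_le R (2 * a) y N ltac:(lra) y1.
    apply: (le_trans (ler_wpM2l (ltW (mulr_gt0 T0 ya0)) h)).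
    rewrite -TT.
    rewrite /W1 le_eqVlt; apply/orP; left; apply/eqP.
    rewrite (_ : y%:R `^ (1 - a) = y%:R `^ a * y%:R `^ (1 - 2 * a)); last first.
      rewrite -powRD ?(gt_eqF y0) ?implybT //; congr (_ `^ _); ring.
    by field; rewrite !gt_eqF.
  have := hZ N; move: small_sum hb.
  set s1 := \sum_(_ <= _ < _) small _; set s2 := \sum_(_ <= _ < _) big _.
  set s3 := \sum_(_ <= _ < _) _; lra.
(* Beyond y all factors equal v0 = 1 / (T y^a), and k has at most log k / log y <= y / log y prime
   factors above y. *)
have hV k : (0 < k <= N)%N ->
    \sum_(1 <= m < N.+1 | (m %| k)%N) m%:R `^ (- a) / u m <= expR (S + 4 * Z + W2).
  move=> /andP[k0 kN].
  pose phi m := m%:R `^ (- a) / u m.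
  have phip p : prime p -> (p <= N)%N -> phi p = if (p <= y)%N then p%:R `^ (- a) else v0.
    move=> pp pN; have p0 := prime_gt0 pp.
    rewrite /phi /u cmul_prime // /u0; case: ifP => _; first by rewrite divr1.
    have pa0 : 0 < p%:R `^ (- a) :> R by rewrite powR_gt0 // ltr0n.
    rewrite prednK // /v0; field.
    by rewrite (gt_eqF pa0) (gt_eqF ya0) (gt_eqF T0).
  have phib p : prime p -> (p <= N)%N -> 0 <= phi p /\ phi p <= 3 / 4.
    move=> pp pN; rewrite phip //; case: ifP => _; split; rewrite ?powR_ge0 ?(ltW v00) //.
    exact: powRN_half_le (prime_gt1 pp).
  apply: (@le_trans _ _ (\prod_(1 <= p < N.+1 | prime p && (p %| k)%N) (1 - phi p)^-1)).
    apply: (sum_le_euler_prod (phi := phi) (S := fun m => (m %| k)%N)) => //.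
    - by rewrite /phi /u cmul1 powR1 divr1.
    - by move=> m; rewrite divr_ge0 ?powR_ge0 // ltW.
    - move=> p m pp m0; rewrite /phi /u cmulM ?(prime_gt0 pp) // natrM powRM // invfM; ring.
    - by move=> p pp _ pN; have [_] := phib _ pp pN; lra.
    - move=> p m pp m0 h; split.
        exact: dvdn_trans (dvdn_mulr _ (dvdnn _)) h.
      exact: dvdn_trans (dvdn_mull _ (dvdnn _)) h.
  apply: (@le_trans _ _ (expR (\sum_(1 <= p < N.+1 | prime p && (p %| k)%N) (phi p + 4 * phi p ^+ 2)))).
    by apply: euler_prod_le => p /andP[pp _] pN; exact: phib.
  rewrite ler_expR.
  pose big p : R := (v0 + 4 * v0 ^+ 2) / ln y%:R * (lnp p * (logn p k)%:R).
  have lnplog p : 0 <= lnp p * (logn p k)%:R :> R by rewrite mulr_ge0 ?lnp_ge0.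
  have vv : 0 <= (v0 + 4 * v0 ^+ 2) / ln y%:R.
    by rewrite divr_ge0 ?addr_ge0 ?mulr_ge0 ?sqr_ge0 // ltW.
  apply: (@le_trans _ _ (\sum_(1 <= p < N.+1) (small p + big p + 4 * p%:R `^ (- (2 * a))))).
    rewrite big_mkcond; apply: ler_sum_nat => p /andP[p0 pN].
    have hs : 0 <= small p by rewrite mulr_ge0 ?powR_ge0.
    have hb : 0 <= big p by rewrite mulr_ge0.
    have hp : 0 <= 4 * p%:R `^ (- (2 * a)) :> R by rewrite mulr_ge0 ?powR_ge0.
    case: ifPn => [/andP[pp pk]|_]; last by rewrite !addr_ge0.
    rewrite phip //; case: ifPn => py.
      rewrite -sqrN // /small pp py mul1r lerD2r lerDl //.
    apply: (@le_trans _ _ (big p)); last by rewrite addrAC lerDr addr_ge0.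
    rewrite /big -mulrA ler_peMr //; first by rewrite addr_ge0 ?mulr_ge0 ?sqr_ge0 // ltW.
    rewrite mulrC ler_pdivlMr // mul1r lnpM pp.
    apply: (@le_trans _ _ (ln p%:R)).
      by rewrite ler_ln ?posrE // ?ltr0n // ler_nat ltnW // ltnNge.
    rewrite ler_peMr ?ln_ge0 ?ler1n // logn_gt0 mem_primes pp k0 pk //.
  rewrite !big_split /= -!mulr_sumr -(ln_sum_logn k0 kN).
  have hb : (v0 + 4 * v0 ^+ 2) / ln y%:R * ln k%:R <= W2.
    apply: (@le_trans _ _ ((v0 + 4 * v0 ^+ 2) / ln y%:R * y%:R)).
      apply: ler_wpM2l => //; apply: le_trans hN.
      by rewrite ler_ln ?posrE ?ltr0n ?ler_nat ?(leq_trans k0 kN).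
    rewrite /W2 -(@powR_natN R y a (ltnW y1)).
    rewrite powRN /v0 le_eqVlt; apply/orP; left; apply/eqP; field.
    by rewrite (gt_eqF T0) (gt_eqF ya0) (gt_eqF ly0).
  have := hZ N; move: small_sum hb.
  set s1 := \sum_(_ <= _ < _) small _; set s2 := _ / ln y%:R * _.
  set s3 := \sum_(_ <= _ < _) _; lra.
apply: (le_trans (gcd_sum_le _ c0 u_gt0 (expR_gt0 _) hU hV)); first by lra.
rewrite -expRD (_ : S + 4 * Z + W1 + _ = expo a d y%:R) //.
have t0 : 0 < 2 * a - 1 by lra.
rewrite /expo -/S -/Z -/T /W1 /W2 /v0; field.
by rewrite ?(gt_eqF T0) ?(gt_eqF ya0) ?(gt_eqF ly0) ?(gt_eqF t0).
Qed.

(** With k = k' g and l = l' g, the equation i k = j l forces i = t l' and j = t k', so the sum is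
    at most (k' l')^(-a) times the sum of t^(-2a). *)
Lemma collision_sum_le a k l J : 1 / 2 < a -> (0 < k)%N -> (0 < l)%N ->
  \sum_(1 <= i < J.+1) \sum_(1 <= j < J.+1 | (i * k == j * l)%N) (i * j)%:R `^ (- a) <=
  2 * a / (2 * a - 1) * ((gcdn k l)%:R `^ (2 * a) * (k * l)%:R `^ (- a)) :> R.
Proof.
move=> a2 k0 l0; set g := gcdn k l; have g0 : (0 < g)%N by rewrite gcdn_gt0 k0.
pose k' := (k %/ g)%N; pose l' := (l %/ g)%N.
have kE : k = (k' * g)%N by rewrite divnK ?dvdn_gcdl.
have lE : l = (l' * g)%N by rewrite divnK ?dvdn_gcdr.
have k'0 : (0 < k')%N by rewrite lt0n; apply/eqP => h; rewrite kE h in k0.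
have l'0 : (0 < l')%N by rewrite lt0n; apply/eqP => h; rewrite lE h in l0.
have cop : coprime k' l'.
  rewrite /coprime -(eqn_pmul2r g0) mul1n muln_gcdl -kE -lE //.
pose Z := 2 * a / (2 * a - 1).
pose h i : R := (i * (i %/ l' * k'))%:R `^ (- a).
apply: (@le_trans _ _ (\sum_(1 <= i < J.+1 | (l' %| i)%N) h i)).
  rewrite [leRHS]big_mkcond; apply: ler_sum_nat => i /andP[i0 iJ].
  have cond j : (i * k == j * l)%N -> (l' %| i)%N /\ j = (i %/ l' * k')%N.
    move=> /eqP; rewrite kE lE !mulnA => /eqP; rewrite eqn_pmul2r // => /eqP e.
    have li : (l' %| i)%N.
      by rewrite -(@Gauss_dvdl _ _ k') 1?coprime_sym // e dvdn_mull.
    split=> //; apply/eqP; rewrite -(eqn_pmul2r l'0) -e mulnAC divnK //.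
  case: ifPn => li; last first.
    by rewrite big1 // => j /cond[]; rewrite (negbTE li).
  rewrite (eq_bigr (fun=> h i)); last by move=> j /cond[_ ->].
  have hi0 : 0 <= h i by exact: powR_ge0.
  rewrite big_mkcond /=.
  have [jJ|jJ] := boolP (0 < i %/ l' * k' < J.+1)%N; last first.
    rewrite big_nat big1 // => j hj; case: ifP => // /cond[_ je].
    by move: jJ; rewrite -je hj.
  rewrite (big_cat_nat _ (n := (i %/ l' * k')%N)) //=; [|by case/andP: jJ|by case/andP: jJ => _ /ltnW].
  rewrite [X in _ + X]big_ltn ?(andP jJ).2 //.
  rewrite [X in X + _]big_nat [X in X + _]big1 ?add0r; last first.
    by move=> j /andP[_ hj]; case: ifP => // /cond[_ je]; rewrite je ltnn in hj.
  rewrite [X in _ + X]big_nat [X in _ + X]big1 ?addr0; last first.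
    by move=> j /andP[hj _]; case: ifP => // /cond[_ je]; rewrite -je ltnn in hj.
  by case: ifP.
rewrite sum_multiples //.
apply: (@le_trans _ _ ((l' * k')%:R `^ (- a) * \sum_(1 <= t < (J %/ l').+1) t%:R `^ (- (2 * a)))).
  rewrite mulr_sumr; apply: ler_sum_nat => t /andP[t0 _].
  rewrite /h mulKn // (_ : (l' * t * (t * k') = l' * k' * (t * t))%N); last by lia.
  rewrite natrM powRM // ler_wpM2l ?powR_ge0 // natrM powRM //.
  rewrite -powRD ?implybT ?pnatr_eq0 -?lt0n ?t0 ?implybT //.
  by rewrite (_ : - a - a = - (2 * a)) //; ring.
rewrite [leRHS]mulrC; apply: ler_pM; rewrite ?powR_ge0 ?sumr_ge0 //.
- rewrite kE lE (_ : (k' * g * (l' * g) = l' * k' * (g * g))%N); last by lia.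
  rewrite [in leRHS]natrM powRM // mulrCA -[leLHS]mulr1 ler_wpM2l ?powR_ge0 //.
  have gn0 : g%:R != 0 :> R by rewrite pnatr_eq0 -lt0n.
  rewrite natrM powRM // -!powRD ?gn0 ?implybT //.
  by rewrite (_ : 2 * a + (- a - a) = 0) ?powRr0 //; ring.
- by apply: sum_powRN_total_le; lra.
Qed.

End GcdSumBound.

(** * The exponent compared with the constant K *)

Section Asymptotics.
Context {R : realType}.
Implicit Types (a b c x y t : R).

(** (t / x)^b >= 1 + b log(t / x), and b log x >= 1 is what lets this outweigh the growth of the
    logarithm. *)
Lemma powR_div_ln_homo b x t : 0 < b -> 0 < x -> b^-1 <= ln x -> x <= t ->
  x `^ b / ln x <= t `^ b / ln t.
Proof.
move=> b0 x0 hx xt; have t0 : 0 < t by exact: lt_le_trans xt.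
have l0 : 0 < ln x by apply: lt_le_trans hx; rewrite invr_gt0.
have lt0 : 0 < ln t by apply: (lt_le_trans l0); rewrite ler_ln ?posrE.
rewrite ler_pdivrMr // mulrAC ler_pdivlMr //.
have q0 : 0 < t / x by rewrite divr_gt0.
have tE : t = x * (t / x) by rewrite mulrC divfK // gt_eqF.
have lE : ln t = ln x + ln (t / x) by rewrite {1}tE lnM ?posrE.
have -> : t `^ b = x `^ b * (t / x) `^ b by rewrite {1}tE powRM // ltW.
rewrite -mulrA ler_wpM2l ?powR_ge0 // lE.
have ls0 : 0 <= ln (t / x) by rewrite ln_ge0 // ler_pdivlMr // mul1r.
have : 1 + b * ln (t / x) <= (t / x) `^ b by rewrite /powR gt_eqF // expR_ge1Dx.
move=> /(ler_wpM2r (ltW l0)) /(le_trans _); apply.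
rewrite mulrDl mul1r lerD2l mulrAC -[leLHS]mul1r ler_wpM2r //.
by have := ler_wpM2l (ltW b0) hx; rewrite mulfV // gt_eqF.
Qed.

(** (1 + 73/800)^8 >= 2, and 1 + u <= e^u at u = 73/800. *)
Lemma ln2_le : ln 2 <= 73 / 100 :> R.
Proof.
rewrite -[leRHS]expRK ler_ln ?posrE ?expR_gt0 //.
have -> : expR (73 / 100) = expR (73 / 800) ^+ 8 :> R.
  by rewrite -expRM_natl; congr expR; field.
apply: (@le_trans _ _ ((1 + 73 / 800) ^+ 8)); first by rewrite !exprS expr0; lra.
have q0 : 0 <= 1 + 73 / 800 :> R by lra.
have hq : 1 + 73 / 800 <= expR (73 / 800) :> R by exact: expR_ge1Dx.
have mono (u v : R) : 0 <= u -> u <= v -> u ^+ 8 <= v ^+ 8.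
  by move=> u0 uv; rewrite lerXn2r ?nnegrE ?(le_trans u0).
exact: mono q0 hq.
Qed.

Lemma ln4_le : ln 4 <= 146 / 100 :> R.
Proof.
have -> : ln 4%:R = 2%:R * ln 2 :> R by rewrite mulr_natl -lnXn // -natrX.
by have := ln2_le; lra.
Qed.

(** Absorbs the rounding of the prime cutoff to an integer, which moves it by at most 2. *)
Lemma powR_shift_le b x y : 0 < b -> b < 1 -> 1 <= x -> 0 <= y -> y <= x + 2 ->
  y `^ b <= x `^ b + 2.
Proof.
move=> b0 b1 x1 y0 yx; have x0 : 0 < x by exact: lt_le_trans x1.
apply: (@le_trans _ _ ((x * (1 + 2 / x)) `^ b)).
  rewrite ge0_ler_powR ?nnegrE ?(ltW b0) //.
    by rewrite mulr_ge0 ?addr_ge0 ?divr_ge0 // ltW.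
  by rewrite mulrDr mulr1 mulrCA mulfV ?gt_eqF // mulr1.
have u0 : 0 < 1 + 2 / x by rewrite addr_gt0 ?divr_gt0.
rewrite powRM ?(ltW x0) ?(ltW u0) //.
apply: (le_trans (ler_wpM2l (powR_ge0 _ _) (powR_le_affine u0 (ltW b0) (ltW b1)))).
have -> : x `^ b * (b * (1 + 2 / x) + (1 - b)) = x `^ b + 2 * (b * (x `^ b / x)).
  by field; rewrite gt_eqF.
have : b * (x `^ b / x) <= 1.
  rewrite mulr_ile1 ?divr_ge0 ?powR_ge0 ?(ltW b0) ?(ltW b1) ?(ltW x0) //.
  by rewrite ler_pdivrMr // mul1r ler1_powR ?(ltW b1).
lra.
Qed.

(** The saving against K is the [e] removed from 3; the 4 is kept whole, its slack absorbing the
    lower-order term 4 / (T y^a). *)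
Lemma expo_le a d e x y (b := 1 - a) (T := Num.sqrt (2 * a - 1)) (s := (1 + d) / 2) :
  1 / 2 < a -> a < 1 -> 0 < d -> d < 1 -> 0 < e ->
  2 * (ln 4 / d) <= 3 - e -> ln 4 * 2 + 1 + e <= 4 ->
  1 <= ln x -> 2 <= x -> x <= y -> y <= x + 2 -> 4 / (e * T) <= x `^ a ->
  expo a d y <= 8 / b * x `^ (b * s) + 8 * (2 * a / (2 * a - 1)) +
    ((3 - e) / b + 4 / T) * ((x `^ b + 2) / ln x).
Proof.
move=> a2 a1 d0 d1 e0 hd he l1 x2 xy yx h2.
have T0 : 0 < T by rewrite /T sqrtr_gt0; lra.
have b0 : 0 < b by rewrite /b; lra.
have b1 : b < 1 by rewrite /b; lra.
have s1 : s < 1 by rewrite /s; lra.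
have s0 : 0 < s by rewrite /s; lra.
have x0 : 0 < x by lra.
have x1 : 1 <= x by lra.
have y0 : 0 < y by lra.
have l0 : 0 < ln x by lra.
have l40 : 0 <= ln 4 :> R by rewrite ln_ge0 // ler1n.
have ly : ln x <= ln y by rewrite ler_ln ?posrE.
have ly0 : 0 < ln y by exact: lt_le_trans ly.
have Ey : y `^ b / ln y <= (x `^ b + 2) / ln x.
  apply: ler_pM; rewrite ?powR_ge0 ?invr_ge0 ?(ltW ly0) //.
    by apply: powR_shift_le => //; exact: ltW.
  by rewrite lef_pV2 ?posrE.
have ys : y `^ (b * s) <= 2 * x `^ (b * s).
  have bs0 : 0 <= b * s by rewrite mulr_ge0 ?(ltW b0) ?(ltW s0).
  have bs1 : b * s <= 1 by rewrite mulr_ile1 ?(ltW b0) ?(ltW s0) ?(ltW b1) ?(ltW s1).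
  apply: (@le_trans _ _ ((2 * x) `^ (b * s))).
    rewrite ge0_ler_powR ?nnegrE ?(ltW y0) ?mulr_ge0 ?(ltW x0) //; lra.
  by rewrite powRM ?(ltW x0) // ler_wpM2r ?powR_ge0 // ler1_powR // ler1n.
have Ty : 4 / (T * y `^ a) <= e.
  have xy' : x `^ a <= y `^ a.
    by rewrite ge0_ler_powR ?nnegrE ?(ltW x0) ?(ltW y0) //; lra.
  have ya0 : 0 < y `^ a by exact: powR_gt0.
  rewrite ler_pdivrMr ?mulr_gt0 //.
  have := le_trans h2 xy'; rewrite ler_pdivrMr ?mulr_gt0 //.
  by rewrite (_ : y `^ a * (e * T) = e * (T * y `^ a)) //; ring.
rewrite /expo /small_prime_expo -/b -/T -(mulrA b (1 + d)) -/s.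
move: Ey; set E := y `^ b / ln y; set E' := (_ + 2) / _ => Ey.
have E0 : 0 <= E by rewrite /E divr_ge0 ?powR_ge0 // ltW.
set Z := _ * (2 * a / _).
have e3 : 0 <= 3 - e by apply: le_trans hd; rewrite mulr_ge0 ?divr_ge0 // ltW.
have t1 : 2 * (ln 4 / (b * d) * E) <= (3 - e) / b * E'.
  have -> : 2 * (ln 4 / (b * d) * E) = (2 * (ln 4 / d)) / b * E.
    by field; rewrite (gt_eqF b0) (gt_eqF d0).
  have h : 2 * (ln 4 / d) / b <= (3 - e) / b by rewrite ler_wpM2r // invr_ge0 ltW.
  apply: ler_pM => //.
  by rewrite divr_ge0 ?mulr_ge0 ?invr_ge0 ?(ltW b0) ?(ltW d0).
have t2 : (ln 4 * (2 * a) + 1 + 4 / (T * y `^ a)) / T * E <= 4 / T * E'.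
  have h : (ln 4 * (2 * a) + 1 + 4 / (T * y `^ a)) <= 4.
    have : ln 4 * (2 * a) <= ln 4 * 2 by apply: ler_wpM2l => //; lra.
    lra.
  apply: ler_pM => //.
    rewrite divr_ge0 ?(ltW T0) // !addr_ge0 // ?divr_ge0 ?mulr_ge0 ?powR_ge0 ?(ltW T0) //; lra.
  by rewrite ler_wpM2r // invr_ge0 ltW.
have t3 : 2 * (2 / b * y `^ (b * s)) <= 8 / b * x `^ (b * s).
  apply: (@le_trans _ _ (2 * (2 / b * (2 * x `^ (b * s))))).
    by rewrite ler_wpM2l // ler_wpM2l // divr_ge0 // ltW.
  by rewrite le_eqVlt; apply/orP; left; apply/eqP; field; rewrite gt_eqF.
rewrite (mulrDl _ _ E') mulrDr.
move: t1 t2 t3; clear.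
set A1 := 2 * _; set A2 := _ * E'; set A3 := _ * E; set A4 := _ * E'.
set A5 := 2 * _; set A6 := 8 / b * _ => *; lra.
Qed.

(** In the application x is the logarithm of the start of a dyadic block, y its prime cutoff and t =
    log k. The term 12 log x pays for the sixth power of the block index, c for the constant
    factors. *)
Lemma expo_asymptotics a : 1 / 2 < a -> a < 1 ->
  exists2 d, 0 < d < 1 & forall c,
  \forall x \near +oo, forall y t, x <= y -> y <= x + 2 -> x <= t ->
    expo a d y + 12 * ln x + c <=
    (3 / (1 - a) + 4 / Num.sqrt (2 * a - 1)) * (t `^ (1 - a) / ln t).
Proof.
move=> a2 a1; set T := Num.sqrt (2 * a - 1).
have T0 : 0 < T by rewrite /T sqrtr_gt0; lra.
have l40 : 0 <= ln 4 :> R by rewrite ln_ge0 // ler1n.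
have [d [e [d0 d1 e0 hd he]]] : exists d e : R,
    [/\ 0 < d, d < 1, 0 < e, 2 * (ln 4 / d) <= 3 - e & ln 4 * 2 + 1 + e <= 4].
  have := ln4_le; set L := ln 4 => hL.
  (* With log 4 <= 1.46: 2.92 / 0.98 < 2.99 and 2.92 + 1 + 0.01 < 4. *)
  exists (98 / 100), (1 / 100); split; lra.
exists d; rewrite ?d0 // => c.
pose b := 1 - a; have b0 : 0 < b by rewrite /b; lra.
have b1 : b < 1 by rewrite /b; lra.
pose Z := 8 * (2 * a / (2 * a - 1)).
pose s := (1 + d) / 2; have s1 : s < 1 by rewrite /s; lra.
pose D := 2 * ((3 - e) / b + 4 / T).
(* The saving (e / b) x^b / log x is divided into four equal shares x^b / (q log x), one for each
   error term. *)
pose q := 4 * b / e; have q0 : 0 < q by rewrite divr_gt0 ?mulr_gt0.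
near=> x => y t xy yx xt; rewrite -/b.
have x2 : 2 <= x by near: x; exact: nbhs_pinfty_ge.
have x0 : 0 < x by rewrite (lt_le_trans _ x2).
have h0 : b^-1 <= ln x by near: x; exact: near_ln_ge.
have h1 : 1 <= ln x by near: x; exact: near_ln_ge.
have l0 : 0 < ln x by rewrite (lt_le_trans _ h1).
have h2 : 4 / (e * T) <= x `^ a.
  by near: x; apply: near_powR_ge; apply: lt_trans a2.
have h3 : q * (8 / b) * (x `^ (b * s) * ln x) <= x `^ b.
  by near: x; apply: near_powR_ln; rewrite gtr_pMr.
have h4 : q * (Z + c) * (x `^ 0 * ln x) <= x `^ b.
  by near: x; apply: near_powR_ln.
have h5 : q * (24 / b) * (x `^ (b / 2) * ln x) <= x `^ b.
  by near: x; apply: near_powR_ln; rewrite ltr_pdivrMr // ltr_pMr // ltr1n.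
have h6 : q * D <= x `^ b by near: x; exact: near_powR_ge.
apply: (le_trans _ (ler_wpM2l _ (powR_div_ln_homo b0 x0 h0 xt))); last first.
  by rewrite addr_ge0 // divr_ge0 // ltW.
have := expo_le a2 a1 d0 d1 e0 hd he h1 x2 xy yx h2.
rewrite -/b -/T -/s -/Z => e1.
have -> : (3 / b + 4 / T) * (x `^ b / ln x) =
    ((3 - e) / b + 4 / T) * (x `^ b / ln x) + 4 * (x `^ b / q) / ln x.
  by rewrite /q; field; rewrite (gt_eqF b0) (gt_eqF T0) (gt_eqF l0) (gt_eqF e0).
rewrite powRr0 mul1r in h4.
have l2 : 12 * (ln x * ln x) <= x `^ b / q.
  have b20 : 0 < b / 2 by rewrite divr_gt0.
  have hl := @ln_le_powR R x (b / 2) x0 b20.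
  rewrite ler_pdivlMr //; apply: le_trans h5.
  have h := ler_wpM2l (ltW q0) (ler_wpM2r (ltW l0) hl).
  have e' : q * (24 / b) * (x `^ (b / 2) * ln x) = 12 * (q * (x `^ (b / 2) / (b / 2) * ln x)).
    by field; rewrite gt_eqF.
  by rewrite e' -(mulrA 12) ler_wpM2l // mulrC.
have i3 : 8 / b * x `^ (b * s) * ln x <= x `^ b / q.
  rewrite ler_pdivlMr //; apply: le_trans h3.
  by rewrite le_eqVlt; apply/orP; left; apply/eqP; ring.
have i4 : (Z + c) * ln x <= x `^ b / q.
  by rewrite ler_pdivlMr //; apply: le_trans h4; rewrite mulrC mulrA.
have i6 : D <= x `^ b / q by rewrite ler_pdivlMr // mulrC.
have : 8 / b * x `^ (b * s) + Z + c + D / ln x + 12 * ln x <= 4 * (x `^ b / q) / ln x.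
  rewrite ler_pdivlMr //.
  have -> : (8 / b * x `^ (b * s) + Z + c + D / ln x + 12 * ln x) * ln x =
     8 / b * x `^ (b * s) * ln x + (Z + c) * ln x + D + 12 * (ln x * ln x).
    by field; rewrite (gt_eqF l0) (gt_eqF b0).
  move: l2 i3 i4 i6; clear.
  set A1 := 12 * _; set A2 := _ * ln x; set A3 := _ * ln x; set A4 := _ / q => *; lra.
have e2 : ((3 - e) / b + 4 / T) * ((x `^ b + 2) / ln x) =
    ((3 - e) / b + 4 / T) * (x `^ b / ln x) + D / ln x.
  by rewrite /D; field; rewrite (gt_eqF b0) (gt_eqF T0) (gt_eqF l0).
rewrite e2 in e1; move: e1; clear.
set A1 := expo _ _ _; set A2 := _ * x `^ _; set A3 := _ * (_ / _).
set A4 := D / _; set A5 := 4 * _ / _ => *; lra.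
Unshelve. all: by end_near. Qed.

End Asymptotics.

(** * Dyadic maximal inequality *)

Lemma sqrD_weighted_le (R : realFieldType) (u v w : R) : 0 < w ->
  (u + v) ^+ 2 <= (w + 1) * (u ^+ 2 + v ^+ 2 / w).
Proof.
move=> w0; rewrite -subr_ge0.
have -> : (w + 1) * (u ^+ 2 + v ^+ 2 / w) - (u + v) ^+ 2 = (w * u - v) ^+ 2 / w.
  by field; rewrite gt_eqF.
by rewrite divr_ge0 ?sqr_ge0 ?(ltW w0).
Qed.

Section RademacherMenshov.
Context {R : realType} d (T : measurableType d) (mu : {measure set T -> \bar R}).
Context (D : set T) (mD : measurable D).
Implicit Types (X : nat -> T -> R) (b : nat -> R) (i j k m n a : nat).

Definition psums X n x : R := \sum_(1 <= k < n.+1) X k x.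

Lemma psumsB X m n x : (m <= n)%N ->
  psums X n x - psums X m x = \sum_(m.+1 <= k < n.+1) X k x.
Proof.
move=> mn; rewrite /psums (@big_cat_nat _ _ _ m.+1 1 n.+1) //=.
by rewrite addrAC subrr add0r.
Qed.

(** The squares of the sums over all left halves in the dyadic tree on [a, a + 2^i), with the single
    terms at the leaves. Apart from a possible last leaf, an initial segment of the interval
    decomposes into left halves. *)
Fixpoint chain X i a x : R :=
  if i is i'.+1 then
    (\sum_(a <= k < a + 2 ^ i') X k x) ^+ 2 + chain X i' a x + chain X i' (a + 2 ^ i') x
  else X a x ^+ 2.

Lemma chain_ge0 X i a x : 0 <= chain X i a x.
Proof.
elim: i a => [|i IH] a /=; first exact: sqr_ge0.
by rewrite !addr_ge0 // sqr_ge0.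
Qed.

(* Cauchy-Schwarz along the binary expansion of [m - a]. *)
Lemma sqr_sum_le_chain X i a m x : (a <= m)%N -> (m <= a + 2 ^ i)%N ->
  (\sum_(a <= k < m) X k x) ^+ 2 <= i.+1%:R * chain X i a x.
Proof.
elim: i a m => [|i IH] a m am mi.
  rewrite mul1r /=; move: mi; rewrite expn0 addn1 leq_eqVlt => /orP[/eqP->|].
    by rewrite big_nat1.
  rewrite ltnS => ma; rewrite (_ : m = a) ?big_geq //; last by lia.
  by rewrite expr0n /= sqr_ge0.
have c0 := chain_ge0 X i a x; have c1 := chain_ge0 X i (a + 2 ^ i) x.
have e1 : i.+2%:R = i.+1%:R + 1 :> R by rewrite natr1.
have i0 : 0 < i.+1%:R :> R by rewrite ltr0n.
rewrite /= e1; set B := \sum_(a <= k < a + 2 ^ i) X k x.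
have [mi2|mi2] := leqP m (a + 2 ^ i).
  apply: (le_trans (IH _ _ am mi2)).
  rewrite mulrDl mul1r !mulrDr.
  have := sqr_ge0 B; have : 0 <= i.+1%:R * B ^+ 2 by rewrite mulr_ge0 ?sqr_ge0 ?(ltW i0).
  have : 0 <= i.+1%:R * chain X i (a + 2 ^ i) x by rewrite mulr_ge0 ?(ltW i0).
  lra.
rewrite (@big_cat_nat _ _ _ (a + 2 ^ i)) ?leq_addr ?(ltnW mi2) //= -/B.
have := IH (a + 2 ^ i)%N m (ltnW mi2); rewrite -addnA addnn -mul2n -expnS => /(_ mi).
set S := \sum_(_ <= k < m) X k x => hS.
apply: (le_trans (sqrD_weighted_le B S i0)); rewrite ler_wpM2l ?addr_ge0 ?(ltW i0) //.
have : S ^+ 2 / i.+1%:R <= chain X i (a + 2 ^ i) x by rewrite ler_pdivrMr // mulrC.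
by move=> h1; rewrite -addrA lerD2l (le_trans h1) // lerDr.
Qed.

Context (X : nat -> T -> R) (b : nat -> R).
Hypothesis mX : forall k, measurable_fun D (X k).
Hypothesis X_le : forall i a m, (2 ^ i <= a)%N -> (a <= m)%N -> (m <= 2 ^ i.+1)%N ->
  (\int[mu]_(x in D) ((\sum_(a <= k < m) X k x) ^+ 2)%:E <= (\sum_(a <= k < m) b k)%:E)%E.

Let mXsum a m : measurable_fun D (fun x => \sum_(a <= k < m) X k x).
Proof. by apply: measurable_sum. Qed.

Let mXsqr a m : measurable_fun D (fun x => (\sum_(a <= k < m) X k x) ^+ 2).
Proof. by apply: measurable_funX; exact: mXsum. Qed.

Let mchain i a : measurable_fun D (chain X i a).
Proof.
elim: i a => [|i IH] a /=; first exact: measurable_funX.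
by apply: measurable_funD => //; apply: measurable_funD.
Qed.

(** Each of the i + 1 levels of the tree consists of disjoint blocks and so costs at most the sum of
    [b] over the whole range. *)
Let chain_le i r a : (2 ^ r <= a)%N -> (a + 2 ^ i <= 2 ^ r.+1)%N ->
  (\int[mu]_(x in D) (chain X i a x)%:E <= (i.+1%:R * \sum_(a <= k < a + 2 ^ i) b k)%:E)%E.
Proof.
elim: i a => [|i IH] a ra ar.
  have := X_le ra (leqnSn a); rewrite expn0 addn1 in ar * => /(_ ar).
  by rewrite big_nat1 mul1r; under eq_integral do rewrite big_nat1.
rewrite /=; under eq_integral do rewrite !EFinD.
have e : (a + 2 ^ i + 2 ^ i = a + 2 ^ i.+1)%N by rewrite -addnA addnn -mul2n -expnS.
rewrite ge0_integralD //; last 4 first.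
- by move=> x _; rewrite -EFinD lee_fin addr_ge0 ?sqr_ge0 ?chain_ge0.
- by apply/measurable_EFinP; apply: measurable_funD.
- by move=> x _; rewrite lee_fin chain_ge0.
- exact/measurable_EFinP.
rewrite ge0_integralD //; last 4 first.
- by move=> x _; rewrite lee_fin sqr_ge0.
- exact/measurable_EFinP.
- by move=> x _; rewrite lee_fin chain_ge0.
- exact/measurable_EFinP.
have h1 := @IH a ra ltac:(lia).
have h2 := @IH (a + 2 ^ i)%N ltac:(lia) ltac:(lia).
have h3 := @X_le r a (a + 2 ^ i)%N ra (leq_addr _ _) ltac:(lia).
have h4 := @X_le r (a + 2 ^ i)%N (a + 2 ^ i.+1)%N ltac:(lia) ltac:(lia) ar.
(* The sign of this block sum is read off the integral that it bounds; [b] itself carries no sign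
   hypothesis. *)
have h5 : 0 <= \sum_(a + 2 ^ i <= k < a + 2 ^ i.+1) b k.
  by rewrite -lee_fin; apply: le_trans h4; apply: integral_ge0 => x _; rewrite lee_fin sqr_ge0.
rewrite e in h2.
apply: (le_trans (leeD (leeD h3 h1) h2)).
rewrite -!EFinD lee_fin [in leRHS](@big_cat_nat _ _ _ (a + 2 ^ i)) ?leq_addr //=; last by lia.
rewrite -[in leRHS]natr1; move: h5.
set u := \sum_(a <= k < a + 2 ^ i) b k; set v := \sum_(a + 2 ^ i <= k < _) b k => h5; lra.
Qed.

(** One of the five powers is lost in [sqr_sum_le_chain]; the remaining (i + 1)^4 bounds the
    oscillation on block i by a multiple of (i + 1)^(-2), which is summable. Integration loses
    another factor i + 1, whence the sixth power in [b_le]. *)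
Let Q x : \bar R := (\sum_(0 <= i <oo) (i.+1%:R ^+ 5 * chain X i (2 ^ i) x)%:E)%E.

Let Q0 x : (0 <= Q x)%E.
Proof. by apply: nneseries_ge0 => i _ _; rewrite lee_fin mulr_ge0 ?exprn_ge0 ?chain_ge0. Qed.

Let mQterm i : measurable_fun D (fun x => (i.+1%:R ^+ 5 * chain X i (2 ^ i) x)%:E).
Proof. by apply/measurable_EFinP; apply: measurable_funM. Qed.

Let mQ : measurable_fun D Q.
Proof.
apply: ge0_emeasurable_sum => // i x _ _.
by rewrite lee_fin mulr_ge0 ?exprn_ge0 ?chain_ge0.
Qed.

Context (W : R).
Hypothesis b_le : forall n,
  \sum_(0 <= i < n) i.+1%:R ^+ 6 * \sum_(2 ^ i <= k < 2 ^ i.+1) b k <= W.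

Let intQ : (\int[mu]_(x in D) Q x <= W%:E)%E.
Proof.
rewrite integral_nneseries //; last first.
  by move=> i x _; rewrite lee_fin mulr_ge0 ?exprn_ge0 ?chain_ge0.
apply: lime_le.
  apply: is_cvg_nneseries => i _ _; apply: integral_ge0 => x _.
  by rewrite lee_fin mulr_ge0 ?exprn_ge0 ?chain_ge0.
apply: nearW => n; apply: (@le_trans _ _
    (\sum_(0 <= i < n) (i.+1%:R ^+ 6 * \sum_(2 ^ i <= k < 2 ^ i.+1) b k)%:E)%E); last first.
  by rewrite sumEFin lee_fin.
apply: lee_sum => i _; under eq_integral do rewrite EFinM.
rewrite ge0_integralZl_EFin ?exprn_ge0 //; last 2 first.
- by move=> x _; rewrite lee_fin chain_ge0.
- exact/measurable_EFinP.
have e : (2 ^ i + 2 ^ i = 2 ^ i.+1)%N by rewrite addnn -mul2n -expnS.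
have := @chain_le i i (2 ^ i)%N (leqnn _); rewrite e => /(_ (leqnn _)) h.
rewrite (_ : (_ ^+ 6 * _)%:E = ((i.+1%:R ^+ 5)%:E *
  (i.+1%:R * \sum_(2 ^ i <= k < 2 ^ i.+1) b k)%:E)%E); last by rewrite -EFinM mulrA -exprSr.
by apply: lee_wpmul2l h; rewrite lee_fin exprn_ge0.
Qed.

Let block_le i m x (q : R) : Q x = q%:E -> (2 ^ i <= m)%N -> (m <= 2 ^ i.+1)%N ->
  `|\sum_(2 ^ i <= k < m) X k x| <= Num.sqrt q / i.+1%:R ^+ 2.
Proof.
move=> Qq im mi; have i0 : 0 < i.+1%:R :> R by rewrite ltr0n.
have q0 : 0 <= q by rewrite -lee_fin -Qq.
rewrite -(@ler_pXn2r _ 2) ?nnegrE ?divr_ge0 ?sqrtr_ge0 ?exprn_ge0 ?(ltW i0) //.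
rewrite real_normK ?num_real // expr_div_n sqr_sqrtr //.
rewrite ler_pdivlMr ?exprn_gt0 //.
have e : (2 ^ i + 2 ^ i = 2 ^ i.+1)%N by rewrite addnn -mul2n -expnS.
have h := @sqr_sum_le_chain X i (2 ^ i) m x im; rewrite e in h.
apply: (@le_trans _ _ (i.+1%:R ^+ 5 * chain X i (2 ^ i) x)).
  have := ler_wpM2r (exprn_ge0 4 (ltW i0)) (h mi); rewrite -exprM.
  by move=> /le_trans; apply; rewrite mulrAC -exprS.
rewrite -lee_fin -Qq /Q.
apply: le_trans (@nneseries_lim_ge R (fun i => (i.+1%:R ^+ 5 * chain X i (2 ^ i) x)%:E) xpredT 0 i.+1 _); last first.
  by move=> n _ _; rewrite lee_fin mulr_ge0 ?exprn_ge0 ?chain_ge0.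
rewrite big_nat_recr //=; rewrite -[leLHS]add0e leeD2r //.
apply: sume_ge0 => n _; by rewrite lee_fin mulr_ge0 ?exprn_ge0 ?chain_ge0.
Qed.

(** The subtracted 1 / (j + 1) makes the induction telescope, through 1 / (j + 2)^2 <= 1 / (j + 1) -
    1 / (j + 2). *)
Let tail_le i j m x (q : R) : Q x = q%:E -> (i <= j)%N -> (2 ^ j <= m)%N -> (m <= 2 ^ j.+1)%N ->
  `|\sum_(2 ^ i <= k < m) X k x| <= Num.sqrt q * (2 / i.+1%:R - j.+1%:R^-1).
Proof.
move=> Qq; elim: j m => [|j IH] m ij jm mj.
  have -> : i = 0%N by lia.
  apply: (le_trans (block_le Qq _ _)) => //; rewrite ?expn0 //.
  rewrite ler_wpM2l ?sqrtr_ge0 // expr1n invr1; lra.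
have i0 : 0 < i.+1%:R :> R by rewrite ltr0n.
have [ji|] := ltnP j i.
  have ei : i = j.+1 by lia.
  move: jm mj; rewrite -ei => jm mj.
  apply: (le_trans (block_le Qq jm mj)); rewrite ler_wpM2l ?sqrtr_ge0 //.
  rewrite (_ : 2 / i.+1%:R - i.+1%:R^-1 = i.+1%:R^-1); last first.
    by move: i0; generalize (i.+1%:R : R) => u u0; field; rewrite gt_eqF.
  by rewrite lef_pV2 ?posrE ?exprn_gt0 // ler_eXnr // ler1n.
move=> ij'; have := IH (2 ^ j.+1)%N ij'; rewrite leq_exp2l // leqnn => /(_ (leqnSn _) isT).
rewrite (@big_cat_nat _ _ _ (2 ^ j.+1) (2 ^ i) m) ?leq_exp2l //=.
have := block_le Qq jm mj.
set u := \sum_(_ <= k < m) _; set v := \sum_(_ <= k < _) _ => hu hv.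
apply: (le_trans (ler_normD _ _)).
apply: (le_trans (lerD hv hu)); rewrite -mulrDr ler_wpM2l ?sqrtr_ge0 //.
have e : j.+2%:R = j.+1%:R + 1 :> R by rewrite natr1.
have j0 : 0 < j.+1%:R :> R by rewrite ltr0n.
suff : (j.+2%:R ^+ 2)^-1 <= j.+1%:R^-1 - j.+2%:R^-1 :> R.
  by move=> h1; rewrite -addrA lerD2l -lerBrDl opprK [leRHS]addrC.
have -> : j.+1%:R^-1 - j.+2%:R^-1 = (j.+1%:R * j.+2%:R)^-1 :> R.
  have h (w : R) : 0 < w -> w^-1 - (w + 1)^-1 = (w * (w + 1))^-1.
    by move=> w0; field; rewrite (gt_eqF w0) gt_eqF // addr_gt0.
  by rewrite e; exact: h.
rewrite lef_pV2 ?posrE ?exprn_gt0 ?mulr_gt0 ?ltr0n //.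
by rewrite expr2 ler_wpM2r // ler_nat.
Qed.

Let osc_le i n m x (q : R) : Q x = q%:E -> (2 ^ i <= n)%N -> (n <= m)%N ->
  `|\sum_(n <= k < m) X k x| <= Num.sqrt q * (4 / i.+1%:R).
Proof.
move=> Qq i_n nm; have n0 : (0 < n)%N by apply: leq_trans i_n; rewrite expn_gt0.
have m0 : (0 < m)%N by exact: leq_trans nm.
have loglt k : (0 < k)%N -> (2 ^ trunc_log 2 k <= k)%N /\ (k <= 2 ^ (trunc_log 2 k).+1)%N.
  move=> k0; split; first by rewrite trunc_logP.
  by rewrite ltnW // trunc_log_ltn.
set r := trunc_log 2 n; have [r1 r2] := loglt n n0.
have [s1 s2] := loglt m m0.
have ir : (i <= r)%N by rewrite /r trunc_log_max.
have rs : (r <= trunc_log 2 m)%N by apply: leq_trunc_log.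
have := tail_le Qq rs s1 s2; have := tail_le Qq (leqnn r) r1 r2.
rewrite (@big_cat_nat _ _ _ n (2 ^ r)%N m) //=.
set u := \sum_(_ <= k < n) _; set v := \sum_(_ <= k < m) _ => hu huv.
have -> : v = (u + v) - u by rewrite addrC addKr.
apply: (le_trans (ler_normB _ _)); apply: (le_trans (lerD huv hu)).
rewrite -mulrDr ler_wpM2l ?sqrtr_ge0 //.
have a1 : 0 <= (trunc_log 2 m).+1%:R^-1 :> R by rewrite invr_ge0.
have a2 : 0 <= r.+1%:R^-1 :> R by rewrite invr_ge0.
have : r.+1%:R^-1 <= i.+1%:R^-1 :> R by rewrite lef_pV2 ?posrE ?ltr0n // ler_nat.
move: a1 a2; set P := r.+1%:R^-1; set I := i.+1%:R^-1; set M := _^-1 => a1 a2 h; lra.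
Qed.

(** The upper limit is measurable and defined at every point before any convergence is known; it is
    the limit wherever [Q] is finite. *)
Definition esup_psums x : R := fine (limn_esup (fun n => (psums X n x)%:E)).

Lemma measurable_esup_psums : measurable_fun D esup_psums.
Proof.
apply: (measurableT_comp (fine_measurable measurableT)).
by apply: measurable_fun_limn_esup => n; apply/measurable_EFinP; exact: mXsum.
Qed.

Let cvgX x : (Q x < +oo)%E -> psums X ^~ x @ \oo --> esup_psums x.
Proof.
move=> Qfin; have Qfn : Q x \is a fin_num by rewrite ge0_fin_numE.
have Qq : Q x = (fine (Q x))%:E by rewrite fineK.
set q := fine (Q x) in Qq.
have hc : cvgn (psums X ^~ x).
  apply: cauchy_cvg; apply/cauchy_exP => e e0.
  have [N hN] : exists N : nat, Num.sqrt q * 4 / e < N.+1%:R.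
    exists (Num.truncn `|Num.sqrt q * 4 / e|).
    by rewrite (le_lt_trans (ler_norm _)) // truncnS_gt.
  exists (psums X (2 ^ N) x); exists (2 ^ N)%N => // n /= hn.
  rewrite /ball /= distrC psumsB // (le_lt_trans (@osc_le N _ _ _ _ Qq _ _)) //.
  by rewrite mulrA ltr_pdivrMr ?ltr0n // (mulrC e); move: hN; rewrite ltr_pdivrMr.
have hl : psums X ^~ x @ \oo --> limn (psums X ^~ x) by exact: hc.
rewrite /esup_psums (_ : limn_esup _ = (limn (psums X ^~ x))%:E) //.
apply: (cvg_limn_einf_sup _).2; apply: cvg_EFin => //.
exact: nearW.
Qed.

Let integrableQ : mu.-integrable D Q.
Proof.
apply/integrableP; split=> //; apply: le_lt_trans (ltry W).
by apply: le_trans intQ; apply: ge0_le_integral => // [|x _]; [exact: measurableT_comp|rewrite gee0_abs].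
Qed.

Lemma ae_cvg_psums : {ae mu, forall x, D x -> psums X ^~ x @ \oo --> esup_psums x}.
Proof.
apply: filterS (integrable_ae mD integrableQ) => x h Dx; apply: cvgX.
by rewrite -ge0_fin_numE //; exact: h.
Qed.

(** The oscillation bound is uniform in the upper index, so it passes to the limit pointwise; its
    square is a multiple of [Q], whose integral is at most W. *)
Lemma psums_L2_le i n : (2 ^ i <= n.+1)%N ->
  (\int[mu]_(x in D) ((psums X n x - esup_psums x) ^+ 2)%:E <=
   (16 / i.+1%:R ^+ 2 * W)%:E)%E.
Proof.
move=> i_n; have i0 : 0 < i.+1%:R :> R by rewrite ltr0n.
have c0 : 0 <= 16 / i.+1%:R ^+ 2 :> R by rewrite divr_ge0 ?exprn_ge0.
apply: (@le_trans _ _ (\int[mu]_(x in D) ((16 / i.+1%:R ^+ 2)%:E * Q x))%E); last first.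
  by rewrite ge0_integralZl_EFin // EFinM; apply: lee_wpmul2l intQ; rewrite lee_fin.
apply: ae_ge0_le_integral => //.
- by move=> x _; rewrite lee_fin sqr_ge0.
- apply/measurable_EFinP; apply: measurable_funX; apply: measurable_funB; first exact: mXsum.
  exact: measurable_esup_psums.
- by move=> x _; rewrite mule_ge0.
- exact: emeasurable_funM.
apply: filterS (integrable_ae mD integrableQ) => x h Dx.
have Qq : Q x = (fine (Q x))%:E by rewrite fineK // h.
have Qfin : (Q x < +oo)%E by rewrite Qq ltry.
have q0 : 0 <= fine (Q x) by rewrite -lee_fin -Qq.
rewrite Qq -EFinM lee_fin.
have hx := cvgX Qfin.
suff : `|esup_psums x - psums X n x| <= Num.sqrt (fine (Q x)) * (4 / i.+1%:R).
  move=> h1; have := ler_pM (normr_ge0 _) (normr_ge0 _) h1 h1; rewrite -!expr2.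
  rewrite real_normK ?num_real // -sqrrN opprB => /le_trans; apply.
  rewrite exprMn sqr_sqrtr // expr_div_n mulrC (_ : 4 ^+ 2 = 16) //.
  by rewrite expr2; lra.
have hc : (fun m => `|psums X m x - psums X n x|) @ \oo --> `|esup_psums x - psums X n x|.
  by apply: cvg_norm; apply: cvgB => //; exact: cvg_cst.
rewrite -(cvg_lim _ hc) //; apply: limr_le; first by apply/cvg_ex; eexists; exact: hc.
exists n => // m /= nm; rewrite psumsB //.
exact: osc_le.
Qed.

End RademacherMenshov.

(** * Trigonometric series *)

Section LebesgueTransfer.
Context {R : realType}.
Local Notation lambda := (@completed_lebesgue_measure R).

Lemma measurable_borel_lebesgue (A : set R) :
  measurable (A : set (measurableTypeR R)) -> measurable (A : set (lebesgueType R)).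
Proof. exact: sub_caratheodory. Qed.

Lemma measurable_fun_id_lebesgue :
  measurable_fun setT (id : lebesgueType R -> measurableTypeR R).
Proof. by move=> _ A mA; rewrite setTI preimage_id; exact: measurable_borel_lebesgue. Qed.

Lemma measurable_fun_borel_lebesgue (D : set R) (f : R -> R) :
  measurable_fun setT (f : measurableTypeR R -> measurableTypeR R) ->
  lebesgue_measurable_fun D f.
Proof.
move=> mf; apply: measurable_funTS.
exact: (measurableT_comp mf measurable_fun_id_lebesgue).
Qed.

Lemma continuous_lebesgue_measurable_fun (D : set R) (f : R -> R) :
  continuous f -> lebesgue_measurable_fun D f.
Proof. by move=> cf; apply: measurable_fun_borel_lebesgue; exact: continuous_measurable_fun. Qed.

Definition unit_itv : set (lebesgueType R) := `[0%R, 1%R]%classic.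

Lemma measurable_unit_itv : measurable unit_itv.
Proof. by apply: measurable_borel_lebesgue; exact: measurable_itv. Qed.

Lemma lambda_unit_itv : lambda unit_itv = 1%E.
Proof.
have -> : lambda unit_itv = lebesgue_measure (`[0%R, 1%R]%classic : set R) by [].
by rewrite lebesgue_measure_itv /= lte_fin ltr01 oppr0 adde0.
Qed.

Lemma bounded_integrable (f : R -> R) (M : R) : lebesgue_measurable_fun unit_itv f ->
  (forall x, `|f x| <= M) -> lambda.-integrable unit_itv (EFin \o f).
Proof.
move=> mf fM; apply: measurable_bounded_integrable => //.
- exact: measurable_unit_itv.
- by rewrite [X in (X < _)%E]lambda_unit_itv ltry.
- exists M; split; first exact: num_real.
  by move=> r Mr x _; exact: le_trans (fM x) (ltW Mr).
Qed.

(** The completed measure pushed forward along the identity is [lebesgue_measure]; this makes the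
    fundamental theorem of calculus applicable. *)
Lemma integral_lebesgue_borel (f : R -> R) (M : R) : continuous f ->
  (forall x, `|f x| <= M) ->
  (\int[lambda]_(x in unit_itv) (f x)%:E =
   \int[@lebesgue_measure R]_(x in `[0%R, 1%R]) (f x)%:E)%E.
Proof.
move=> cf fM.
have intf := bounded_integrable (@continuous_lebesgue_measurable_fun unit_itv _ cf) fM.
have mf : measurable_fun setT (EFin \o f : measurableTypeR R -> \bar R).
  by apply/measurable_EFinP; exact: continuous_measurable_fun.
have m01 : measurable (`[0%R, 1%R]%classic : set (measurableTypeR R)) by exact: measurable_itv.
have h := @integral_pushforward _ _ _ _ R _ measurable_fun_id_lebesgue lambda
  (`[0%R, 1%R]%classic : set (measurableTypeR R)) _ mf intf m01.
rewrite -[LHS]h; apply: eq_measure_integral => //.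
exact: measurable_fun_id_lebesgue.
Qed.

Local Notation "\I f" := (Rintegral lambda unit_itv f) (at level 10, f at level 9).
Local Notation Int f := (lambda.-integrable unit_itv (EFin \o f)).

Lemma Rint_sum (I : Type) (r : seq I) (P : pred I) (h : I -> R -> R) :
  (forall i, Int (h i)) ->
  Int (fun x => \sum_(i <- r | P i) h i x) /\
  \I (fun x => \sum_(i <- r | P i) h i x) = \sum_(i <- r | P i) \I (h i).
Proof.
move=> hint; have mD := measurable_unit_itv.
have h1 s : Int (fun x => \sum_(i <- s | P i) h i x).
  have := @integrable_sum _ _ _ lambda _ mD _ s P (fun i => EFin \o h i) (fun i _ => hint i).
  by under [X in _.-integrable _ X]eq_fun do rewrite sumEFin.
split => //; elim: r => [|i r IH].
  rewrite big_nil (@eq_Rintegral _ _ _ _ _ (cst 0)); last by move=> x _; rewrite big_nil.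
  by rewrite Rintegral_cst // mul0r.
rewrite big_cons; case: ifPn => Pi.
  rewrite -IH -RintegralD //; apply: eq_Rintegral => x _.
  by rewrite big_cons Pi.
by rewrite -IH; apply: eq_Rintegral => x _; rewrite big_cons (negbTE Pi).
Qed.

Lemma RintZ (a : R) (f : R -> R) : Int f -> Int (fun x => a * f x).
Proof.
move=> fint; have := integrableZl measurable_unit_itv a fint.
by apply: eq_integrable => //; exact: measurable_unit_itv.
Qed.

Lemma continuous_sinM (a : R) : continuous (fun x => sin (a * x)).
Proof.
move=> x; apply: (@continuous_comp _ _ _ (fun x => a * x) sin).
  exact: mulrl_continuous.
exact: continuous_sin.
Qed.

Lemma continuous_cosM (a : R) : continuous (fun x => cos (a * x)).
Proof.
move=> x; apply: (@continuous_comp _ _ _ (fun x => a * x) cos).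
  exact: mulrl_continuous.
exact: continuous_cos.
Qed.

Definition tsin (n : nat) (x : R) : R := sin (2 * pi * n%:R * x).
Definition tcos (n : nat) (x : R) : R := cos (2 * pi * n%:R * x).

Lemma tsin_le1 n x : `|tsin n x| <= 1. Proof. exact: sin_max. Qed.
Lemma tcos_le1 n x : `|tcos n x| <= 1. Proof. exact: cos_max. Qed.

Lemma continuous_tsin n : continuous (tsin n). Proof. exact: continuous_sinM. Qed.
Lemma continuous_tcos n : continuous (tcos n). Proof. exact: continuous_cosM. Qed.

Lemma sin_natpi (n : nat) : sin (2 * pi * n%:R) = 0 :> R.
Proof.
have -> : 2 * pi * n%:R = 0 + (pi *+ 2) *+ n :> R.
  by rewrite add0r -[pi *+ 2]mulr_natl -[X in _ = X]mulr_natr.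
by rewrite (periodicn (@sinD2pi R)) sin0.
Qed.

Lemma cos_natpi (n : nat) : cos (2 * pi * n%:R) = 1 :> R.
Proof.
have -> : 2 * pi * n%:R = 0 + (pi *+ 2) *+ n :> R.
  by rewrite add0r -[pi *+ 2]mulr_natl -[X in _ = X]mulr_natr.
by rewrite (periodicn (@cosD2pi R)) cos0.
Qed.

Lemma Rint_FTC (F f : R -> R) (M : R) : continuous f -> (forall x, `|f x| <= M) ->
  (forall x : R, is_derive x 1 F (f x)) -> \I f = F 1 - F 0.
Proof.
move=> cf fM Ff; rewrite /Rintegral (integral_lebesgue_borel cf fM).
have cF : continuous F.
  by move=> x; apply: differentiable_continuous; apply/derivable1_diffP; case: (Ff x).
rewrite (@continuous_FTC2 _ f F 0 1) //.
- exact: continuous_subspaceT.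
- split; last 2 first.
  + exact/cvg_at_right_filter/cF.
  + exact/cvg_at_left_filter/cF.
  by move=> x _; case: (Ff x).
- by move=> x _; rewrite derive1E; case: (Ff x).
Qed.

Lemma Rint_tcos n : \I (tcos n) = (n == 0)%:R.
Proof.
have [->|n0] := eqVneq n 0%N.
  rewrite (@eq_Rintegral _ _ _ _ _ (cst 1)); last by move=> x _; rewrite /tcos mulr0 mul0r cos0.
  by rewrite (@Rintegral_cst _ _ _ lambda _ measurable_unit_itv) [X in fine X]lambda_unit_itv mul1r.
pose w : R := 2 * pi * n%:R.
have w0 : w != 0 by rewrite gt_eqF // mulr_gt0 ?ltr0n ?lt0n // mulr_gt0 ?pi_gt0.
have hF (x : R) : is_derive x 1 (fun x => w^-1 * sin (w * x)) (tcos n x).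
  apply: is_derive_eq; rewrite /tcos -/w /GRing.scale /=; field.
  exact: w0.
rewrite (Rint_FTC (@continuous_tcos n) (tcos_le1 n) hF).
by rewrite mulr1 mulr0 sin0 sin_natpi !mulr0 subrr.
Qed.

Lemma Rint_tsin n : \I (tsin n) = 0.
Proof.
have [->|n0] := eqVneq n 0%N.
  rewrite (@eq_Rintegral _ _ _ _ _ (cst 0)); last by move=> x _; rewrite /tsin mulr0 mul0r sin0.
  by rewrite (@Rintegral_cst _ _ _ lambda _ measurable_unit_itv) mul0r.
pose w : R := 2 * pi * n%:R.
have w0 : w != 0 by rewrite gt_eqF // mulr_gt0 ?ltr0n ?lt0n // mulr_gt0 ?pi_gt0.
have hF (x : R) : is_derive x 1 (fun x => - w^-1 * cos (w * x)) (tsin n x).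
  apply: is_derive_eq; rewrite /tsin -/w /GRing.scale /=; field.
  exact: w0.
rewrite (Rint_FTC (@continuous_tsin n) (tsin_le1 n) hF).
by rewrite mulr1 mulr0 cos0 cos_natpi subrr.
Qed.

End LebesgueTransfer.

Section TrigonometricSums.
Context {R : realType}.
Local Notation lambda := (@completed_lebesgue_measure R).
Local Notation "\I f" := (Rintegral lambda unit_itv f) (at level 10, f at level 9).
Local Notation Int f := (lambda.-integrable unit_itv (EFin \o f)).
Implicit Types (n m j k : nat) (a b : R).

Lemma Rint_EFin (f : R -> R) : Int f ->
  (\int[lambda]_(x in unit_itv) (f x)%:E)%E = (\I f)%:E.
Proof.
move=> fint; rewrite /Rintegral fineK //.
exact: (integrable_fin_num measurable_unit_itv fint).
Qed.

Definition trig a b n (x : R) : R := a * tsin n x + b * tcos n x.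

Lemma trig_bound a b n x : `|trig a b n x| <= `|a| + `|b|.
Proof.
apply: (le_trans (ler_normD _ _)); rewrite !normrM; apply: lerD.
  by rewrite -[leRHS]mulr1 ler_wpM2l // tsin_le1.
by rewrite -[leRHS]mulr1 ler_wpM2l // tcos_le1.
Qed.

Lemma continuous_trig a b n : continuous (trig a b n).
Proof.
move=> x; apply: cvgD.
  by apply: cvgM; [exact: cvg_cst|exact: continuous_tsin].
by apply: cvgM; [exact: cvg_cst|exact: continuous_tcos].
Qed.

Lemma measurable_trig D a b n : lebesgue_measurable_fun D (trig a b n).
Proof. by apply: continuous_lebesgue_measurable_fun; exact: continuous_trig. Qed.

Lemma trig_dilate a b n k x : trig a b (n * k) x = trig a b n (k%:R * x).
Proof.
by rewrite /trig /tsin /tcos natrM !mulrA.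
Qed.

Lemma Int_trig a b n : Int (trig a b n).
Proof. exact: (bounded_integrable (@measurable_trig _ a b n) (trig_bound a b n)). Qed.

Lemma Int_tsin n : Int (tsin n).
Proof.
apply: (@bounded_integrable _ _ 1 _ (tsin_le1 n)).
by apply: continuous_lebesgue_measurable_fun; exact: continuous_tsin.
Qed.

Lemma Int_tcos n : Int (tcos n).
Proof.
apply: (@bounded_integrable _ _ 1 _ (tcos_le1 n)).
by apply: continuous_lebesgue_measurable_fun; exact: continuous_tcos.
Qed.

Lemma Rint_trig a b n : \I (trig a b n) = b * (n == 0)%:R.
Proof.
have mD := @measurable_unit_itv R.
rewrite /trig RintegralD //; last 2 first.
- exact: RintZ (Int_tsin n).
- exact: RintZ (Int_tcos n).
rewrite RintegralZl //; last exact: Int_tsin.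
rewrite RintegralZl //; last exact: Int_tcos.
by rewrite Rint_tsin Rint_tcos mulr0 add0r.
Qed.

(** In truncated subtraction [(n - m) + (m - n)] is |n - m|. The sign of the sine coefficient at
    this frequency depends on which of n, m is larger, hence the existential [c]; it disappears on
    integration. *)
Lemma trigM a b n a' b' m : exists c, forall x,
  trig a b n x * trig a' b' m x =
  trig ((a * b' + b * a') / 2) ((b * b' - a * a') / 2) (n + m) x +
  trig c ((a * a' + b * b') / 2) ((n - m) + (m - n)) x.
Proof.
pose u x := 2 * pi * n%:R * x : R; pose v x := 2 * pi * m%:R * x : R.
have addE x : 2 * pi * (n + m)%:R * x = u x + v x by rewrite natrD /u /v; ring.
have [mn|nm] := leqP m n.
  exists ((a * b' - b * a') / 2) => x.
  have subE : 2 * pi * ((n - m) + (m - n))%:R * x = u x - v x.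
    by rewrite (_ : n - m + (m - n) = n - m)%N ?natrB // /u /v; [ring|lia].
  rewrite /trig /tsin /tcos addE subE -/(u x) -/(v x) sinD cosD sinB cosB; by field.
exists (- (a * b' - b * a') / 2) => x.
have subE : 2 * pi * ((n - m) + (m - n))%:R * x = v x - u x.
  by rewrite (_ : n - m + (m - n) = m - n)%N ?natrB ?(ltnW nm) // /u /v; [ring|lia].
rewrite /trig /tsin /tcos addE subE -/(u x) -/(v x) sinD cosD sinB cosB; by field.
Qed.

Lemma Rint_trigM a b n a' b' m : (0 < n)%N ->
  Int (fun x => trig a b n x * trig a' b' m x) /\
  \I (fun x => trig a b n x * trig a' b' m x) = (n == m)%:R * ((a * a' + b * b') / 2).
Proof.
move=> n0; have [c hc] := trigM a b n a' b' m; have mD := @measurable_unit_itv R.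
have -> : (fun x => trig a b n x * trig a' b' m x) =
  (fun x => trig ((a * b' + b * a') / 2) ((b * b' - a * a') / 2) (n + m) x +
  trig c ((a * a' + b * b') / 2) ((n - m) + (m - n)) x) by apply/funext.
split.
  have := integrableD mD (Int_trig ((a * b' + b * a') / 2) ((b * b' - a * a') / 2) (n + m))
    (Int_trig c ((a * a' + b * b') / 2) ((n - m) + (m - n))).
  by apply: eq_integrable.
rewrite RintegralD //; [|exact: Int_trig|exact: Int_trig].
rewrite !Rint_trig (_ : (n + m == 0)%N = false) ?mulr0 ?add0r; last by lia.
by rewrite mulrC (_ : (n - m + (m - n) == 0)%N = (n == m)) //; lia.
Qed.

(** Coincidences among the frequencies are allowed: for blocks of a Fourier series only the diagonal
    survives, while for dilated sums the coincidences produce the gcd form. *)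
Lemma trig_sum_L2 (I : eqType) (r : seq I) (nu : I -> nat) (al be : I -> R) :
  (forall i, i \in r -> (0 < nu i)%N) ->
  (\int[lambda]_(x in unit_itv)
     ((\sum_(i <- r) trig (al i) (be i) (nu i) x) ^+ 2)%:E)%E =
  (\sum_(i <- r) \sum_(j <- r) (nu i == nu j)%:R * ((al i * al j + be i * be j) / 2))%:E.
Proof.
move=> nu0.
pose h i := trig (al i) (be i) (nu i).
have hM (i j : I) : Int (fun x => h i x * h j x).
  apply: (@bounded_integrable _ _ ((`|al i| + `|be i|) * (`|al j| + `|be j|))).
    by apply: measurable_funM; exact: measurable_trig.
  by move=> x; rewrite normrM ler_pM // trig_bound.
have h1 (i : I) := @Rint_sum _ _ r predT (fun (j : I) x => h i x * h j x) (hM i).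
have h2 := @Rint_sum _ _ r predT (fun (i : I) x => \sum_(j <- r) h i x * h j x) (fun i => (h1 i).1).
have -> : (fun x => ((\sum_(i <- r) trig (al i) (be i) (nu i) x) ^+ 2)%:E) =
   EFin \o (fun x => \sum_(i <- r) \sum_(j <- r) h i x * h j x).
  by apply/funext => x /=; rewrite expr2 big_distrl /=; under eq_bigr do rewrite big_distrr.
rewrite [LHS](Rint_EFin h2.1) h2.2; congr EFin.
rewrite big_seq [RHS]big_seq; apply: eq_bigr => i ir.
by rewrite (h1 i).2; apply: eq_bigr => j _; rewrite (Rint_trigM _ _ _ _ _ (nu0 _ ir)).2.
Qed.

(** Write rho = e^(-2t). One factor e^(-t i) absorbs the sixth power, via i + 1 <= (6 / t) e^((i +
    1) t / 6), and the other is summed geometrically. *)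
Lemma exp_poly_sum_le (rho : R) : 0 < rho -> rho < 1 ->
  exists W, forall n, \sum_(0 <= i < n) i.+1%:R ^+ 6 * rho ^+ i <= W :> R.
Proof.
move=> r0 r1; have [t t0 tE] : exists2 t, 0 < t & t = - ln rho / 2.
  by exists (- ln rho / 2); rewrite ?divr_gt0 // oppr_gt0 ln_lt0 // r0 r1.
pose s := expR (- t); have s0 : 0 < s by exact: expR_gt0.
have s1 : s < 1 by rewrite /s -expR0 ltr_expR oppr_lt0.
have rE : rho = s * s.
  by rewrite /s -expRD -[LHS]lnK ?posrE //; congr expR; rewrite tE; field.
pose C := (6 / t) ^+ 6 * expR t.
have C0 : 0 <= C by rewrite mulr_ge0 ?expR_ge0 // exprn_ge0 // divr_ge0 // ltW.
exists (C / (1 - s)) => n.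
have key i : i.+1%:R ^+ 6 * rho ^+ i <= C * s ^+ i :> R.
  have e1 : i.+1%:R <= 6 / t * expR (i.+1%:R * t / 6) :> R.
    rewrite mulrAC ler_pdivlMr // -ler_pdivrMl //.
    apply: (@le_trans _ _ (1 + i.+1%:R * t / 6)); last exact: expR_ge1Dx.
    by rewrite mulrC lerDr.
  have e2 : i.+1%:R ^+ 6 <= (6 / t) ^+ 6 * expR (i.+1%:R * t) :> R.
    apply: (@le_trans _ _ ((6 / t * expR (i.+1%:R * t / 6)) ^+ 6)).
      rewrite lerXn2r ?nnegrE // mulr_ge0 ?expR_ge0 // divr_ge0 // ltW //.
    rewrite exprMn -expRM_natl ler_wpM2l ?exprn_ge0 ?divr_ge0 ?(ltW t0) //.
    by rewrite (_ : 6 * (i.+1%:R * t / 6) = i.+1%:R * t) //; field.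
  rewrite rE exprMn mulrA ler_wpM2r ?exprn_ge0 ?(ltW s0) //.
  apply: (le_trans (ler_wpM2r (exprn_ge0 i (ltW s0)) e2)).
  rewrite /C -mulrA ler_wpM2l ?exprn_ge0 ?divr_ge0 ?(ltW t0) //.
  rewrite /s -expRM_natl -expRD ler_expR -natr1.
  by rewrite le_eqVlt; apply/orP; left; apply/eqP; ring.
apply: (@le_trans _ _ (\sum_(0 <= i < n) C * s ^+ i)); first exact: ler_sum.
rewrite -mulr_sumr ler_wpM2l // -[leRHS]mul1r ler_pdivlMr ?subr_gt0 // mulr_suml.
have -> : \sum_(0 <= i < n) s ^+ i * (1 - s) = 1 - s ^+ n.
  clear key; elim: n => [|n IH]; first by rewrite big_geq // expr0 subrr.
  by rewrite big_nat_recr //= IH exprSr; ring.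
by rewrite gerBl exprn_ge0 // ltW.
Qed.

Context (al M : R) (al2 : 1 / 2 < al) (A B : nat -> R).
Hypothesis A_le : forall j, (0 < j)%N -> `|A j| <= M * j%:R `^ (- al).
Hypothesis B_le : forall j, (0 < j)%N -> `|B j| <= M * j%:R `^ (- al).

Definition fourier_sum n x : R := \sum_(1 <= j < n.+1) trig (A j) (B j) j x.

(* The limsup of the partial sums makes the sum a function defined at every point. *)
Definition fourier_series (x : R) : R :=
  fine (limn_esup (fun n => (fourier_sum n x)%:E)).

Let coef_sqr_le j : (0 < j)%N ->
  (A j ^+ 2 + B j ^+ 2) / 2 <= M ^+ 2 * j%:R `^ (- (2 * al)).
Proof.
move=> j0; have jn0 : j%:R != 0 :> R by rewrite pnatr_eq0 -lt0n.
have -> : M ^+ 2 * j%:R `^ (- (2 * al)) = (M * j%:R `^ (- al)) ^+ 2.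
  rewrite exprMn; congr (_ * _); rewrite expr2 -powRD ?jn0 ?implybT //.
  by congr (_ `^ _); ring.
have h (u v : R) : `|u| <= v -> u ^+ 2 <= v ^+ 2.
  move=> uv; rewrite -(real_normK (num_real u)) lerXn2r ?nnegrE //.
  exact: le_trans uv.
have := h _ _ (A_le j0); have := h _ _ (B_le j0); lra.
Qed.

(** The block starting at 2^i is at most M^2 2^(i (1 - 2 al)), which is geometric because al >
    1/2. *)
Lemma fourier_block_sum_le : exists W, forall n, \sum_(0 <= i < n)
  i.+1%:R ^+ 6 * \sum_(2 ^ i <= j < 2 ^ i.+1) ((A j ^+ 2 + B j ^+ 2) / 2) <= W :> R.
Proof.
pose rho : R := 2 `^ (1 - 2 * al).
have r0 : 0 < rho by exact: powR_gt0.
have r1 : rho < 1.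
  have l2 : 0 < ln 2 :> R by rewrite ln_gt0 // ltr1n.
  have h : (1 - 2 * al) * ln 2 < 0 by rewrite pmulr_llt0 // subr_lt0 -ltr_pdivrMl // mulrC.
  by rewrite /rho /powR gt_eqF // -[ltRHS]expR0 ltr_expR.
have [W hW] := exp_poly_sum_le r0 r1; exists (M ^+ 2 * W) => n.
apply: (@le_trans _ _ (M ^+ 2 * \sum_(0 <= i < n) i.+1%:R ^+ 6 * rho ^+ i)); last first.
  by rewrite ler_wpM2l ?sqr_ge0.
rewrite mulr_sumr; apply: ler_sum => i _; rewrite mulrCA ler_wpM2l ?exprn_ge0 //.
apply: (@le_trans _ _ (\sum_(2 ^ i <= j < 2 ^ i.+1) M ^+ 2 * (2 ^ i)%:R `^ (- (2 * al)))).
  apply: ler_sum_nat => j /andP[ij ji].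
  have i0 : (0 < 2 ^ i)%N by rewrite expn_gt0.
  have j0 : (0 < j)%N by exact: leq_trans ij.
  apply: (le_trans (coef_sqr_le j0)); rewrite ler_wpM2l ?sqr_ge0 //.
  rewrite !powRN lef_pV2 ?posrE ?powR_gt0 ?ltr0n //.
  by rewrite ge0_ler_powR ?nnegrE ?ler_nat // mulr_ge0 // ltW // (lt_trans _ al2) // divr_gt0.
rewrite sumr_const_nat -mulrnAr ler_wpM2l ?sqr_ge0 //.
have -> : (2 ^ i.+1 - 2 ^ i = 2 ^ i)%N by rewrite expnS mul2n -addnn addnK.
rewrite -[leLHS]mulr_natl powR_natN ?expn_gt0 // natrX.
by rewrite /rho -!powR_mulrn ?powR_ge0 // -!powRrM mulrC.
Qed.

(** For fixed k the frequencies j k are distinct, so dilation preserves orthogonality and the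
    undilated block bounds feed the maximal inequality. *)
Lemma fourier_series_dilated k : (0 < k)%N ->
  {ae lambda, forall x, unit_itv x ->
     fourier_sum n (k%:R * x) @[n --> \oo] --> fourier_series (k%:R * x)} /\
  exists W, forall i n, (2 ^ i <= n.+1)%N ->
    (\int[lambda]_(x in unit_itv)
       ((fourier_sum n (k%:R * x) - fourier_series (k%:R * x)) ^+ 2)%:E <=
     (16 / i.+1%:R ^+ 2 * W)%:E)%E.
Proof.
move=> k0; pose X j : lebesgueType R -> R := trig (A j) (B j) (j * k).
pose b j := (A j ^+ 2 + B j ^+ 2) / 2.
have mX j : measurable_fun unit_itv (X j : lebesgueType R -> R) by exact: measurable_trig.
have [W hW] := fourier_block_sum_le.
have Xle (i a m : nat) : (2 ^ i <= a)%N -> (a <= m)%N -> (m <= 2 ^ i.+1)%N ->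
  (\int[lambda]_(x in unit_itv) ((\sum_(a <= j < m) X j x) ^+ 2)%:E <=
   (\sum_(a <= j < m) b j)%:E)%E.
  move=> ia am _; have a0 : (0 < a)%N by rewrite (leq_trans _ ia) // expn_gt0.
  rewrite trig_sum_L2; last first.
    by move=> j; rewrite mem_index_iota muln_gt0 k0 andbT => /andP[+ _]; exact: leq_trans.
  rewrite lee_fin; apply: ler_sum_nat => j /andP[aj jm].
  rewrite (bigD1_seq j) ?iota_uniq ?mem_index_iota ?aj //= eqxx mul1r -!expr2.
  rewrite big1 ?addr0 // => l lj; rewrite eqn_pmul2r // eq_sym (negbTE lj) mul0r //.
have sE n (x : lebesgueType R) : psums X n x = fourier_sum n (k%:R * x).
  by apply: eq_bigr => j _; rewrite /X trig_dilate.
have eE (x : lebesgueType R) : esup_psums X x = fourier_series (k%:R * x).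
  by rewrite /esup_psums /fourier_series; under eq_fun do rewrite sE.
split.
  have := ae_cvg_psums measurable_unit_itv mX Xle hW.
  apply: filterS => x h Dx; rewrite -(eE x).
  by under eq_fun do rewrite -(sE _ x); exact: h.
exists W => i n i_n.
apply: le_trans (psums_L2_le measurable_unit_itv mX Xle hW i_n).
by under [leRHS]eq_integral => x _ do rewrite (sE _ x) (eE x).
Qed.

End TrigonometricSums.

(** * Square-integrable functions on a set of measure 1 *)

Section SquareIntegrable.
Context {R : realType} d (T : measurableType d) (mu : {measure set T -> \bar R}).
Context (D : set T) (mD : measurable D) (muD : mu D = 1%E).
Local Notation "\I f" := (Rintegral mu D f) (at level 10, f at level 9).
Local Notation Int f := (mu.-integrable D (EFin \o f)).

(** Integrates |u| <= e / 2 + u^2 / (2 e); the free parameter e replaces the square root in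
    Cauchy-Schwarz. *)
Lemma integral_abs_le (u : T -> R) (c e : R) : measurable_fun D u ->
  (\int[mu]_(x in D) ((u x) ^+ 2)%:E <= c%:E)%E -> 0 < e ->
  (\int[mu]_(x in D) `|u x|%:E <= (e / 2 + c / (2 * e))%:E)%E.
Proof.
move=> mu' hc e0.
have mu2 : measurable_fun D (fun x => (u x ^+ 2)%:E).
  by apply/measurable_EFinP; exact: measurable_funX.
apply: (@le_trans _ _ (\int[mu]_(x in D)
    ((e / 2)%:E + (2 * e)^-1%:E * (u x ^+ 2)%:E))%E).
  apply: ge0_le_integral => //.
  - by apply/measurable_EFinP; exact: measurableT_comp.
  - by apply: emeasurable_funD => //; apply: emeasurable_funM.
  move=> x _; rewrite -EFinM -EFinD lee_fin.
  have : 0 <= (`|u x| - e) ^+ 2 by exact: sqr_ge0.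
  rewrite sqrrB real_normK ?num_real // => h.
  rewrite -(@ler_pM2l _ (2 * e)) ?mulr_gt0 // mulrDr mulVKf ?mulf_neq0 ?gt_eqF //.
  have -> : 2 * e * (e / 2) = e ^+ 2 by field.
  rewrite -mulr_natl in h; lra.
rewrite ge0_integralD //; last 3 first.
- by move=> x _; rewrite lee_fin divr_ge0 // ltW.
- by move=> x _; rewrite -EFinM lee_fin mulr_ge0 ?sqr_ge0 // invr_ge0 mulr_ge0 // ltW.
- by apply: emeasurable_funM.
rewrite integral_cst // muD mule1.
rewrite ge0_integralZl_EFin //; last 2 first.
- by move=> x _; rewrite lee_fin sqr_ge0.
- by rewrite invr_ge0 mulr_ge0 // ltW.
rewrite EFinD leeD2l // (mulrC c) EFinM; apply: lee_wpmul2l hc.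
by rewrite lee_fin invr_ge0 mulr_ge0 // ltW.
Qed.

Lemma sqint_integrable (u : T -> R) : measurable_fun D u ->
  (\int[mu]_(x in D) ((u x) ^+ 2)%:E < +oo)%E -> Int u.
Proof.
move=> mu'; set J := (\int[mu]_(x in D) _)%E => hJ.
have J0 : (0 <= J)%E by apply: integral_ge0 => x _; rewrite lee_fin sqr_ge0.
apply/integrableP; split; first exact/measurable_EFinP.
apply: le_lt_trans (@integral_abs_le u (fine J) 1 mu' _ ltr01) (ltry _).
by rewrite fineK // ge0_fin_numE.
Qed.

Lemma Int_mul_bounded (u phi : T -> R) : Int u -> measurable_fun D phi ->
  (forall x, `|phi x| <= 1) -> Int (fun x => u x * phi x).
Proof.
move=> iu mphi phi1.
apply: (le_integrable mD _ _ iu).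
  apply/measurable_EFinP; apply: measurable_funM => //.
  by apply/measurable_EFinP; exact: (measurable_int _ iu).
move=> x _ /=; rewrite lee_fin normrM -[leRHS]mulr1 ler_wpM2l //.
Qed.

Lemma le_norm_Rint (u : T -> R) (c e : R) : measurable_fun D u ->
  (\int[mu]_(x in D) ((u x) ^+ 2)%:E <= c%:E)%E -> 0 < e ->
  forall phi : T -> R, measurable_fun D phi -> (forall x, `|phi x| <= 1) ->
  `|\I (fun x => u x * phi x)| <= e / 2 + c / (2 * e).
Proof.
move=> mu' hc e0 phi mphi phi1.
have iu : Int u by apply: sqint_integrable => //; apply: le_lt_trans hc (ltry _).
have iup := Int_mul_bounded iu mphi phi1.
apply: (le_trans (le_normr_Rintegral mD iup)).
rewrite /Rintegral -lee_fin fineK; last first.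
  exact: (integrable_fin_num mD (integrable_norm iup)).
apply: le_trans (integral_abs_le mu' hc e0).
apply: ge0_le_integral; first exact: mD.
- by move=> x _; rewrite lee_fin.
- apply/measurable_EFinP; apply: measurableT_comp => //.
  exact: measurable_funM.
- by apply/measurable_EFinP; exact: measurableT_comp.
by move=> x _; rewrite lee_fin normrM -[leRHS]mulr1 ler_wpM2l.
Qed.

Lemma L2_limit_Rint (h phi : T -> R) (v : R) : measurable_fun D h ->
  (\int[mu]_(x in D) ((h x) ^+ 2)%:E < +oo)%E ->
  measurable_fun D phi -> (forall x, `|phi x| <= 1) ->
  (forall e : R, 0 < e -> exists s : T -> R, [/\ measurable_fun D s,
     Int s, \I (fun x => s x * phi x) = v &
     (\int[mu]_(x in D) ((s x - h x) ^+ 2)%:E <= e%:E)%E]) ->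
  \I (fun x => h x * phi x) = v.
Proof.
move=> mh h2 mphi phi1 H.
have ih := sqint_integrable mh h2.
apply/eqP; rewrite -subr_eq0 -normr_le0; apply/ler_addgt0Pl => e e0; rewrite addr0.
(* Accuracy e^2 is chosen because e / 2 + e^2 / (2 e) = e. *)
have [s [ms int_s sv sh]] := H (e ^+ 2) (exprn_gt0 _ e0).
have msh : measurable_fun D (fun x => s x - h x) by exact: measurable_funB.
have := le_norm_Rint msh sh e0 mphi phi1.
have -> : e / 2 + e ^+ 2 / (2 * e) = e by field; rewrite gt_eqF.
have -> : \I (fun x => (s x - h x) * phi x) = v - \I (fun x => h x * phi x).
  rewrite -sv -RintegralB //; [|exact: Int_mul_bounded|exact: Int_mul_bounded].
  by apply: eq_Rintegral => x _; rewrite mulrBl.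
by rewrite distrC.
Qed.

End SquareIntegrable.

Section SeriesCoefficients.
Context {R : realType}.
Local Notation lambda := (@completed_lebesgue_measure R).
Local Notation "\I f" := (Rintegral lambda unit_itv f) (at level 10, f at level 9).
Local Notation Int f := (lambda.-integrable unit_itv (EFin \o f)).
Context (al M : R) (al2 : 1 / 2 < al) (A B : nat -> R).
Hypothesis A_le : forall j, (0 < j)%N -> `|A j| <= M * j%:R `^ (- al).
Hypothesis B_le : forall j, (0 < j)%N -> `|B j| <= M * j%:R `^ (- al).

Local Notation h := (fourier_series A B).

Lemma periodic_fourier_series : periodic h 1.
Proof.
move=> x; rewrite /fourier_series; congr (fine (limn_esup _)); apply/funext => n.
congr EFin; apply: eq_bigr => j _; rewrite /trig /tsin /tcos.
have -> : 2 * pi * j%:R * (x + 1) = 2 * pi * j%:R * x + (pi *+ 2) *+ j.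
  by rewrite -[pi *+ 2]mulr_natl -[X in _ = _ + X]mulr_natr; ring.
by rewrite (periodicn (@sinD2pi R)) (periodicn (@cosD2pi R)).
Qed.

Lemma measurable_dilated_series D k : lebesgue_measurable_fun D (fun x => h (k%:R * x)).
Proof.
apply: (measurableT_comp (fine_measurable measurableT)).
apply: measurable_fun_limn_esup => n; apply/measurable_EFinP.
apply: measurable_sum => j; 
apply: (@continuous_lebesgue_measurable_fun _ _ (fun x : R => trig (A j) (B j) j (k%:R * x))).
move=> x; apply: (@continuous_comp _ _ _ (fun x : R => k%:R * x) (trig (A j) (B j) j)).
  exact: mulrl_continuous.
exact: continuous_trig.
Qed.

Lemma sqint_dilated_series k : (0 < k)%N ->
  (\int[lambda]_(x in unit_itv) ((h (k%:R * x)) ^+ 2)%:E < +oo)%E.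
Proof.
move=> k0; have [_ [W hW]] := fourier_series_dilated al2 A_le B_le k0.
apply: (@le_lt_trans _ _ (16 / 1%:R ^+ 2 * W)%:E); last exact: ltry.
(* For n = 0 the partial sum is empty, and the approximation error is the square norm of the series
   itself. *)
apply: le_trans (hW 0%N 0%N (leqnn _)); rewrite le_eqVlt; apply/orP; left; apply/eqP.
apply: eq_integral => x _; congr EFin.
by rewrite /fourier_sum big_geq // sub0r sqrrN.
Qed.

Lemma L2_approx_series k : (0 < k)%N -> forall (e : R) (m : nat), 0 < e ->
  exists2 n, (m <= n)%N & (\int[lambda]_(x in unit_itv)
     ((fourier_sum A B n (k%:R * x) - h (k%:R * x)) ^+ 2)%:E <= e%:E)%E.
Proof.
move=> k0 e m e0; have [_ [W hW]] := fourier_series_dilated al2 A_le B_le k0.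
pose i := Num.truncn (16 * `|W| / e).
exists (maxn m (2 ^ i)); first exact: leq_maxl.
apply: (le_trans (hW i _ _)); first by rewrite ltnW // ltnS leq_maxr.
rewrite lee_fin.
have i1 : 16 * `|W| / e < i.+1%:R by exact: truncnS_gt.
have i0 : 0 < i.+1%:R :> R by rewrite ltr0n.
apply: (@le_trans _ _ (16 * `|W| / i.+1%:R)).
  rewrite mulrAC; apply: (@le_trans _ _ (16 * `|W| / i.+1%:R ^+ 2)).
    by rewrite ler_wpM2r ?invr_ge0 ?exprn_ge0 // ler_wpM2l // ler_norm.
  rewrite ler_wpM2l ?mulr_ge0 // lef_pV2 ?posrE ?exprn_gt0 //.
  by rewrite ler_eXnr // ler1n.
by rewrite ler_pdivrMr // (mulrC e) -ler_pdivrMr // ltW.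
Qed.

Let Int_fsum n k : Int (fun x => fourier_sum A B n (k%:R * x)).
Proof.
rewrite /fourier_sum; under eq_fun do under eq_bigr do rewrite -trig_dilate.
by apply: (Rint_sum _ _ _).1 => j; exact: Int_trig.
Qed.

Let Rint_fsum n k a b m : (0 < k)%N ->
  \I (fun x => fourier_sum A B n (k%:R * x) * trig a b m x) =
  \sum_(1 <= j < n.+1) (j * k == m)%N%:R * ((A j * a + B j * b) / 2).
Proof.
move=> k0.
have hI j : Int (fun x => trig (A j) (B j) (j.-1.+1 * k) x * trig a b m x).
  by apply: (Rint_trigM _ _ _ _ _ _).1; rewrite muln_gt0.
have := (@Rint_sum _ _ (index_iota 1 n.+1) predT _ hI).2.
rewrite (@eq_Rintegral _ _ _ lambda unit_itv
    (fun x : lebesgueType R => fourier_sum A B n (k%:R * x) * trig a b m x)); last first.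
  move=> x _; rewrite /fourier_sum mulr_suml; apply: eq_big_nat => j /andP[j0 _].
  by rewrite prednK // trig_dilate.
move=> ->; apply: eq_big_nat => j /andP[j0 _].
by rewrite prednK // (Rint_trigM _ _ _ _ _ _).2 // muln_gt0 j0.
Qed.

(** All partial sums with n >= m have the same coefficient at frequency m, and [L2_limit_Rint]
    carries it to the limit. *)
Lemma Rint_dilated_series_trig k a b m : (0 < k)%N -> `|a| + `|b| <= 1 ->
  \I (fun x => h (k%:R * x) * trig a b m x) =
  \sum_(1 <= j < m.+1) (j * k == m)%N%:R * ((A j * a + B j * b) / 2).
Proof.
move=> k0 ab1; apply: (L2_limit_Rint measurable_unit_itv lambda_unit_itv).
- exact: measurable_dilated_series.
- exact: sqint_dilated_series.
- exact: measurable_trig.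
- by move=> x; exact: le_trans (trig_bound a b m x) ab1.
move=> e e0; have [n mn hn] := L2_approx_series k0 m e0.
exists (fun x => fourier_sum A B n (k%:R * x)); split => //.
- by apply/measurable_EFinP; exact: (measurable_int _ (Int_fsum n k)).
rewrite Rint_fsum // (@big_cat_nat _ _ _ m.+1) //= [X in _ + X]big_nat [X in _ + X]big1 ?addr0 //.
move=> j /andP[mj _]; rewrite (_ : (j * k == m)%N = false) ?mul0r //.
by rewrite gtn_eqF // (leq_trans mj) // leq_pmulr.
Qed.

End SeriesCoefficients.

(** * Uniqueness of Fourier coefficients *)

Section BorelDetection.
Context {R : realType} d (T : measurableType d) (mu : {measure set T -> \bar R}).
Context (D : set T) (mD : measurable D) (p : T -> R).
Hypothesis mp : measurable_fun setT (p : T -> measurableTypeR R).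
Context (g : T -> R) (ig : mu.-integrable D (EFin \o g)).

Let iS (S : set T) : measurable S -> S `<=` D -> mu.-integrable S (EFin \o g).
Proof. by move=> mS SD; exact: integrableS ig. Qed.

Let mpre (A : set (measurableTypeR R)) : measurable A -> measurable (p @^-1` A).
Proof. by move=> mA; rewrite -[X in measurable X]setTI; exact: mp. Qed.

(** A Dynkin argument: open rays are stable under intersection and generate the Borel sets, and the
    sets over which the integral vanishes are stable under complements and disjoint countable
    unions. *)
Lemma integral_preimage_eq0 :
  (forall c, \int[mu]_(x in D `&` p @^-1` `]-oo, c[) (g x)%:E = 0)%E ->
  (\int[mu]_(x in D) (g x)%:E = 0)%E ->
  forall A : set (measurableTypeR R), measurable A ->
    (\int[mu]_(x in D `&` p @^-1` A) (g x)%:E = 0)%E.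
Proof.
move=> hray hD.
have := @dynkin_induction _ (measurableTypeR R) (@RGenInftyO.G R)
  (fun A => \int[mu]_(x in D `&` p @^-1` A) (g x)%:E = 0)%E.
move=> /(_ (RGenInftyO.measurableE R)) ind A mA; apply: ind => //.
- move=> _ _ [a ->] [b ->]; exists (Num.min a b).
  apply/seteqP; split => x /=; rewrite !in_itv /= lt_min; first by case=> -> ->.
  by move=> /andP[].
- by rewrite preimage_setT setIT.
- by move=> _ [c ->].
- move=> S mS hS; have mDS : measurable (D `&` p @^-1` S) by apply: measurableI => //; exact: mpre.
  have mDC : measurable (D `&` p @^-1` (~` S)).
    by apply: measurableI => //; apply: mpre; exact: measurableC.
  have e : D = (D `&` p @^-1` S) `|` (D `&` p @^-1` (~` S)).
    by rewrite -setIUr preimage_setC setUCr setIT.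
  move: hD; rewrite {1}e integral_setU_EFin //; last 2 first.
  + by rewrite -e; apply/measurable_EFinP; exact: (measurable_int _ ig).
  + by apply/disj_setPS => x [[_ h1] [_ h2]].
  by rewrite hS add0e.
- move=> F mF tF hF.
  have mDF k : measurable (D `&` p @^-1` (F k)) by apply: measurableI => //; exact: mpre.
  rewrite preimage_bigcup setI_bigcupr.
  rewrite integral_bigcup //.
  + by rewrite eseries0 // => k _ _; exact: hF.
  + apply/trivIsetP => i j _ _ ij; apply/seteqP; split => // x [[_ h1] [_ h2]].
    move/trivIsetP : tF => /(_ i j Logic.I Logic.I ij) /seteqP[h _].
    by apply: (h (p x)).
  + apply: iS; first exact: bigcupT_measurable.
    by move=> x [k _ []].
by move: mA; rewrite RGenInftyO.measurableE.
Qed.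

(** Up to null sets every measurable set is a preimage, so [g] integrates to 0 over all measurable
    subsets of [D], in particular over those where g >= 0 and where g < 0. *)
Lemma ae_eq0_preimage :
  (forall E : set T, measurable E -> exists A : set (measurableTypeR R), exists N : set T,
     [/\ measurable A, mu.-negligible N & E = p @^-1` A `|` N]) ->
  (forall A : set (measurableTypeR R), measurable A ->
    (\int[mu]_(x in D `&` p @^-1` A) (g x)%:E = 0)%E) ->
  {ae mu, forall x, D x -> g x = 0}.
Proof.
move=> hE hA.
have mg : measurable_fun D g by apply/measurable_EFinP; exact: (measurable_int _ ig).
have int0 E : measurable E -> E `<=` D -> (\int[mu]_(x in E) (g x)%:E = 0)%E.
  move=> mE ED; have [A [N [mA [N' [mN' N'0 NN']] EE]]] := hE E mE.
  have mpA : measurable (p @^-1` A) by exact: mpre.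
  have pAE : p @^-1` A `<=` E by rewrite EE; exact: subsetUl.
  have pAD : D `&` p @^-1` A = p @^-1` A.
    by apply/setIidPr; exact: subset_trans ED.
  have hpA := hA A mA; rewrite pAD in hpA.
  rewrite (negligible_integral mN' mE (iS mE ED) N'0).
  rewrite (negligible_integral mN' mpA (iS mpA (subset_trans pAE ED)) N'0) in hpA.
  rewrite -[RHS]hpA; congr (integral _ _ _).
  apply/seteqP; split => x [Ex N'x]; split => //; last exact: pAE.
  by move: Ex; rewrite EE => -[//|/NN'].
have key (E : set T) (s : R) : measurable E -> E `<=` D -> (forall x, E x -> 0 <= s * g x) -> s != 0 ->
    {ae mu, forall x, E x -> g x = 0}.
  move=> mE ED hs s0.
  have mgE : measurable_fun E (fun x => (s * g x)%:E).
    by apply/measurable_EFinP; apply: measurable_funM => //; exact: measurable_funS mg.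
  have : (\int[mu]_(x in E) `|(s * g x)%:E| = 0)%E.
    rewrite (@eq_integral _ _ _ _ _ (fun x => (s%:E * (g x)%:E)%E)).
      by rewrite integralZl //; [rewrite int0 // mule0|exact: iS].
    by move=> x /[1!inE] Ex; rewrite gee0_abs ?EFinM // lee_fin hs.
  move=> /(ae_eq_integral_abs mu mE mgE); apply: filterS => x h Ex.
  by have [/eqP] := h Ex; rewrite mulf_eq0 (negbTE s0) => /eqP.
have mP : measurable (D `&` [set x | 0 <= g x]).
  have := mg mD (`[0, +oo[%classic) (measurable_itv _).
  by congr measurable; apply/seteqP; split => x [Dx] /=; rewrite in_itv /= andbT.
have mQ : measurable (D `&` [set x | g x < 0]).
  have := mg mD (`]-oo, 0[%classic) (measurable_itv _).
  by congr measurable; apply/seteqP; split => x [Dx] /=; rewrite in_itv /=.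
have h1 := key _ 1 mP (@subIsetl _ _ _) _ (oner_neq0 _).
have h2 := key _ (-1) mQ (@subIsetl _ _ _) _ _.
apply: filterS2 (h1 _) (h2 _ _) => [x a1 a2 Dx|x [_] /=|x [_] /= /ltW|].
- by have [g0|g0] := leP 0 (g x); [exact: a1|exact: a2].
- by rewrite mul1r.
- by rewrite mulN1r oppr_ge0.
- by rewrite oppr_eq0 oner_neq0.
Qed.

(* [1 - (1 - s ^ m) ^ (2 ^ m)] tends to the indicator of [s > 1/2]. *)
Lemma cvg_step_lt (s : R) : 0 <= s -> s < 1 / 2 ->
  (1 - s ^+ m) ^+ (2 ^ m) @[m --> \oo] --> (1 : R).
Proof.
move=> s0 s2.
(* Bernoulli's inequality gives (1 - s^m)^(2^m) >= 1 - (2 s)^m. *)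
have bern (t : R) n : 0 <= t -> t <= 1 -> 1 - n%:R * t <= (1 - t) ^+ n.
  move=> t0 t1; elim: n => [|n IH]; first by rewrite mul0r subr0 expr0.
  rewrite exprS; apply: le_trans (ler_wpM2l _ IH); last by rewrite subr_ge0.
  have : 0 <= n%:R * (t * t) by rewrite !mulr_ge0.
  by rewrite -natr1; lra.
have s1 m : 0 <= s ^+ m /\ s ^+ m <= 1.
  by rewrite exprn_ge0 // exprn_ile1 //; lra.
have h2 : (fun m => 1 - (2 * s) ^+ m) @ \oo --> (1 : R).
  rewrite -[X in _ --> X]subr0; apply: cvgB; first exact: cvg_cst.
  by apply: cvg_expr; rewrite ger0_norm ?mulr_ge0 //; lra.
apply: squeeze_cvgr h2 (@cvg_cst _ _ _ _ _).
apply: nearW => m; apply/andP; split.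
  have [h0 h1] := s1 m; apply: le_trans (bern _ (2 ^ m)%N h0 h1).
  by rewrite natrX exprMn.
by have [h0 h1] := s1 m; rewrite exprn_ile1 // ?subr_ge0 // gerBl.
Qed.

(** 1 - t <= e^(-t) bounds the expression by exp(-(2 s)^m), hence by (2 s)^(-m). *)
Lemma cvg_step_gt (s : R) : 1 / 2 < s -> s <= 1 ->
  (1 - s ^+ m) ^+ (2 ^ m) @[m --> \oo] --> (0 : R).
Proof.
move=> s2 s1.
have s0 : 0 < s by lra.
have sm m : 0 <= s ^+ m /\ s ^+ m <= 1 by rewrite exprn_ge0 ?exprn_ile1 // ltW.
have h2 : (fun m => ((2 * s)^-1) ^+ m) @ \oo --> (0 : R).
  by apply: cvg_expr; rewrite ger0_norm ?invr_ge0 ?mulr_ge0 ?(ltW s0) // invf_lt1 ?mulr_gt0 //; lra.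
apply: squeeze_cvgr (@cvg_cst _ _ _ _ _) h2.
apply: nearW => m; have [h0 h1] := sm m; apply/andP; split.
  by rewrite exprn_ge0 // subr_ge0.
apply: (@le_trans _ _ (expR (- s ^+ m) ^+ (2 ^ m))).
  by rewrite lerXn2r ?nnegrE ?expR_ge0 ?subr_ge0 // expR_ge1Dx.
rewrite -expRM_natl mulrN natrX -exprMn expRN exprVn lef_pV2 ?posrE ?expR_gt0 ?exprn_gt0 ?mulr_gt0 //.
by apply: le_trans (expR_ge1Dx _); rewrite lerDr.
Qed.

(** Dominated convergence: the functions g (1 - (1 - s^m)^(2^m)) have integral 0, are dominated by
    |g|, and tend to g on [P] and to 0 off it. The level s = 1/2, where the limit is another one, is
    excluded almost everywhere. *)
Lemma integral_step_eq0 (s : T -> R) (P : set T) :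
  measurable P -> measurable_fun D s -> (forall x, 0 <= s x <= 1) ->
  {ae mu, forall x, D x -> (P x -> 1 / 2 < s x) /\ (~ P x -> s x < 1 / 2)} ->
  (forall m n, \int[mu]_(x in D) (g x * (1 - s x ^+ m) ^+ n)%:E = 0)%E ->
  (\int[mu]_(x in D `&` P) (g x)%:E = 0)%E.
Proof.
move=> mP ms s01 hs h0.
have mg : measurable_fun D g by apply/measurable_EFinP; exact: (measurable_int _ ig).
pose f m x := (g x * (1 - (1 - s x ^+ m) ^+ (2 ^ m)))%:E.
have q01 m n x : 0 <= (1 - s x ^+ m) ^+ n <= 1.
  have /andP[a b] := s01 x.
  by rewrite exprn_ge0 ?exprn_ile1 ?subr_ge0 ?gerBl ?exprn_ge0 ?exprn_ile1.
have mq m n : measurable_fun D (fun x => (1 - s x ^+ m) ^+ n).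
  by apply: measurable_funX; apply: measurable_funB => //; exact: measurable_funX.
have mf m : measurable_fun D (f m).
  by apply/measurable_EFinP; apply: measurable_funM => //; apply: measurable_funB.
have mGP : measurable_fun D ((EFin \o g) \_ P).
  apply/(measurable_restrict _ mP mD); apply: measurable_funS (measurable_int _ ig) => //.
have ff : {ae mu, forall x, D x -> f m x @[m --> \oo] --> ((EFin \o g) \_ P) x}.
  apply: filterS hs => x hx Dx; have [h1 h2] := hx Dx.
  have /andP[a b] := s01 x.
  rewrite patchE; case: ifPn => [/set_mem Px|/negP nPx].
    have -> : (EFin \o g) x = (g x * (1 - 0))%:E by rewrite /= subr0 mulr1.
    apply: cvg_EFin; first exact: nearW.
    apply: cvgM; first exact: cvg_cst.
    by apply: cvgB; [exact: cvg_cst|apply: cvg_step_gt => //; exact: h1].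
  have -> : point = (g x * (1 - 1))%:E :> \bar R by rewrite subrr mulr0.
  apply: cvg_EFin; first exact: nearW.
  apply: cvgM; first exact: cvg_cst.
  apply: cvgB; [exact: cvg_cst|apply: cvg_step_lt => //; apply: h2].
  by move=> Px; apply: nPx; exact: mem_set.
have dom : {ae mu, forall x m, D x -> (`|f m x| <= `|(EFin \o g) x|)%E}.
  apply: aeW => x m Dx; rewrite lee_fin normrM -[leRHS]mulr1 ler_wpM2l //.
  have /andP[a b] := q01 m (2 ^ m)%N x.
  by rewrite ger0_norm ?subr_ge0 // gerBl.
have [_ _] := dominated_convergence mD mf mGP ff (integrable_norm ig) dom.
have e m : (\int[mu]_(x in D) f m x = 0)%E.
  have i1 : mu.-integrable D (fun x => (g x * (1 - s x ^+ m) ^+ (2 ^ m))%:E).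
    apply: (le_integrable mD _ _ ig).
      by apply/measurable_EFinP; apply: measurable_funM.
    move=> x _ /=; rewrite lee_fin normrM -[leRHS]mulr1 ler_wpM2l //.
    by have /andP[a b] := q01 m (2 ^ m)%N x; rewrite ger0_norm.
  have gD : (\int[mu]_(x in D) (g x)%:E = 0)%E.
    by have := h0 0%N 0%N; under eq_integral do rewrite expr0 mulr1.
  under eq_integral do rewrite /f mulrBr mulr1 EFinB.
  by rewrite integralB // gD h0 sube0.
under eq_fun do rewrite e.
move=> /cvg_lim; rewrite lim_cst // => /(_ (@ereal_hausdorff _)) h.
by rewrite integral_mkcondr -h.
Qed.

End BorelDetection.

(** * Null sets of the completed measure *)

Section NullSets.
Context {R : realType}.
Local Notation lambda := (@completed_lebesgue_measure R).
Local Notation mu := (@lebesgue_measure R).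

Lemma negligible_completed (N : set R) : lambda.-negligible N <-> mu.-negligible N.
Proof.
split=> [[A [_ A0 NA]]|[A [mA A0 NA]]].
  apply/negligible_outer_measure/eqP; rewrite eq_le outer_measure_ge0 andbT.
  by rewrite -A0; apply: le_outer_measure.
by exists A; split => //; exact: measurable_borel_lebesgue.
Qed.

Lemma completed_measurableE (E : set R) : measurable (E : set (lebesgueType R)) ->
  exists A : set (measurableTypeR R), exists N : set R,
    [/\ measurable A, lambda.-negligible N & E = A `|` N].
Proof.
move=> mE.
have : completed_algebra_gen mu E.
  by rewrite -g_sigma_completed_algebra_genE completed_caratheodory_measurable.
move=> [A mA [N nN <-]]; exists A, N; split => //.
by apply/negligible_completed.
Qed.

(** [a] times the pushforward of Lebesgue measure along x -> a x + b agrees with Lebesgue measure on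
    half-open intervals, hence on Borel sets. *)
Lemma negligible_affine (a b : R) (N : set R) : 0 < a -> lambda.-negligible N ->
  lambda.-negligible [set x | N (a * x + b)].
Proof.
move=> a0 /negligible_completed [A [mA A0 NA]]; apply/negligible_completed.
pose phi : measurableTypeR R -> measurableTypeR R := fun x => a * x + b.
have mphi : measurable_fun setT phi.
  by apply: measurable_funD => //; apply: measurable_funM.
have mpA : measurable (phi @^-1` A) by rewrite -[X in measurable X]setTI; exact: mphi.
have := @lebesgue_measure_unique R (mscale (NngNum (ltW a0)) (pushforward mu phi)).
move=> /(_ mphi) h.
exists (phi @^-1` A); split.
- exact: mpA.
- have : (a%:E * mu (phi @^-1` A) = 0)%E.
    rewrite -A0 [RHS]h // => {h} _ [[u v]] _ <-.
    transitivity (a%:E * mu (phi @^-1` `]u, v]))%E; last by [].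
    have -> : phi @^-1` `]u, v]%classic = `](u - b) / a, (v - b) / a]%classic.
      apply/seteqP; split => x /=; rewrite !in_itv /= ltr_pdivrMr // ler_pdivlMr //;
        by rewrite /phi (mulrC x) ltrBlDr lerBrDr.
    rewrite !lebesgue_measure_itv /= !lte_fin ltr_pM2r ?invr_gt0 // ltrD2r.
    case: ifPn => _; last by rewrite mule0.
    by rewrite -!EFinB -EFinM; congr EFin; field; rewrite gt_eqF.
  by move/eqP; rewrite mule_eq0 eqe (gt_eqF a0) => /eqP.
- by move=> x; exact: NA.
Qed.

(** Countably many integer translates of the part in the unit interval cover [N]; they are written
    as affine preimages with factor 1 to reuse [negligible_affine]. *)
Lemma negligible_periodic (N : set R) : (forall x, N (x + 1) = N x) ->
  lambda.-negligible (N `&` unit_itv) -> lambda.-negligible N.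
Proof.
move=> pN nN.
have pn n x : N (x + n%:R) = N x.
  by elim: n => [|n IH]; [rewrite addr0|rewrite -natr1 addrA pN].
have pz (z : int) x : N (x + z%:~R) = N x.
  case: z => n; first exact: pn.
  by rewrite NegzE mulrNz -(pn n.+1 (x - _)) subrK.
pose S (z : R) := [set x : R | (N `&` unit_itv) (1 * x + z)].
apply: (@negligibleS _ _ _ lambda ((\bigcup_n S n%:R) `|` (\bigcup_n S (- n%:R)))).
  move=> x Nx.
  have nu : unit_itv (x - (Num.floor x)%:~R).
    rewrite /unit_itv /= in_itv /=.
    by rewrite subr_ge0 floor_le_tmp lerBlDl -intrD1 ltW // floorD1_gt.
  have Nu : N (x - (Num.floor x)%:~R) by rewrite -mulrNz pz.
  move: nu Nu; case: (Num.floor x) => n nu Nu.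
    by right; exists n => //; rewrite /S /= mul1r; split.
  left; exists n.+1 => //; rewrite /S /= mul1r.
  by move: nu Nu; rewrite NegzE mulrNz opprK.
apply: negligibleU; apply: negligible_bigcup => n; exact: negligible_affine.
Qed.

Lemma ae_dilate (P : R -> Prop) (k : nat) : (0 < k)%N ->
  {ae lambda, forall x, P x} -> {ae lambda, forall x, P (k%:R * x)}.
Proof.
move=> k0 hP; have k0' : 0 < k%:R :> R by rewrite ltr0n.
have := negligible_affine 0 k0' hP.
by apply: negligibleS => x /=; rewrite addr0.
Qed.

Lemma ae_periodic (P : R -> Prop) : (forall x, P (x + 1) = P x) ->
  {ae lambda, forall x, unit_itv x -> P x} -> {ae lambda, forall x, P x}.
Proof.
move=> pP hP; apply: negligible_periodic; first by move=> x /=; rewrite pP.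
by apply: negligibleS hP => x [nP xu] /= h; apply: nP; exact: h.
Qed.

End NullSets.

Section MultiplierOrthogonality.
Context {R : realType} d (T : measurableType d) (mu : {measure set T -> \bar R}).
Context (D : set T) (mD : measurable D).
Local Notation "\I f" := (Rintegral mu D f) (at level 10, f at level 9).
Local Notation Int f := (mu.-integrable D (EFin \o f)).
Context (g : T -> R) (ig : Int g).
Context (I : Type) (t : I -> T -> R) (s : T -> R).
Hypothesis mt : forall i, measurable_fun D (t i).
Hypothesis t_bounded : forall i, exists M, forall x, `|t i x| <= M.
Hypothesis ms : measurable_fun D s.
Hypothesis s01 : forall x, 0 <= s x <= 1.
Hypothesis st : forall i, exists j1 j2 j3, forall x, s x * t i x = t j1 x + t j2 x + t j3 x.

Lemma Int_mul_bound (u : T -> R) : measurable_fun D u -> (exists M, forall x, `|u x| <= M) ->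
  Int (fun x => g x * u x).
Proof.
move=> mu' [M uM].
apply: (@le_integrable _ _ _ mu _ mD _ (fun x => (M%:E * (g x)%:E)%E)).
- apply/measurable_EFinP; apply: measurable_funM => //.
  by apply/measurable_EFinP; exact: (measurable_int _ ig).
- move=> x _ /=; rewrite lee_fin !normrM mulrC ler_wpM2r //.
  by apply: le_trans (uM x) _; exact: ler_norm.
- exact: integrableZl.
Qed.

(** The bounded multipliers that preserve the orthogonality of [g] to all [t i]. They are stable
    under subtraction and, since each s t_i is a sum of three t_j, under multiplication by [s]. *)
Let V (u : T -> R) := [/\ measurable_fun D u, exists M, forall x, `|u x| <= M &
  forall i, \I (fun x => g x * (u x * t i x)) = 0].

Let IntV u i : V u -> Int (fun x => g x * (u x * t i x)).
Proof.
move=> [mu' [M uM] _]; apply: Int_mul_bound; first exact: measurable_funM.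
have [N tN] := t_bounded i; exists (M * N) => x; rewrite normrM.
by apply: ler_pM.
Qed.

Let VM u : V u -> V (fun x => u x * s x).
Proof.
move=> Vu; have [mu' [M uM] u0] := Vu; split.
- exact: measurable_funM.
- exists M => x; have /andP[s0 s1] := s01 x; rewrite normrM (ger0_norm s0).
  by apply: le_trans (uM x); rewrite -[leRHS]mulr1 ler_wpM2l.
- move=> i; have [j1 [j2 [j3 e]]] := st i.
  rewrite (@eq_Rintegral _ _ _ mu D (fun x => g x * (u x * t j1 x) + g x * (u x * t j2 x) +
    g x * (u x * t j3 x))); last by move=> x _; rewrite -mulrA e; ring.
  rewrite RintegralD //; [|exact: (integrableD mD (IntV j1 Vu) (IntV j2 Vu))|exact: IntV].
  by rewrite RintegralD // ?u0 ?addr0 //; exact: IntV.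
Qed.

Let VB u v : V u -> V v -> V (fun x => u x - v x).
Proof.
move=> Vu Vv; have [mu' [M uM] u0] := Vu; have [mv [N vN] v0] := Vv; split.
- exact: measurable_funB.
- by exists (M + N) => x; apply: le_trans (ler_normB _ _) _; exact: lerD.
- move=> i.
  rewrite (@eq_Rintegral _ _ _ mu D (fun x => g x * (u x * t i x) - g x * (v x * t i x)));
    last by move=> x _; ring.
  by rewrite RintegralB // ?u0 ?v0 ?subrr //; exact: IntV.
Qed.

(** (1 - s^m)^(n + 1) is (1 - s^m)^n minus its product with s^m, so the stability of [V] suffices;
    the constant member [t i1] then recovers the plain integral. *)
Lemma multiplier_orthogonal (i1 : I) : (forall x, t i1 x = 1) ->
  (forall i, \I (fun x => g x * t i x) = 0) ->
  forall m n, (\int[mu]_(x in D) (g x * (1 - s x ^+ m) ^+ n)%:E = 0)%E.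
Proof.
move=> t1 g0 m n.
have VX u k : V u -> V (fun x => u x * s x ^+ k).
  move=> Vu; elim: k => [|k IH]; first by under eq_fun do rewrite expr0 mulr1.
  by under eq_fun do rewrite exprSr mulrA; exact: VM.
have {VX} : V (fun x => (1 - s x ^+ m) ^+ n).
  elim: n => [|n IH].
    split.
    - by under eq_fun do rewrite expr0; exact: measurable_cst.
    - by exists 1 => x; rewrite expr0 normr1.
    - by move=> i; under eq_Rintegral do rewrite expr0 mul1r; exact: g0.
  have := VB IH (VX _ m IH).
  by congr V; apply/funext => x; rewrite exprSr mulrBr mulr1.
move=> Vs; have iV := IntV i1 Vs; have [_ _ /(_ i1) h] := Vs.
have e : (fun x => g x * ((1 - s x ^+ m) ^+ n * t i1 x)) = (fun x => g x * (1 - s x ^+ m) ^+ n).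
  by apply/funext => x; rewrite t1 mulr1.
rewrite e in iV h.
by rewrite -[LHS]fineK ?(integrable_fin_num mD iV) //; congr EFin.
Qed.

End MultiplierOrthogonality.

Section FourierUniqueness.
Context {R : realType}.
Local Notation lambda := (@completed_lebesgue_measure R).
Local Notation "\I f" := (Rintegral lambda unit_itv f) (at level 10, f at level 9).
Local Notation Int f := (lambda.-integrable unit_itv (EFin \o f)).

Lemma negligible_set1 (a : R) : lambda.-negligible [set a].
Proof.
apply/negligible_completed; exists [set a]; split => //.
  exact: lebesgue_measure_set1.
Qed.

(* [step c x - 1 / 2 = sin (pi * x) * sin (pi * (c - x)) / 2]. *)
Let step (c x : R) : R :=
  1 / 2 - cos (pi * c) / 4 + trig (sin (pi * c) / 4) (cos (pi * c) / 4) 1 x.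

Let stepE c x : step c x = 1 / 2 + (cos (pi * x + pi * (x - c)) - cos (pi * c)) / 4.
Proof.
have -> : pi * x + pi * (x - c) = 2 * pi * 1%:R * x - pi * c by ring.
by rewrite cosB /step /trig /tsin /tcos; field.
Qed.

Let step_trig c a b n : exists j1 j2 j3 : R * R * nat, forall x,
  step c x * trig a b n x =
  trig j1.1.1 j1.1.2 j1.2 x + trig j2.1.1 j2.1.2 j2.2 x + trig j3.1.1 j3.1.2 j3.2 x.
Proof.
set p := sin (pi * c) / 4; set q := cos (pi * c) / 4.
have [e he] := trigM p q 1 a b n.
exists ((1 / 2 - q) * a, (1 / 2 - q) * b, n).
exists ((p * b + q * a) / 2, (q * b - p * a) / 2, (1 + n)%N).
exists (e, (p * a + q * b) / 2, ((1 - n) + (n - 1))%N) => x /=.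
rewrite -addrA -he /step -/p -/q mulrDl.
by congr (_ + _); rewrite /trig mulrDr !mulrA.
Qed.

Let step_gt (c x : R) : 0 < x -> x < 1 -> 0 < c -> c <= 1 -> x < c -> 1 / 2 < step c x.
Proof.
move=> x0 x1 c0 c1 xc; have p0 := pi_gt0 R.
have h1 : 0 < sin (pi * x) by apply: sin_gt0_pi; rewrite mulr_gt0 // gtr_pMr.
have h2 : 0 < sin (pi * (c - x)).
  apply: sin_gt0_pi; rewrite mulr_gt0 ?subr_gt0 // gtr_pMr //; lra.
have := mulr_gt0 h1 h2.
rewrite stepE {1}(_ : pi * c = pi * x + pi * (c - x)); last by ring.
rewrite -[pi * (x - c)]opprK -mulrN opprB cosB cosD; lra.
Qed.

Let step_lt (c x : R) : 0 < x -> x < 1 -> 0 < c -> c <= 1 -> c < x -> step c x < 1 / 2.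
Proof.
move=> x0 x1 c0 c1 xc; have p0 := pi_gt0 R.
have h1 : 0 < sin (pi * x) by apply: sin_gt0_pi; rewrite mulr_gt0 // gtr_pMr.
have h2 : 0 < sin (pi * (x - c)).
  apply: sin_gt0_pi; rewrite mulr_gt0 ?subr_gt0 // gtr_pMr //; lra.
have := mulr_gt0 h1 h2.
rewrite stepE {1}(_ : pi * c = pi * x - pi * (x - c)); last by ring.
rewrite cosB cosD; lra.
Qed.

Let step01 (c x : R) : 0 <= step c x <= 1.
Proof.
rewrite stepE; set u := pi * x + _; set v := pi * c.
have ? := cos_geN1 u; have ? := cos_le1 u; have ? := cos_geN1 v; have ? := cos_le1 v.
by lra.
Qed.

(** Polynomials in [step c] show that the integral of g over the part of the unit interval below c
    vanishes; this extends to Borel sets, and then to Lebesgue sets, which differ from Borel sets by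
    null sets. *)
Lemma fourier_uniqueness (g : R -> R) : Int g ->
  (forall a b n, `|a| + `|b| <= 1 -> \I (fun x => g x * trig a b n x) = 0) ->
  {ae lambda, forall x, unit_itv x -> g x = 0}.
Proof.
move=> ig g0.
have mD := @measurable_unit_itv R.
have gt0 (i : R * R * nat) : \I (fun x => g x * trig i.1.1 i.1.2 i.2 x) = 0.
  (* The normalization |a| + |b| <= 1 is removed by scaling. *)
  case: i => [[a b] n] /=; pose r := 1 + `|a| + `|b|.
  have r0 : 0 < r by rewrite /r -addrA ltr_wpDr // addr_ge0.
  have h := g0 (a / r) (b / r) n; have ab1 : `|a / r| + `|b / r| <= 1.
    by rewrite !normrM normfV (gtr0_norm r0) -mulrDl ler_pdivrMr // mul1r /r; lra.
  rewrite (@eq_Rintegral _ _ _ lambda unit_itv (fun x : lebesgueType R => r * (g x * trig (a / r) (b / r) n x))).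
    rewrite RintegralZl // ?h ?mulr0 //.
    apply: (Int_mul_bounded mD ig); first exact: measurable_trig.
    by move=> x; exact: le_trans (trig_bound _ _ _ x) ab1.
  by move=> x _; rewrite /trig; field; exact: lt0r_neq0.
have hD : (\int[lambda]_(x in unit_itv) (g x)%:E = 0)%E.
  rewrite Rint_EFin //; congr EFin; rewrite -[RHS](gt0 (0, 1, 0%N)).
  by apply: eq_Rintegral => x _; rewrite /trig /= /tcos mulr0 !mul0r cos0 add0r !mulr1.
apply: (ae_eq0_preimage mD (@measurable_fun_id_lebesgue R) ig).
  by move=> E /completed_measurableE.
apply: (integral_preimage_eq0 mD (@measurable_fun_id_lebesgue R) ig) => // c.
have [c0|c0] := leP c 0.
  rewrite [X in integral _ X _](_ : _ = set0) ?integral_set0 //.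
  apply/seteqP; split => // x [] /=; rewrite /unit_itv /= !in_itv /= => /andP[x0 _] xc.
  by have := lt_le_trans xc c0; rewrite ltNge x0.
have [c1|c1] := leP c 1; last first.
  rewrite [X in integral _ X _](_ : _ = unit_itv) // -[RHS]setIT; apply/seteqP.
  split => x [xD _]; split => //=.
  by move: xD; rewrite /unit_itv /= !in_itv /= => /andP[_ x1]; exact: le_lt_trans c1.
apply: (@integral_step_eq0 _ _ _ lambda _ mD g ig (step c)).
- by apply: measurable_borel_lebesgue; exact: measurable_itv.
- apply: continuous_lebesgue_measurable_fun => x.
  by apply: cvgD; [exact: cvg_cst|exact: continuous_trig].
- exact: step01.
(* [step c] equals 1/2 at 0, c and 1, which form a null set. *)
- have h := negligibleU (negligible_set1 0) (negligibleU (negligible_set1 c) (negligible_set1 1)).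
  apply: negligibleS h => x /=; rewrite !in_itv /= => hx.
  apply: contrapT => /not_orP[x0 /not_orP[xc x1]]; apply: hx; rewrite /unit_itv /= !in_itv /=.
  move=> /andP[]; rewrite !le_eqVlt => /predU1P[/esym //|x0'] /predU1P[//|x1'].
  split; first exact: step_gt.
  by move=> /negP; rewrite -leNgt le_eqVlt => /predU1P[/esym //|]; exact: step_lt.
apply: (@multiplier_orthogonal _ _ _ lambda _ mD g ig (R * R * nat)
  (fun i => trig i.1.1 i.1.2 i.2) (step c) _ _ _ _ _ (0, 1, 0%N)) => //.
- by move=> i; exact: measurable_trig.
- by move=> i; eexists => x; exact: trig_bound.
- apply: continuous_lebesgue_measurable_fun => x.
  by apply: cvgD; [exact: cvg_cst|exact: continuous_trig].
- by move=> x; rewrite /trig /= /tcos mulr0 !mul0r cos0 add0r mulr1.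
Qed.

End FourierUniqueness.

(** * Functions of the class as sums of their Fourier series *)

Section ClassC.
Context {R : realType} (al : R) (al2 : 1 / 2 < al).
Local Notation lambda := (@completed_lebesgue_measure R).
Local Notation "\I f" := (Rintegral lambda unit_itv f) (at level 10, f at level 9).
Local Notation Int f := (lambda.-integrable unit_itv (EFin \o f)).

Lemma bigO_powRN (u : nat -> R) : u =O_\oo (fun j : nat => j%:R `^ (- al)) ->
  exists M, forall j, (0 < j)%N -> `|u j| <= M * j%:R `^ (- al).
Proof.
move=> /eqO_exP[k k0 [n _ hn]].
have p0 j : (0 < j)%N -> 0 < j%:R `^ (- al) :> R by move=> j0; rewrite powR_gt0 // ltr0n.
(* The finitely many ratios below the threshold are added to the asymptotic constant, so that the
   bound holds from j = 1 on. *)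
exists (k + \sum_(0 <= j < n) `|u j| / j%:R `^ (- al)) => j j0.
have [jn|nj] := ltnP j n; last first.
  apply: (le_trans (hn j nj)); rewrite ger0_norm ?powR_ge0 // ler_wpM2r ?powR_ge0 // lerDl.
  by apply: sumr_ge0 => i _; rewrite divr_ge0 // powR_ge0.
rewrite -ler_pdivrMr ?p0 // (bigD1_seq j) ?mem_index_iota ?iota_uniq //= addrCA lerDl addr_ge0 ?(ltW k0) //.
by apply: sumr_ge0 => i _; rewrite divr_ge0 // powR_ge0.
Qed.

Context (f : R -> R) (fC : class_C al f).
Local Notation A := (fourier_sin f).
Local Notation B := (fourier_cos f).

Lemma class_C_coef_le : exists M,
  (forall j, (0 < j)%N -> `|A j| <= M * j%:R `^ (- al)) /\
  (forall j, (0 < j)%N -> `|B j| <= M * j%:R `^ (- al)).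
Proof.
have [M hM] := bigO_powRN (class_sin fC); have [N hN] := bigO_powRN (class_cos fC).
exists (Num.max M N); split=> j j0.
  by apply: (le_trans (hM j j0)); rewrite ler_wpM2r ?powR_ge0 // le_max lexx.
by apply: (le_trans (hN j j0)); rewrite ler_wpM2r ?powR_ge0 // le_max lexx orbT.
Qed.

(** [f] and its Fourier series have equal coefficients at every frequency, so they agree almost
    everywhere on the unit interval; periodicity and the invariance of null sets under dilation do
    the rest. *)
Lemma class_C_ae_series (k : nat) : (0 < k)%N ->
  {ae lambda, forall x, f (k%:R * x) = fourier_series A B (k%:R * x)}.
Proof.
have mD := @measurable_unit_itv R.
have [M [A_le B_le]] := class_C_coef_le.
have If : Int f.
  apply: (sqint_integrable mD lambda_unit_itv _ (class_sqint fC)).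
  exact: measurable_funTS (class_measurable fC).
have Ih : Int (fourier_series A B).
  have h1 := @sqint_dilated_series _ _ _ al2 _ _ A_le B_le 1 isT.
  have := sqint_integrable mD lambda_unit_itv (@measurable_dilated_series _ A B _ 1) h1.
  by congr (lambda.-integrable _ _); apply/funext => x /=; rewrite mul1r.
suff h : {ae lambda, forall x, f x = fourier_series A B x}.
  by move=> k0; exact: (ae_dilate k0 h).
apply: ae_periodic; first by move=> x; rewrite periodic_fourier_series (class_periodic fC).
have Ig : Int (fun x => f x - fourier_series A B x) by exact: (integrableB mD If Ih).
have := fourier_uniqueness Ig.
suff h : forall a b n, `|a| + `|b| <= 1 ->
    \I (fun x => (f x - fourier_series A B x) * trig a b n x) = 0.
  by move=> /(_ h); apply: filterS => x hx xD; apply/eqP; rewrite -subr_eq0; apply/eqP; exact: hx.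
move=> a b n ab1.
have IM u : Int u -> Int (fun x => u x * trig a b n x).
  move=> iu; apply: (Int_mul_bounded mD iu); first exact: measurable_trig.
  by move=> x; exact: le_trans (trig_bound _ _ _ x) ab1.
rewrite (@eq_Rintegral _ _ _ lambda unit_itv
  (fun x : lebesgueType R => f x * trig a b n x - fourier_series A B x * trig a b n x));
  last by move=> x _; rewrite mulrBl.
rewrite RintegralB //; [|exact: IM|exact: IM].
have -> : \I (fun x => fourier_series A B x * trig a b n x) =
    \sum_(1 <= j < n.+1) (j * 1 == n)%N%:R * ((A j * a + B j * b) / 2).
  rewrite -(Rint_dilated_series_trig al2 A_le B_le n (k := 1) isT ab1).
  by apply: eq_Rintegral => x _; rewrite mul1r.
have It1 u : (exists n, u = tsin n \/ u = tcos n) -> Int (fun x => f x * u x).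
  move=> [m hu]; apply: (Int_mul_bounded mD If).
    by case: hu => ->; apply: continuous_lebesgue_measurable_fun;
      [exact: continuous_tsin|exact: continuous_tcos].
  by case: hu => -> x; [exact: tsin_le1|exact: tcos_le1].
have Is : Int (fun x => f x * tsin n x) by apply: It1; exists n; left.
have Ic : Int (fun x => f x * tcos n x) by apply: It1; exists n; right.
rewrite (@eq_Rintegral _ _ _ lambda unit_itv
  (fun x : lebesgueType R => a * (f x * tsin n x) + b * (f x * tcos n x)));
  last by move=> x _; rewrite /trig; ring.
rewrite RintegralD //; [|exact: RintZ|exact: RintZ].
rewrite !RintegralZl //.
have [->|n0] := posnP n.
  (* The series has no constant term, so frequency 0 is where the vanishing mean of [f] enters. *)
  rewrite big_geq // subr0.
  rewrite (@eq_Rintegral _ _ _ lambda unit_itv (fun x : lebesgueType R => 0 * f x));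
    last by move=> x _; rewrite /tsin mulr0 !mul0r sin0 mulr0.
  rewrite RintegralZl // mul0r mulr0 add0r.
  rewrite (@eq_Rintegral _ _ _ lambda unit_itv f);
    last by move=> x _; rewrite /tcos mulr0 !mul0r cos0 mulr1.
  by rewrite [X in b * X](class_mean0 fC) mulr0.
have -> : \sum_(1 <= j < n.+1) (j * 1 == n)%N%:R * ((A j * a + B j * b) / 2) =
    (A n * a + B n * b) / 2.
  rewrite big_nat_recr //= muln1 eqxx mul1r big_nat big1 ?add0r // => j /andP[_ jn].
  by rewrite muln1 (ltn_eqF jn) mul0r.
rewrite /fourier_sin /fourier_cos.
set u := \I _; set v := \I _.
transitivity (a * u + b * v - (2 * u * a + 2 * v * b) / 2); first by [].
by field.
Qed.

End ClassC.

(** * Convergence *)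

Section FatouSquare.
Context {R : realType} d (T : measurableType d) (mu : {measure set T -> \bar R}).
Context (D : set T) (mD : measurable D).

Lemma measurable_sum_nat (X : nat -> T -> R) a m :
  (forall k, measurable_fun D (X k)) -> measurable_fun D (fun x => \sum_(a <= k < m) X k x).
Proof. by move=> mX; exact: measurable_sum. Qed.

Lemma measurable_lincomb_nat (c : nat -> R) (X : nat -> T -> R) a m :
  (forall k, measurable_fun D (X k)) -> measurable_fun D (fun x => \sum_(a <= k < m) c k * X k x).
Proof. by move=> mX; apply: measurable_sum_nat => k; exact: measurable_funM. Qed.

(** Reduces an L2 bound for infinite Fourier series to one for trigonometric polynomials that is
    uniform in the degree. *)
Lemma fatou_sqr (u : nat -> T -> R) (v : T -> R) (B : R) :
  (forall n, measurable_fun D (u n)) -> measurable_fun D v ->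
  {ae mu, forall x, D x -> u n x @[n --> \oo] --> v x} ->
  (forall n, \int[mu]_(x in D) ((u n x) ^+ 2)%:E <= B%:E)%E ->
  (\int[mu]_(x in D) ((v x) ^+ 2)%:E <= B%:E)%E.
Proof.
move=> mu' mv uv uB; pose f n x := ((u n x) ^+ 2)%:E.
have mf n : measurable_fun D (f n) by apply/measurable_EFinP; exact: measurable_funX.
have f0 n x : D x -> (0 <= f n x)%E by rewrite lee_fin sqr_ge0.
have -> : (\int[mu]_(x in D) ((v x) ^+ 2)%:E = \int[mu]_(x in D) limn_einf (f^~ x))%E.
  apply: ge0_ae_eq_integral => //.
  - by apply/measurable_EFinP; exact: measurable_funX.
  - have -> : (fun x => limn_einf (f ^~ x)) = (fun x => - limn_esup (-%E \o f ^~ x))%E.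
      by apply/funext => x; rewrite limn_esupN oppeK.
    apply: measurableT_comp => //; apply: measurable_fun_limn_esup => n.
    exact: measurableT_comp.
  - by move=> x _; rewrite lee_fin sqr_ge0.
  - move=> x Dx; rewrite limn_einf_lim; apply: lime_ge; first exact: is_cvg_einfs.
    by apply: nearW => n; apply: le_ereal_inf_tmp => _ [p /= _ <-]; exact: f0.
  - apply: filterS uv => x h Dx; symmetry; apply: (cvg_limn_einf_sup _).1.
    by apply: cvg_EFin; [exact: nearW|exact: (cvgM (h Dx) (h Dx))].
apply: (le_trans (fatou mu mD mf f0)).
rewrite limn_einf_lim; apply: lime_le; first exact: is_cvg_einfs.
by apply: nearW => n; apply: (le_trans (ereal_inf_lbound _) (uB n)); exists n => /=.
Qed.

End FatouSquare.

Lemma cvg_sum_nat (R : realType) (F : nat -> nat -> R) (l : nat -> R) a m :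
  (forall k, (a <= k < m)%N -> F n k @[n --> \oo] --> l k) ->
  \sum_(a <= k < m) F n k @[n --> \oo] --> \sum_(a <= k < m) l k.
Proof.
move=> h; rewrite big_nat; under eq_fun do rewrite big_nat.
elim: (index_iota a m) => [|k r IH].
  by rewrite big_nil; under eq_fun do rewrite big_nil; exact: cvg_cst.
rewrite big_cons [X in X @ _](_ : _ = fun n => if (a <= k < m)%N
  then F n k + \sum_(i <- r | (a <= i < m)%N) F n i else \sum_(i <- r | (a <= i < m)%N) F n i); last first.
  by apply/funext => n; rewrite big_cons.
case: ifP => // /h hk; exact: cvgD.
Qed.

Lemma big_nat_support (R : nmodType) (F : nat -> R) a m n : (0 < a)%N -> (a <= m)%N -> (m <= n)%N ->
  (forall k, ~~ (a <= k < m)%N -> F k = 0) -> \sum_(a <= k < m) F k = \sum_(1 <= k < n) F k.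
Proof.
move=> a0 am mn h; rewrite (@big_cat_nat _ _ _ a 1 n) //= ?(leq_trans am) //.
rewrite (@big_cat_nat _ _ _ m a n) //=.
have -> : \sum_(1 <= k < a) F k = 0.
  by rewrite big_nat big1 // => k /andP[_ ka]; apply: h; rewrite negb_and -ltnNge ka.
have -> : \sum_(m <= k < n) F k = 0.
  by rewrite big_nat big1 // => k /andP[mk _]; apply: h; rewrite negb_and -!ltnNge ltnS mk orbT.
by rewrite add0r addr0.
Qed.

Section DilatedBlocks.
Context {R : realType} (al : R) (al2 : 1 / 2 < al) (al1 : al < 1).
Local Notation lambda := (@completed_lebesgue_measure R).
Context (M : R) (A B : nat -> R).
Hypothesis A_le : forall j, (0 < j)%N -> `|A j| <= M * j%:R `^ (- al).
Hypothesis B_le : forall j, (0 < j)%N -> `|B j| <= M * j%:R `^ (- al).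
Context (c : nat -> R).

Let coefM_le i j : (0 < i)%N -> (0 < j)%N ->
  `|A i * A j + B i * B j| / 2 <= M ^+ 2 * (i * j)%:R `^ (- al).
Proof.
move=> i0 j0.
have key (X : nat -> R) : (forall j, (0 < j)%N -> `|X j| <= M * j%:R `^ (- al)) ->
    `|X i * X j| <= M ^+ 2 * (i * j)%:R `^ (- al).
  move=> X_le; rewrite normrM natrM powRM // expr2 mulrACA.
  by apply: ler_pM => //; exact: X_le.
rewrite ler_pdivrMr // mulr_natr mulr2n.
by apply: (le_trans (ler_normD _ _)); apply: lerD; exact: key.
Qed.

(** Truncating each Fourier series at J and expanding over pairs (k, j) leaves the collisions i k =
    j l; [collision_sum_le] bounds them, uniformly in J, by the gcd form that [gcd_sum_expo_le]
    estimates. *)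
Lemma dilated_sum_L2 dlt y N a m : 0 < dlt -> dlt < 1 -> (1 < y)%N ->
  4 / 3 <= Num.sqrt (2 * al - 1) * y%:R `^ al -> ln N%:R <= y%:R :> R ->
  (0 < a)%N -> (a <= m)%N -> (m <= N.+1)%N ->
  (\int[lambda]_(x in unit_itv)
     ((\sum_(a <= k < m) c k * fourier_series A B (k%:R * x)) ^+ 2)%:E <=
   (M ^+ 2 * (2 * al / (2 * al - 1)) * expR (expo al dlt y%:R) *
      \sum_(a <= k < m) c k ^+ 2)%:E)%E.
Proof.
move=> d0 d1 y1 hT hN a0 am mN.
have mD := @measurable_unit_itv R.
pose u J (x : lebesgueType R) := \sum_(a <= k < m) c k * fourier_sum A B J (k%:R * x).
apply: (@fatou_sqr _ _ _ lambda _ mD u).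
- move=> J; apply: measurable_lincomb_nat => k.
  under eq_fun do rewrite /fourier_sum; apply: measurable_sum_nat => j.
  under eq_fun do rewrite -trig_dilate; exact: measurable_trig.
- by apply: measurable_lincomb_nat => k; exact: measurable_dilated_series.
- have hk k : {ae lambda, forall x, unit_itv x -> (0 < k)%N ->
      fourier_sum A B n (k%:R * x) @[n --> \oo] --> fourier_series A B (k%:R * x)}.
    have [->|k0] := posnP k; first by apply: aeW.
    by have [h _] := fourier_series_dilated al2 A_le B_le k0; apply: filterS h => x h ? ?; exact: h.
  apply: filterS (ae_foralln hk) => x h xD; rewrite /u; apply: cvg_sum_nat => k /andP[ak _].
  by apply: cvgM; [exact: cvg_cst|apply: h => //; exact: leq_trans ak].
move=> J.
pose r := [seq (k, j) | k <- index_iota a m, j <- index_iota 1 J.+1].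
have uE : u J = fun x => \sum_(p <- r) trig (c p.1 * A p.2) (c p.1 * B p.2) (p.2 * p.1) x.
  apply/funext => x; rewrite /u /r big_allpairs_dep /=; apply: eq_bigr => k _.
  rewrite /fourier_sum big_distrr /=; apply: eq_bigr => j _.
  by rewrite trig_dilate /trig; ring.
rewrite uE trig_sum_L2; last first.
  move=> [k j] /allpairsPdep[k' [j' []]]; rewrite !mem_index_iota => /andP[ak _] /andP[j0 _] [-> ->] /=.
  by rewrite muln_gt0 j0 (leq_trans a0 ak).
rewrite lee_fin /r big_allpairs_dep /=.
under eq_bigr do under eq_bigr do rewrite big_allpairs_dep /=.
(* The gcd bound asks for nonnegative coefficients on the full range 1..N, so absolute values are
   taken and extended by 0 outside the block. *)
pose c' k := if (a <= k < m)%N then `|c k| else 0.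
have c'0 k : 0 <= c' k by rewrite /c'; case: ifP.
pose G k l := (gcdn k l)%:R `^ (2 * al) * (k * l)%:R `^ (- al) : R.
have Z0 : 0 <= 2 * al / (2 * al - 1) by have a2 := al2; rewrite divr_ge0 //; lra.
have extE (F : nat -> R) : (forall k, ~~ (a <= k < m)%N -> F k = 0) ->
    \sum_(a <= k < m) F k = \sum_(1 <= k < N.+1) F k.
  exact: big_nat_support.
have -> : \sum_(a <= k < m) c k ^+ 2 = \sum_(1 <= k < N.+1) c' k ^+ 2.
  rewrite -extE => [|k /negbTE h]; last by rewrite /c' h expr0n.
  by rewrite big_nat [RHS]big_nat; apply: eq_bigr => k h; rewrite /c' h real_normK ?num_real.
apply: le_trans (_ : M ^+ 2 * (2 * al / (2 * al - 1)) *
  \sum_(1 <= k < N.+1) \sum_(1 <= l < N.+1) c' k * c' l * G k l <= _); last first.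
  rewrite -[leRHS]mulrA; apply: ler_wpM2l; first exact: mulr_ge0 (sqr_ge0 _) Z0.
  exact: gcd_sum_expo_le.
rewrite mulr_sumr -extE => [|k /negbTE h]; last first.
  by rewrite big1 ?mulr0 // => l _; rewrite /c' h !mul0r.
rewrite big_nat [leRHS]big_nat; apply: ler_sum => k kam.
have k0 : (0 < k)%N by case/andP: kam => + _; exact: leq_trans.
rewrite mulr_sumr -extE => [|l /negbTE h]; last by rewrite /c' h mulr0 mul0r mulr0.
rewrite exchange_big /= big_nat [leRHS]big_nat; apply: ler_sum => l lam.
have l0 : (0 < l)%N by case/andP: lam => + _; exact: leq_trans.
rewrite /c' kam lam.
apply: le_trans (_ : `|c k| * `|c l| * M ^+ 2 * \sum_(1 <= i < J.+1)
   \sum_(1 <= j < J.+1 | (i * k == j * l)%N) (i * j)%:R `^ (- al) <= _); last first.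
  rewrite [leRHS](_ : _ = `|c k| * `|c l| * M ^+ 2 * (2 * al / (2 * al - 1) * G k l)); last by ring.
  apply: ler_wpM2l; last exact: collision_sum_le.
  exact: mulr_ge0 (mulr_ge0 (normr_ge0 _) (normr_ge0 _)) (sqr_ge0 _).
rewrite mulr_sumr big_nat [leRHS]big_nat; apply: ler_sum => i /andP[i0 _].
rewrite mulr_sumr [leRHS]big_mkcond big_nat [leRHS]big_nat; apply: ler_sum => j /andP[j0 _].
case: eqP => _; last by rewrite mul0r.
rewrite mul1r (_ : _ / 2 = c k * c l * ((A i * A j + B i * B j) / 2)); last by ring.
apply: (le_trans (ler_norm _)).
rewrite normrM normrM [X in _ * X]normrM normfV (ger0_norm (ler0n R 2)) -[leRHS]mulrA.
by apply: ler_wpM2l; [exact: mulr_ge0|exact: coefM_le].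
Qed.

End DilatedBlocks.

(** * Block constants against the weight of the theorem *)

Section BlockWeights.
Context {R : realType}.
Implicit Types (x y t : R) (i k : nat).

Lemma le1_logm x : 1 <= logm x. Proof. by rewrite /logm le_max lexx. Qed.

Lemma logmE x : 1 <= ln x -> logm x = ln x.
Proof. by move=> h; apply/max_idPr. Qed.

Lemma log_weight_ge0 (K a x : R) : 0 <= K -> 0 <= K * (logm x `^ a) / logm (logm x).
Proof.
move=> K0; rewrite divr_ge0 ?(mulr_ge0 K0 (powR_ge0 _ _)) //.
exact: le_trans ler01 (le1_logm _).
Qed.

(** For large i this is [expo_asymptotics], whose uniformity in t >= x reaches every k >= 2^i. The
    finitely many small i are covered by C, because the weight is at least 1. *)
Lemma block_factor_le (a P : R) : 1 / 2 < a -> a < 1 -> 0 <= P ->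
  let K := 3 / (1 - a) + 4 / Num.sqrt (2 * a - 1) in
  exists d, exists y : nat -> nat, exists C,
    [/\ 0 < d < 1,
        forall i, [/\ (1 < y i)%N, 4 / 3 <= Num.sqrt (2 * a - 1) * (y i)%:R `^ a &
                      ln (2 ^ i.+1)%:R <= (y i)%:R :> R] &
        forall i k, (2 ^ i <= k)%N -> i.+1%:R ^+ 6 * (P * expR (expo a d (y i)%:R)) <=
          C * expR (K * (logm k%:R `^ (1 - a)) / logm (logm k%:R))].
Proof.
move=> a2 a1 P0 K.
have T0 : 0 < Num.sqrt (2 * a - 1) by rewrite sqrtr_gt0; lra.
have K0 : 0 <= K by rewrite /K addr_ge0 // divr_ge0 ?sqrtr_ge0 //; lra.
have l2 := @half_le_ln2 R; have l2' := @ln2_le R.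
have [d d01 hexp] := expo_asymptotics a2 a1.
exists d; move: (hexp (ln (P + 1))) => {}hexp.
have [N0 hN0] : exists N : nat, forall n, (N <= n)%N ->
    4 / 3 <= Num.sqrt (2 * a - 1) * n%:R `^ a.
  apply: (@near_natP _ (fun x => 4 / 3 <= Num.sqrt (2 * a - 1) * x `^ a)).
  have a0 : 0 < a by lra.
  apply: filterS (near_powR_ge (4 / 3 / Num.sqrt (2 * a - 1)) a0) => x.
  by rewrite ler_pdivrMr // => h; rewrite [leRHS]mulrC.
pose Y0 := maxn N0 2.
(* The cutoff is the first integer above log 2^(i + 1), raised to [Y0] for small i so that the
   condition on T y^a holds throughout. *)
pose y i := maxn Y0 (Num.truncn (i.+1%:R * ln 2 : R)).+1.
have yE i : (i.+1)%:R * ln 2 < (y i)%:R :> R.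
  apply: (lt_le_trans (truncnS_gt _)); by rewrite ler_nat leq_maxr.
have [X hX] : exists X, forall x, X < x ->
    [/\ forall y t, x <= y -> y <= x + 2 -> x <= t ->
      expo a d y + 12 * ln x + ln (P + 1) <= K * (t `^ (1 - a) / ln t),
      1 <= ln x & 1 <= x].
  suff [X [_ hX]] : \forall x \near +oo, [/\ forall y t, x <= y -> y <= x + 2 -> x <= t ->
      expo a d y + 12 * ln x + ln (P + 1) <= K * (t `^ (1 - a) / ln t),
      1 <= ln x & 1 <= x] by exists X.
  near=> x; split; near: x => //; [exact: near_ln_ge|exact: nbhs_pinfty_ge].
pose i0 := (maxn (Num.truncn (2 * X)).+1 (maxn 8 (2 * Y0))).
pose F i := i.+1%:R ^+ 6 * (P * expR (expo a d (y i)%:R)) : R.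
have F0 i : 0 <= F i by rewrite /F mulr_ge0 ?exprn_ge0 // mulr_ge0 // expR_ge0.
exists y, (1 + \sum_(0 <= i < i0) F i); split=> //.
  move=> i; split.
  - by rewrite leq_max /Y0 leq_max orbT.
  - by apply: hN0; rewrite leq_max /Y0 leq_max leqnn.
  - by rewrite natrX lnXn // -[X in X <= _]mulr_natl ltW // yE.
move=> i k ik; rewrite -/(F i).
set w := expR _; have w1 : 1 <= w.
  by rewrite -expR0 ler_expR; exact: log_weight_ge0.
have S0 : 0 <= \sum_(0 <= i < i0) F i by exact: sumr_ge0.
have [ii0|i0i] := ltnP i i0.
  apply: (@le_trans _ _ (1 + \sum_(0 <= i < i0) F i)); last by rewrite ler_peMr // addr_ge0.
  rewrite (bigD1_seq i) ?mem_index_iota ?iota_uniq //= addrCA lerDl addr_ge0 //.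
  exact: sumr_ge0.
apply: (@le_trans _ _ w); last by rewrite ler_peMl ?(le_trans ler01 w1) // lerDl.
have [iX i8 iY] : [/\ (2 * X < i%:R)%R, (8 <= i)%N & (2 * Y0 <= i)%N].
  move: i0i; rewrite !geq_max => /andP[h /andP[-> ->]]; split=> //.
  by apply: (lt_le_trans (truncnS_gt _)); rewrite ler_nat.
pose x := i%:R * ln 2 : R.
have i8' : 8 <= i%:R :> R by rewrite (ler_nat R 8).
have xi : i%:R / 2 <= x by rewrite /x; apply: ler_wpM2l => //; lra.
have [hx lx1 x1] : [/\ forall y t, x <= y -> y <= x + 2 -> x <= t ->
      expo a d y + 12 * ln x + ln (P + 1) <= K * (t `^ (1 - a) / ln t),
      1 <= ln x & 1 <= x] by apply: hX; lra.
have x0 : 0 < x by lra.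
have xE : i.+1%:R * ln 2 = x + ln 2 by rewrite -natr1 mulrDl mul1r.
have yi : y i = (Num.truncn (i.+1%:R * ln 2 : R)).+1.
  apply/maxn_idPr; rewrite -(ler_nat R).
  have h := truncnS_gt (i.+1%:R * ln 2 : R); apply: ltW; apply: le_lt_trans h.
  have : (2 * Y0)%:R <= i%:R :> R by rewrite ler_nat.
  rewrite natrM mulrC -ler_pdivlMr // => /le_trans; apply.
  by rewrite xE (le_trans xi) // lerDl (le_trans _ l2).
have y_le : (y i)%:R <= x + 2.
  rewrite yi -natr1; have := @truncn_le R (i.+1%:R * ln 2).
  rewrite mulr_ge0 ?(le_trans _ l2) // -[i.+1%:R]natr1 mulrDl mul1r -/x; lra.
have le_y : x <= (y i)%:R.
  by have := yE i; rewrite -natr1 mulrDl mul1r -/x; lra.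
have xk : x <= ln k%:R.
  rewrite /x mulr_natl -lnXn // -natrX ler_ln ?posrE ?ltr0n ?expn_gt0 //.
    by rewrite ler_nat.
  by apply: leq_trans ik; rewrite expn_gt0.
have lk1 : 1 <= ln (ln k%:R) :> R.
  by apply: (le_trans lx1); rewrite ler_ln ?posrE // (lt_le_trans x0).
have := hx _ _ le_y y_le xk.
rewrite /w /F (logmE (le_trans x1 xk)) (logmE lk1) => h.
(* For i >= 8, i + 1 <= (i / 2)^2 <= x^2, since x = i log 2 >= i / 2; this is the origin of 12 log
   x. *)
have i6 : i.+1%:R ^+ 6 <= expR (12 * ln x).
  have -> : 12 * ln x = ln ((x ^+ 2) ^+ 6).
    by rewrite -exprM lnXn // mulr_natl.
  rewrite lnK ?posrE ?exprn_gt0 // lerXn2r ?nnegrE ?ler0n ?exprn_ge0 ?(ltW x0) //.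
  apply: (@le_trans _ _ ((i%:R / 2) ^+ 2)); last by rewrite lerXn2r ?nnegrE ?(ltW x0) //; lra.
  by rewrite -natr1 expr2; nra.
have P1 : P <= expR (ln (P + 1)) by rewrite lnK ?posrE; lra.
apply: le_trans (_ : expR (12 * ln x) * (expR (ln (P + 1)) * expR (expo a d (y i)%:R)) <= _).
  by apply: ler_pM => //; rewrite ?exprn_ge0 ?mulr_ge0 ?expR_ge0 // ler_wpM2r ?expR_ge0.
by rewrite -!expRD ler_expR -[leRHS]mulrA; lra.
Unshelve. all: by end_near. Qed.

End BlockWeights.

Lemma measurable_fun_scale (R : realType) d (T : measurableType d) (D : set T) (c : R) (u : T -> R) :
  measurable_fun D u -> measurable_fun D (fun x => c * u x).
Proof. by move=> mu; exact: measurable_funM. Qed.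

Lemma ae_eq_integral_sqr (R : realType) d (T : measurableType d) (mu : {measure set T -> \bar R})
    (D : set T) (u v : T -> R) : measurable D -> measurable_fun D u -> measurable_fun D v ->
  {ae mu, forall x, D x -> u x = v x} ->
  (\int[mu]_(x in D) ((u x) ^+ 2)%:E = \int[mu]_(x in D) ((v x) ^+ 2)%:E)%E.
Proof.
move=> mD mu' mv uv; apply: ge0_ae_eq_integral => //.
- by apply/measurable_EFinP; exact: measurable_funX.
- by apply/measurable_EFinP; exact: measurable_funX.
- by move=> x _; rewrite lee_fin sqr_ge0.
- by move=> x _; rewrite lee_fin sqr_ge0.
- by apply: filterS uv => x h Dx; rewrite h.
Qed.

Section L2Norm.
Context {R : realType}.
Local Notation lambda := (@completed_lebesgue_measure R).

Lemma norm_L2_01E (u : R -> R) :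
  norm_L2_01 u = ((\int[lambda]_(x in (`]0%R, 1%R[%classic : set (lebesgueType R)))
    ((u x) ^+ 2)%:E) `^ 2^-1)%E.
Proof.
rewrite /norm_L2_01 unlock /=; congr (_ `^ _)%E; rewrite [RHS]integral_mkcond.
apply: eq_integral => x _ /=; rewrite !patchE; case: ifPn => _.
  by rewrite powR_mulrn // real_normK ?num_real.
by rewrite normr0 powR0.
Qed.

Lemma norm_L2_01_le (u : R -> R) (c : R) : lebesgue_measurable_fun unit_itv u -> 0 <= c ->
  (\int[lambda]_(x in unit_itv) ((u x) ^+ 2)%:E <= (c ^+ 2)%:E)%E ->
  (norm_L2_01 u <= c%:E)%E.
Proof.
move=> mu c0 hu; rewrite norm_L2_01E.
have -> : c%:E = (((c ^+ 2)%:E) `^ 2^-1)%E.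
  by rewrite poweR_EFin powR12_sqrt ?sqr_ge0 // sqrtr_sqr ger0_norm.
apply: gt0_ler_poweR; rewrite ?in_itv /= ?leey ?andbT ?lee_fin ?sqr_ge0 ?invr_ge0 //.
  by apply: integral_ge0 => x _; rewrite lee_fin sqr_ge0.
apply: le_trans hu; apply: ge0_subset_integral.
- by apply: measurable_borel_lebesgue; exact: measurable_itv.
- exact: measurable_unit_itv.
- by apply/measurable_EFinP; exact: measurable_funX.
- by move=> x _; rewrite lee_fin sqr_ge0.
- by apply: subset_itvW.
Qed.

End L2Norm.

Section ConvergencePart.
Context {R : realType}.
Local Notation lambda := (@completed_lebesgue_measure R).

Lemma nneseries_partial_le (w : nat -> R) : (forall k, 0 <= w k) ->
  (\sum_(1 <= k <oo) (w k)%:E < +oo)%E ->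
  exists S, forall n, \sum_(1 <= k < n) w k <= S.
Proof.
move=> w0 h; exists (fine (\sum_(1 <= k <oo) (w k)%:E)%E) => n.
rewrite -lee_fin fineK; last first.
  by rewrite ge0_fin_numE // nneseries_ge0 // => k _ _; rewrite lee_fin.
by rewrite -sumEFin; apply: nneseries_lim_ge => k _ _; rewrite lee_fin.
Qed.

Lemma sum_dyadic (F : nat -> R) n :
  \sum_(0 <= i < n) \sum_(2 ^ i <= k < 2 ^ i.+1) F k = \sum_(1 <= k < 2 ^ n) F k.
Proof.
elim: n => [|n IH]; first by rewrite !big_geq.
rewrite big_nat_recr //= IH -big_cat_nat //= ?expn_gt0 //.
by rewrite leq_exp2l.
Qed.

Lemma cvg_inv_log (c : R) : c / (trunc_log 2 N.+1).+1%:R @[N --> \oo] --> (0 : R).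
Proof.
apply/cvgrPdist_le => e e0.
exists (2 ^ (Num.truncn (`|c| / e)).+1)%N => // N /= hN.
rewrite sub0r normrN normrM normfV (ger0_norm (ler0n R _)) ler_pdivrMr ?ltr0n //.
rewrite mulrC -ler_pdivrMr //; apply: le_trans (ltW (truncnS_gt _)) _.
rewrite ler_nat; apply: leq_trans (leqnSn _).
by apply: trunc_log_max => //; exact: leq_trans (leqnSn _).
Qed.

Lemma dilated_sum_cvg (al : R) (al2 : 1 / 2 < al) (al1 : al < 1) (f : R -> R) (c : nat -> R) :
  class_C al f ->
  let K := 3 / (1 - al) + 4 / Num.sqrt (2 * al - 1) in
  (\sum_(1 <= k <oo) (c k ^+ 2 * expR (K * (logm k%:R `^ (1 - al))
                        / logm (logm k%:R)))%:E < +oo)%E ->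
  cvg_L2_01 (dilated_sum c f) /\
  {ae lambda, forall x, cvgn (fun N : nat => dilated_sum c f N x)}.
Proof.
move=> fC K hc.
have mD := @measurable_unit_itv R.
have [M [A_le B_le]] := class_C_coef_le fC.
set A := fourier_sin f in A_le; set B := fourier_cos f in B_le.
pose P := M ^+ 2 * (2 * al / (2 * al - 1)).
have P0 : 0 <= P by rewrite /P mulr_ge0 ?sqr_ge0 // divr_ge0 //; lra.
have [d [y [C [/andP[d0 d1] hy hG]]]] := block_factor_le al2 al1 P0.
pose w k := c k ^+ 2 * expR (K * (logm k%:R `^ (1 - al)) / logm (logm k%:R)).
have w0 k : 0 <= w k by rewrite /w mulr_ge0 ?sqr_ge0 ?expR_ge0.
have [S hS] := nneseries_partial_le w0 hc.
pose G i := P * expR (expo al d (y i)%:R).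
(* [trunc_log 2 k] is the index of the dyadic block containing k, so each block carries its own
   constant. *)
pose b k := G (trunc_log 2 k) * c k ^+ 2.
pose X k (x : lebesgueType R) := c k * fourier_series A B (k%:R * x).
have mX k : measurable_fun unit_itv (X k).
  by apply: measurable_fun_scale; exact: measurable_dilated_series.
have Xle i a m : (2 ^ i <= a)%N -> (a <= m)%N -> (m <= 2 ^ i.+1)%N ->
    (\int[lambda]_(x in unit_itv) ((\sum_(a <= k < m) X k x) ^+ 2)%:E <=
     (\sum_(a <= k < m) b k)%:E)%E.
  move=> ia am mi; have [y1 hT hN] := hy i.
  have -> : \sum_(a <= k < m) b k = G i * \sum_(a <= k < m) c k ^+ 2.
    rewrite mulr_sumr big_nat [RHS]big_nat; apply: eq_bigr => k /andP[ak km].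
    by rewrite /b (@trunc_log_eq 2 i) // (leq_trans ia ak) (leq_trans km mi).
  apply: (dilated_sum_L2 al2 al1 A_le B_le c d0 d1 y1 hT hN) => //.
    by apply: leq_trans ia; rewrite expn_gt0.
  exact: leqW.
have hW n : \sum_(0 <= i < n) i.+1%:R ^+ 6 * \sum_(2 ^ i <= k < 2 ^ i.+1) b k <= `|C| * S.
  apply: le_trans (ler_wpM2l (normr_ge0 C) (hS (2 ^ n)%N)).
  rewrite mulr_sumr -sum_dyadic; apply: ler_sum => i _.
  rewrite mulr_sumr big_nat [leRHS]big_nat; apply: ler_sum => k /andP[ik ki].
  rewrite /b (@trunc_log_eq 2 i) ?ik ?ki // mulrA.
  apply: le_trans (ler_wpM2r (sqr_ge0 _) (hG i k ik)) _.
  by rewrite /w [leRHS](mulrCA `|C|) [leRHS]mulrC ler_wpM2r ?sqr_ge0 // ler_wpM2r ?expR_ge0 // ler_norm.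
set W := `|C| * S in hW.
have W0 : 0 <= W by have := hW 0%N; rewrite big_geq.
(* One null set serves all N, as a countable union over the dilations k. *)
have aeX : {ae lambda, forall x, unit_itv x -> forall N, dilated_sum c f N x = psums X N x}.
  have h k : {ae lambda, forall x, unit_itv x -> (0 < k)%N -> f (k%:R * x) = fourier_series A B (k%:R * x)}.
    have [->|k0] := posnP k; first exact: aeW.
    by apply: negligibleS (class_C_ae_series al2 fC k0) => x /= hx e; apply: hx.
  apply: filterS (ae_foralln h) => x hx xD N.
  rewrite /dilated_sum /psums /X big_nat [RHS]big_nat; apply: eq_bigr => k /andP[k0 _].
  by rewrite hx.
have aeL := ae_cvg_psums mD mX Xle hW.
split; last first.
  apply: (@ae_periodic _ (fun x => cvgn (fun N : nat => dilated_sum c f N x))).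
    move=> x; suff -> : (dilated_sum c f)^~ (x + 1) = (dilated_sum c f)^~ x by [].
    apply/funext => N; apply: eq_bigr => k _.
    by rewrite mulrDr mulr1 (periodicn (class_periodic fC)).
  apply: filterS2 aeX aeL => x hx hl xD.
  by rewrite (funext (hx xD)); apply/cvg_ex; exists (esup_psums X x); exact: hl.
exists (esup_psums X); split.
- apply: measurable_funS (measurable_esup_psums mX) => //.
  exact: subset_itvW.
- apply: (@le_lt_trans _ _ (Num.sqrt (16 * W))%:E); last exact: ltry.
  apply: norm_L2_01_le; [exact: (measurable_esup_psums mX)|exact: sqrtr_ge0|].
  apply: (@le_trans _ _ (16 / 1%:R ^+ 2 * W)%:E); last first.
    by rewrite lee_fin sqr_sqrtr ?(mulr_ge0 _ W0) // expr1n divr1.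
  apply: le_trans (psums_L2_le mD mX Xle hW (i := 0) (n := 0) isT).
  rewrite le_eqVlt; apply/orP; left; apply/eqP; apply: eq_integral => x _.
  by rewrite /psums big_geq // sub0r sqrrN.
(* Measurability of the partial sums is inherited through this equality, the measure being
   complete. *)
have aeE N : ae_eq lambda unit_itv
    (fun x => (psums X N x - esup_psums X x)%:E)
    (fun x => (dilated_sum c f N x - esup_psums X x)%:E).
  by apply: filterS aeX => x hx xD; rewrite hx.
have mpsums N : measurable_fun unit_itv (fun x => psums X N x - esup_psums X x).
  by apply: measurable_funB; [exact: measurable_sum_nat|exact: measurable_esup_psums].
have mdil N : measurable_fun unit_itv (fun x : lebesgueType R => dilated_sum c f N x - esup_psums X x).
  apply/measurable_EFinP.
  apply: (ae_measurable_fun (@completed_lebesgue_measure_is_complete R) (aeE N)).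
  by apply/measurable_EFinP.
apply: (@squeeze_cvge _ _ _ _ (cst 0%E) _
  (fun N => (4 * Num.sqrt W / (trunc_log 2 N.+1).+1%:R)%:E)).
- apply: nearW => N; apply/andP; split; first by rewrite norm_L2_01E poweR_ge0.
  have v0 : 0 <= 4 * Num.sqrt W / (trunc_log 2 N.+1).+1%:R.
    by rewrite divr_ge0 // mulr_ge0 // sqrtr_ge0.
  apply: norm_L2_01_le => //; first exact: mdil.
  apply: (@le_trans _ _ (16 / (trunc_log 2 N.+1).+1%:R ^+ 2 * W)%:E); last first.
    rewrite lee_fin exprMn exprVn exprMn sqr_sqrtr // (_ : 4 ^+ 2 = 16) 1?mulrAC //.
    by rewrite -natrX.
  apply: le_trans (psums_L2_le mD mX Xle hW (i := trunc_log 2 N.+1) (n := N)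
    (@trunc_logP 2 N.+1 isT isT)); rewrite le_eqVlt; apply/orP; left; apply/eqP.
  apply: (ae_eq_integral_sqr mD (mdil N) (mpsums N)).
  by apply: filterS aeX => x hx xD /=; rewrite hx.
- exact: cvg_cst.
- by apply: cvg_EFin; [exact: nearW|exact: cvg_inv_log].
Qed.

End ConvergencePart.

(** * Divergence *)

Lemma sum_uniq_le (R : realType) (F : nat -> R) (r : seq nat) (m n : nat) : uniq r ->
  {subset r <= index_iota m n} -> (forall j, 0 <= F j) ->
  \sum_(j <- r) F j <= \sum_(m <= j < n) F j.
Proof.
move=> ur rs F0; rewrite [leRHS](bigID (mem r)) /=.
rewrite -[leLHS]addr0; apply: lerD; last exact: sumr_ge0.
rewrite -[leRHS]big_filter le_eqVlt; apply/orP; left; apply/eqP; apply: perm_big; apply: uniq_perm => //.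
  by rewrite filter_uniq // iota_uniq.
by move=> j; rewrite mem_filter; case: (boolP (j \in r)) => //= /rs ->.
Qed.

Section SquarefreeDivisors.
Implicit Types (p k n : nat) (s : seq nat).

(** Subset products, listed recursively so that double sums over pairs of divisors factor one prime
    at a time. *)
Fixpoint sqfree_divs s : seq nat :=
  if s is p :: s' then sqfree_divs s' ++ [seq (p * n)%N | n <- sqfree_divs s'] else [:: 1%N].

Lemma size_sqfree_divs s : size (sqfree_divs s) = (2 ^ size s)%N.
Proof. by elim: s => //= p s IH; rewrite size_cat size_map IH expnS mul2n addnn. Qed.

Lemma sqfree_divs_dvdn s n : n \in sqfree_divs s -> (n %| \prod_(p <- s) p)%N.
Proof.
elim: s n => [|p s IH] n /=; first by rewrite big_nil inE => /eqP ->.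
rewrite big_cons mem_cat => /orP[/IH h|/mapP[m /IH h ->]]; first exact: dvdn_mull.
exact: dvdn_mul.
Qed.

Lemma sqfree_divs_uniq s : all prime s -> uniq s -> uniq (sqfree_divs s).
Proof.
elim: s => //= p s IH /andP[pp ps] /andP[pn us]; rewrite cat_uniq IH //=.
rewrite map_inj_uniq ?IH //; last by move=> m n /eqP; rewrite eqn_pmul2l ?prime_gt0 // => /eqP.
rewrite andbT; apply/hasPn => _ /mapP[m _ ->]; apply/negP => /sqfree_divs_dvdn h.
have : (p %| \prod_(q <- s) q)%N by apply: dvdn_trans h; exact: dvdn_mulr.
move=> {h}; elim: s pn ps {IH us} => [|q s IH] /=; first by rewrite big_nil dvdn1 => _ _ /eqP p1; rewrite p1 in pp.
rewrite inE negb_or => /andP[pq pn] /andP[qq ps]; rewrite big_cons Euclid_dvdM // dvdn_prime2 //.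
by rewrite (negbTE pq) => /IH; apply.
Qed.

Lemma prod_prime_gt0 s : all prime s -> (0 < \prod_(p <- s) p)%N.
Proof.
by elim: s => [|p s IH] /=; rewrite ?big_nil // big_cons muln_gt0 => /andP[/prime_gt0 -> /IH].
Qed.

Lemma sqfree_divs_gt0 s n : all prime s -> n \in sqfree_divs s -> (0 < n)%N.
Proof. by move=> /prod_prime_gt0 P0 /sqfree_divs_dvdn /dvdn_gt0; exact. Qed.

Context {R : realType} (a : R).

(** For positive k and n this is (n / k)^(-a) if k divides n and 0 otherwise, written in the form in
    which the coefficients of a dilated series appear. *)
Definition quot_powR k n : R := \sum_(1 <= j < n.+1) (j * k == n)%N%:R * j%:R `^ (- a).

Lemma quot_powR_ge0 k n : 0 <= quot_powR k n.
Proof. by apply: sumr_ge0 => j _; rewrite mulr_ge0 ?powR_ge0. Qed.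

Let quot_powR_map q k n k' n' : (0 < q)%N -> (q * n <= n')%N ->
  (forall j, (j * k == n)%N -> (q * j * k' == n')%N) ->
  q%:R `^ (- a) * quot_powR k n <= quot_powR k' n'.
Proof.
move=> q0 nn h; rewrite /quot_powR mulr_sumr.
pose G j := (j * k' == n')%N%:R * j%:R `^ (- a) : R.
apply: (@le_trans _ _ (\sum_(j <- [seq (q * j)%N | j <- index_iota 1 n.+1]) G j)).
  rewrite big_map; apply: ler_sum => j _; rewrite /G.
  case: eqP => [/eqP e|_]; last by rewrite mul0r mulr0 mulr_ge0 ?powR_ge0.
  by rewrite (h j e) natrM powRM // !mul1r.
apply: sum_uniq_le => [|_ /mapP[j + ->]|j].
- by rewrite map_inj_uniq ?iota_uniq // => i j /eqP; rewrite eqn_pmul2l // => /eqP.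
- rewrite !mem_index_iota => /andP[j0 jn]; rewrite muln_gt0 q0 j0 ltnS.
  by apply: leq_trans nn; rewrite leq_mul2l -ltnS jn orbT.
- by rewrite mulr_ge0 ?powR_ge0.
Qed.

(** At each prime p the local pairs (k, n) = (1, 1) and (p, p) contribute 1 each and (1, p)
    contributes p^(-a); the pair (p, 1) is dropped. *)
Lemma sum_quot_powR_ge s : all prime s ->
  \prod_(p <- s) (2 + p%:R `^ (- a)) <=
  \sum_(n <- sqfree_divs s) \sum_(k <- sqfree_divs s) quot_powR k n.
Proof.
elim: s => [|p s IH] /=.
  by rewrite big_nil !big_seq1 /quot_powR big_nat1 muln1 eqxx mul1r powR1.
move=> /andP[pp /IH {}IH]; have p0 := prime_gt0 pp.
rewrite big_cons; apply: le_trans (ler_wpM2l _ IH) _; first by rewrite addr_ge0 ?powR_ge0.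
set ds := sqfree_divs s; rewrite big_cat !big_map /= -[2]/(1 + 1) !mulrDl !mul1r.
rewrite -addrA; apply: lerD.
  apply: ler_sum => n _; rewrite big_cat lerDl; apply: sumr_ge0 => k _; exact: quot_powR_ge0.
rewrite mulr_sumr -big_split /=; apply: ler_sum => n _.
rewrite big_cat big_map /= addrC mulr_sumr; apply: lerD; apply: ler_sum => k _.
  apply: quot_powR_map => // j /eqP <-; by rewrite mulnA.
have := @quot_powR_map 1%N k n (p * k) (p * n); rewrite powR1 mul1r; apply => //.
  by rewrite mul1n leq_pmull.
by move=> j /eqP <-; rewrite mul1n mulnCA.
Qed.

End SquarefreeDivisors.

Section Levels.
Context {R : realType} (a : R).
Hypothesis (a2 : 1 / 2 < a) (a1 : a < 1).
Implicit Types (i k n y : nat).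

Definition primes_upto y : seq nat := [seq p <- index_iota 1 y.+1 | prime p].

Lemma all_prime_upto y : all prime (primes_upto y).
Proof. exact: filter_all. Qed.

Lemma uniq_primes_upto y : uniq (primes_upto y).
Proof. by rewrite filter_uniq // iota_uniq. Qed.

Lemma theta_primes_upto y : theta y = ln (\prod_(p <- primes_upto y) p)%N%:R :> R.
Proof. by rewrite theta_primorial big_filter. Qed.

(** With v = u / 2: log(1 + v) >= 1 - 1 / (1 + v) >= v - v^2. *)
Let two_plus_ge (u : R) : 0 <= u -> 2 * expR (u / 2 - u ^+ 2 / 4) <= 2 + u.
Proof.
move=> u0; have v0 : 0 < 1 + u / 2 by rewrite ltr_pwDl // divr_ge0.
rewrite -[leRHS](_ : 2 * (1 + u / 2) = _); last by rewrite mulrDr mulr1 mulrC divfK.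
rewrite ler_pM2l // -[leRHS]lnK ?posrE // ler_expR.
have vi : 0 < (1 + u / 2)^-1 by rewrite invr_gt0.
have := ln_le_subr1 vi; rewrite lnV ?posrE // => h.
suff : (1 + u / 2)^-1 <= 1 - (u / 2 - u ^+ 2 / 4) by lra.
rewrite -[leLHS]mul1r ler_pdivrMr //.
have : 0 <= u ^+ 3 by exact: exprn_ge0.
have -> : (1 - (u / 2 - u ^+ 2 / 4)) * (1 + u / 2) = 1 + u ^+ 3 / 8 by field.
lra.
Qed.

Lemma prod_two_plus_ge : exists Z, forall y,
  2 ^+ size (primes_upto y) * expR (psum (fun p => p%:R `^ (- a)) y / 2 - Z) <=
  \prod_(p <- primes_upto y) (2 + p%:R `^ (- a)) :> R.
Proof.
have a21 : 1 < 2 * a by have := a2; lra.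
exists (2 * a / (2 * a - 1) / 4) => y.
have -> : 2 ^+ size (primes_upto y) = \prod_(p <- primes_upto y) 2 :> R.
  by rewrite big_const_seq count_predT iter_mulr_1.
apply: (@le_trans _ _ (\prod_(p <- primes_upto y)
    (2 * expR (p%:R `^ (- a) / 2 - (p%:R `^ (- a)) ^+ 2 / 4)))); last first.
  by apply: ler_prod => p _; rewrite mulr_ge0 ?expR_ge0 //= two_plus_ge ?powR_ge0.
rewrite big_split /= ler_wpM2l ?prodr_ge0 // -expR_sum ler_expR sumrB; apply: lerB.
  rewrite -mulr_suml /psum /primes_upto big_filter ler_wpM2r // [leRHS]big_mkcond /=.
  by apply: ler_sum => p _; case: ifP; rewrite ?mul1r ?mul0r.
rewrite -mulr_suml ler_wpM2r // /primes_upto big_filter.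
apply: le_trans (sum_powRN_total_le y a21); rewrite [leLHS]big_mkcond /=; apply: ler_sum => p _.
case: ifP => _; last exact: powR_ge0.
by rewrite -powR_mulrn ?powR_ge0 // -powRrM mulNr mulrC.
Qed.

(** The exponent of the summability weight for eps = 0 at log k = theta y, the largest value of log
    k among the divisors of the primorial. *)
Definition level_expo y : R := theta y `^ (1 - a) / ln (theta y) / (1 - a).

Lemma near_level_expo_ge (M : R) : 0 <= M -> exists Y, forall y, (Y <= y)%N -> M <= level_expo y.
Proof.
move=> M0; have b0 : 0 < 1 - a by have := a1; lra.
have [X hX] : exists X, forall x, X < x -> (M * (1 - a)) * (x `^ 0 * ln x) <= x `^ (1 - a) /\ 1 <= ln x.
  suff [X [_ hX]] : \forall x \near +oo,
      (M * (1 - a)) * (x `^ 0 * ln x) <= x `^ (1 - a) /\ 1 <= ln x :> R by exists X.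
  near=> x; split; near: x; [exact: near_powR_ln|exact: near_ln_ge].
have [c c0 [N hN]] := @theta_linear R.
exists (maxn N (Num.truncn (X / c)).+1) => y; rewrite geq_max => /andP[Ny Xy].
have [|h l1] := hX (theta y).
  apply: lt_le_trans (hN y Ny); rewrite mulrC -ltr_pdivrMr //.
  by apply: (lt_le_trans (truncnS_gt _)); rewrite ler_nat.
have l0 : 0 < ln (theta y) :> R by exact: lt_le_trans ltr01 l1.
rewrite /level_expo !ler_pdivlMr //; apply: le_trans h.
by rewrite powRr0 mul1r.
Unshelve. all: by end_near. Qed.

(** The constant of [psum_powRN_ge] is taken as 1 - 1 / (i + 2), which tends to 1, so that 1 - eps
    is eventually exceeded for every eps. *)
Lemma exists_levels : exists y : nat -> nat, forall i,
  i%:R <= level_expo (y i) /\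
  (1 - i.+2%:R^-1) * level_expo (y i) <= psum (fun p => p%:R `^ (- a)) (y i).
Proof.
suff h i : exists y, i%:R <= level_expo y /\
    (1 - i.+2%:R^-1) * level_expo y <= psum (fun p => p%:R `^ (- a)) y.
  by exists (fun i => projT1 (cid (h i))) => i; case: cid.
have [Y hY] := @near_level_expo_ge i%:R (ler0n _ _).
have q1 : i.+2%:R^-1 < 1 :> R by rewrite invf_lt1 ?ltr0n // ltr1n.
have q0 : 0 < i.+2%:R^-1 :> R by rewrite invr_gt0 ltr0n.
have a0 : 0 < a by have := a2; lra.
have qi0 : 0 < 1 - i.+2%:R^-1 :> R by rewrite subr_gt0.
have qi1 : 1 - i.+2%:R^-1 < 1 :> R by rewrite gtrBl.
have [y Yy hy] := psum_powRN_ge Y a0 a1 qi0 qi1.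
exists y; split; first exact: hY.
apply: le_trans hy; rewrite /level_expo le_eqVlt; apply/orP; left; apply/eqP.
by rewrite mulrA [X in X / _ = _]mulrC [RHS]mulrAC mulrC mulrA.
Qed.

(** x^(1 - a) / log x is monotone only once log x >= 1 / (1 - a). Values of log k beyond L are
    compared with theta y by monotonicity; the others contribute at most C, which depends on none of
    y, k, e. *)
Lemma log_weight_le_level : exists2 C, 0 <= C & forall y k, (0 < k)%N ->
  ln k%:R <= theta y :> R ->
  forall e, 0 < e -> e < 1 -> 0 <= level_expo y ->
  (1 - e) / (1 - a) * ((logm k%:R `^ (1 - a)) / logm (logm k%:R)) <=
    C + (1 - e) * level_expo y.
Proof.
have b0 : 0 < 1 - a by have := a1; lra.
pose L := expR (1 - a)^-1 : R.
have L1 : 1 <= L by rewrite -expR0 ler_expR invr_ge0 ltW.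
exists (L `^ (1 - a) / (1 - a)); first by rewrite divr_ge0 ?powR_ge0 ?ltW.
move=> y k k0 ky e e0 e1 E0; have e10 : 0 <= 1 - e by lra.
have [kL|Lk] := leP (ln k%:R) L.
  apply: (@le_trans _ _ (L `^ (1 - a) / (1 - a))); last by rewrite lerDl mulr_ge0.
  have lL : logm k%:R <= L by rewrite /logm ge_max L1.
  have l1 := @le1_logm R k%:R; have l2 := @le1_logm R (logm k%:R).
  have v0 : 0 <= logm k%:R `^ (1 - a) / logm (logm k%:R).
    by rewrite divr_ge0 ?powR_ge0 // (le_trans ler01).
  rewrite mulrAC ler_pM2r ?invr_gt0 //.
  apply: (@le_trans _ _ (1 * (logm k%:R `^ (1 - a) / logm (logm k%:R)))).
    by rewrite ler_wpM2r //; lra.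
  rewrite mul1r; apply: (@le_trans _ _ (logm k%:R `^ (1 - a))).
    by rewrite ler_pdivrMr ?(lt_le_trans ltr01) // ler_peMr ?powR_ge0.
  apply: ge0_ler_powR => //; first exact: ltW.
    by rewrite nnegrE (le_trans ler01 l1).
  by rewrite nnegrE (le_trans ler01 L1).
have lk1 : 1 <= ln k%:R :> R by rewrite (le_trans L1) // ltW.
have lk0 : 0 < ln k%:R :> R by exact: lt_le_trans ltr01 lk1.
have llk : (1 - a)^-1 <= ln (ln k%:R) :> R.
  by rewrite -[leLHS]expRK ler_ln ?posrE ?expR_gt0 // ltW.
have llk1 : 1 <= ln (ln k%:R) :> R.
  apply: le_trans llk; rewrite invf_ge1 //; have := a2; lra.
rewrite (logmE lk1) (logmE llk1).
apply: (@le_trans _ _ ((1 - e) * level_expo y)); last by rewrite lerDr divr_ge0 ?powR_ge0 ?ltW.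
rewrite -mulrA ler_wpM2l // /level_expo [leRHS]mulrC ler_wpM2l ?invr_ge0 ?(ltW b0) //.
exact: powR_div_ln_homo.
Qed.

End Levels.

(** * Duality and boundedness in L2 *)

Section SquareBounds.
Context {R : realType} d (T : measurableType d) (mu : {measure set T -> \bar R}).
Context (D : set T) (mD : measurable D).
Local Notation "\I f" := (Rintegral mu D f) (at level 10, f at level 9).

Let integral_sqr_comb_le (h : T -> \bar R) (u v : T -> R) (r s : R) : 0 <= r -> 0 <= s ->
  measurable_fun D h -> measurable_fun D u -> measurable_fun D v ->
  (forall x, D x -> (0 <= h x)%E) ->
  (forall x, D x -> (h x <= (r * u x ^+ 2 + s * v x ^+ 2)%:E)%E) ->
  (\int[mu]_(x in D) h x <=
   r%:E * \int[mu]_(x in D) (u x ^+ 2)%:E + s%:E * \int[mu]_(x in D) (v x ^+ 2)%:E)%E.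
Proof.
move=> r0 s0 mh mu' mv h0 hle.
have mu2 : measurable_fun D (fun x => (u x ^+ 2)%:E).
  by apply/measurable_EFinP; exact: measurable_funX.
have mv2 : measurable_fun D (fun x => (v x ^+ 2)%:E).
  by apply/measurable_EFinP; exact: measurable_funX.
apply: (@le_trans _ _ (\int[mu]_(x in D) (r%:E * (u x ^+ 2)%:E + s%:E * (v x ^+ 2)%:E))%E).
  apply: ge0_le_integral => //.
  - by apply: emeasurable_funD; apply: emeasurable_funM.
rewrite ge0_integralD //; last 4 first.
- by move=> x _; rewrite -EFinM lee_fin mulr_ge0 // sqr_ge0.
- by apply: emeasurable_funM.
- by move=> x _; rewrite -EFinM lee_fin mulr_ge0 // sqr_ge0.
- by apply: emeasurable_funM.
by rewrite !ge0_integralZl_EFin // => x _; rewrite lee_fin sqr_ge0.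
Qed.

(** Cauchy-Schwarz in the form u v <= u^2 / (2 t) + t v^2 / 2; the parameter is chosen in the
    divergence argument. *)
Lemma Rint_mul_le (u v : T -> R) (t a b : R) : 0 < t ->
  measurable_fun D u -> measurable_fun D v ->
  (\int[mu]_(x in D) (u x ^+ 2)%:E <= a%:E)%E ->
  (\int[mu]_(x in D) (v x ^+ 2)%:E <= b%:E)%E ->
  \I (fun x => u x * v x) <= (a / t + t * b) / 2.
Proof.
move=> t0 mu' mv ua vb.
have t2 : 0 <= (2 * t)^-1 by rewrite invr_ge0 mulr_ge0 // ltW.
have t3 : 0 <= t / 2 by rewrite divr_ge0 // ltW.
have muv : measurable_fun D (fun x => (u x * v x)%:E).
  by apply/measurable_EFinP; exact: measurable_funM.
have h : (\int[mu]_(x in D) `|(u x * v x)%:E| <= ((a / t + t * b) / 2)%:E)%E.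
  apply: le_trans (integral_sqr_comb_le t2 t3 _ mu' mv _ _) _.
  - exact: measurableT_comp.
  - by move=> x _; exact: abse_ge0.
  - move=> x _; rewrite lee_fin normrM.
    have : 0 <= (`|u x| - t * `|v x|) ^+ 2 by exact: sqr_ge0.
    rewrite sqrrB exprMn !real_normK ?num_real // => h.
    rewrite -(@ler_pM2l _ (2 * t)) ?mulr_gt0 // mulrDr mulVKf ?mulf_neq0 ?(gt_eqF t0) //.
    have -> : 2 * t * (t / 2 * v x ^+ 2) = t ^+ 2 * v x ^+ 2 by field.
    rewrite -subr_ge0; apply: le_trans h _; rewrite le_eqVlt; apply/orP; left; apply/eqP.
    by rewrite -mulr_natl; ring.
  rewrite (_ : (a / t + t * b) / 2 = (2 * t)^-1 * a + t / 2 * b); last by field; rewrite gt_eqF.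
  by rewrite EFinD !EFinM leeD // lee_wpmul2l ?lee_fin.
have iuv : mu.-integrable D (EFin \o (fun x => u x * v x)).
  by apply/integrableP; split => //; apply: le_lt_trans h (ltry _).
apply: le_trans (ler_norm _) _; apply: le_trans (le_normr_Rintegral mD iuv) _.
rewrite -lee_fin fineK; first by apply: le_trans h; rewrite le_eqVlt eqxx.
have -> : (\int[mu]_(x in D) (`|u x * v x|)%:E = \int[mu]_(x in D) `|(u x * v x)%:E|)%E by [].
rewrite ge0_fin_numE; first exact: le_lt_trans h (ltry _).
by apply: integral_ge0 => x _; exact: abse_ge0.
Qed.

Lemma integral_sqr_le_sub (u v : T -> R) : measurable_fun D u -> measurable_fun D v ->
  (\int[mu]_(x in D) (u x ^+ 2)%:E <=
   2%:E * \int[mu]_(x in D) ((u x - v x) ^+ 2)%:E + 2%:E * \int[mu]_(x in D) (v x ^+ 2)%:E)%E.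
Proof.
move=> mu' mv; apply: (integral_sqr_comb_le (u := fun x => u x - v x)) => //.
- by apply/measurable_EFinP; exact: measurable_funX.
- exact: measurable_funB.
- by move=> x _; rewrite lee_fin sqr_ge0.
- move=> x _; rewrite lee_fin -subr_ge0.
  have -> : 2 * (u x - v x) ^+ 2 + 2 * v x ^+ 2 - u x ^+ 2 = (u x - 2 * v x) ^+ 2 by ring.
  exact: sqr_ge0.
Qed.

End SquareBounds.

Section BoundedOfConvergent.
Context {R : realType}.
Local Notation lambda := (@completed_lebesgue_measure R).
Local Notation open_itv := (`]0%R, 1%R[%classic : set (lebesgueType R)).

Lemma norm_L2_01_sqr (u : R -> R) :
  (\int[lambda]_(x in open_itv) ((u x) ^+ 2)%:E = norm_L2_01 u `^ 2)%E.
Proof.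
rewrite norm_L2_01E -poweRrM mulVf // poweRe1 //.
by apply: integral_ge0 => x _; rewrite lee_fin sqr_ge0.
Qed.

Lemma integral_open_unit_itv (u : R -> R) : lebesgue_measurable_fun setT u ->
  (\int[lambda]_(x in unit_itv) ((u x) ^+ 2)%:E =
   \int[lambda]_(x in open_itv) ((u x) ^+ 2)%:E)%E.
Proof.
move=> mu; pose N : set (lebesgueType R) := [set 0] `|` [set 1].
have mN : measurable N.
  by apply: measurable_borel_lebesgue; apply: measurableU; exact: measurable_set1.
have N0 : lambda N = 0%E.
  by apply: measure_negligible mN _; apply: negligibleU; exact: negligible_set1.
rewrite (ge0_negligible_integral mN (@measurable_unit_itv R) _ _ N0).
- congr (integral _ _ _); apply/seteqP; split => x; rewrite /unit_itv /N /= !in_itv /=.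
    by move=> [/andP[]]; rewrite !le_eqVlt => /predU1P[->|->] /predU1P[->|->] // /not_orP[].
  move=> /andP[x0 x1]; split; first by rewrite !ltW.
  by case => e; move: x0 x1; rewrite e ltxx.
- by apply/measurable_EFinP; apply: measurable_funX; exact: measurable_funTS.
- by move=> x _; rewrite lee_fin sqr_ge0.
Qed.

(** From some N0 on the distance to the limit g is below 1, and u^2 <= 2 (u - g)^2 + 2 g^2. *)
Lemma cvg_L2_01_bounded (S : nat -> R -> R) : (forall N, lebesgue_measurable_fun setT (S N)) ->
  cvg_L2_01 S -> exists B N0, forall N, (N0 <= N)%N ->
    (\int[lambda]_(x in unit_itv) ((S N x) ^+ 2)%:E <= B%:E)%E.
Proof.
move=> mS [g [mg ng hg]].
have mO : measurable open_itv by apply: measurable_borel_lebesgue; exact: measurable_itv.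
have gfin : (\int[lambda]_(x in open_itv) ((g x) ^+ 2)%:E < +oo)%E.
  by rewrite norm_L2_01_sqr poweR_lty.
have g0 : (0 <= \int[lambda]_(x in open_itv) ((g x) ^+ 2)%:E)%E.
  by apply: integral_ge0 => x _; rewrite lee_fin sqr_ge0.
have := hg _ (@open_ereal_lt' R 0%E 1%E lte01) => -[N0 _ hN0].
set G := (\int[lambda]_(x in open_itv) ((g x) ^+ 2)%:E)%E in gfin g0.
exists (2 + 2 * fine G), N0 => N NN; rewrite integral_open_unit_itv //.
have mSN : lebesgue_measurable_fun open_itv (S N) by exact: measurable_funTS (mS N).
have h2 := @integral_sqr_le_sub _ _ _ lambda _ mO _ _ mSN mg.
apply: (le_trans h2).
have Gf : G \is a fin_num by rewrite ge0_fin_numE.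
have -> : ((2 + 2 * fine G)%:E = 2%:E + 2%:E * G)%E by rewrite -[in RHS](fineK Gf).
apply: leeD => //.
rewrite -[leRHS]mule1 lee_wpmul2l ?lee_fin //.
rewrite -/(open_itv) (norm_L2_01_sqr (S N \- g)).
have h := ltW (hN0 N NN).
have -> : 1%E = (1 `^ 2)%E :> \bar R by rewrite poweR_EFin powR1.
apply: gt0_ler_poweR => //; rewrite in_itv /= ?leey ?andbT ?lee_fin //.
by rewrite norm_L2_01E poweR_ge0.
Qed.

End BoundedOfConvergent.

Section SineSeries.
Context {R : realType} (a : R) (a2 : 1 / 2 < a).
Local Notation lambda := (@completed_lebesgue_measure R).
Local Notation "\I f" := (Rintegral lambda unit_itv f) (at level 10, f at level 9).
Local Notation Int f := (lambda.-integrable unit_itv (EFin \o f)).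

Let A (j : nat) : R := j%:R `^ (- a).
Let B (j : nat) : R := 0.

Let A_le j : (0 < j)%N -> `|A j| <= 1 * j%:R `^ (- a).
Proof. by rewrite mul1r ger0_norm ?powR_ge0. Qed.

Let B_le j : (0 < j)%N -> `|B j| <= 1 * j%:R `^ (- a).
Proof. by rewrite mul1r normr0 powR_ge0. Qed.

Definition sine_series : R -> R := fourier_series A B.
Local Notation f := sine_series.

Let measurable_f k : lebesgue_measurable_fun setT (fun x => f (k%:R * x)).
Proof. exact: measurable_dilated_series. Qed.

Let Rint_f_trig u v n : `|u| + `|v| <= 1 ->
  \I (fun x => f x * trig u v n x) = (0 < n)%N%:R * (A n * u / 2).
Proof.
move=> uv; have := Rint_dilated_series_trig a2 A_le B_le n (k := 1) isT uv.
under eq_Rintegral do rewrite mul1r.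
have e j : (A j * u + B j * v) / 2 = A j * u / 2 by rewrite /B mul0r addr0.
move=> ->; under eq_bigr do rewrite e.
case: n => [|n]; first by rewrite big_geq // mul0r.
rewrite big_nat_recr //= muln1 eqxx big_nat big1 ?add0r // => j /andP[_ jn].
by rewrite muln1 (ltn_eqF jn) mul0r.
Qed.

Lemma sine_series_class_C : class_C a f.
Proof.
have fs n : fourier_sin f n = (0 < n)%N%:R * A n.
  rewrite /fourier_sin (_ : Rintegral _ _ _ = \I (fun x => f x * trig 1 0 n x)).
    by rewrite Rint_f_trig ?normr1 ?normr0 ?addr0 // mulr1; field.
  by apply: eq_Rintegral => x _; rewrite /trig mul1r mul0r addr0.
have fc n : fourier_cos f n = 0.
  rewrite /fourier_cos (_ : Rintegral _ _ _ = \I (fun x => f x * trig 0 1 n x)).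
    by rewrite Rint_f_trig ?normr1 ?normr0 ?add0r // mulr0 mul0r !mulr0.
  by apply: eq_Rintegral => x _; rewrite /trig mul1r mul0r add0r.
split.
- by have := measurable_f 1; under eq_fun do rewrite mul1r.
- exact: periodic_fourier_series.
- rewrite (_ : Rintegral _ _ _ = \I (fun x => f x * trig 0 1 0 x)).
    by rewrite Rint_f_trig ?normr1 ?normr0 ?add0r // mul0r.
  by apply: eq_Rintegral => x _; rewrite /trig /tcos mulr0 !mul0r cos0 add0r !mulr1.
- have := @sqint_dilated_series _ _ _ a2 _ _ A_le B_le 1 isT.
  by under eq_integral do rewrite mul1r.
- apply/eqO_exP; exists 1 => //; apply: nearW => n.
  rewrite fs normrM mul1r ler_piMl // ger0_norm //.
  by case: (0 < n)%N.
- apply/eqO_exP; exists 1 => //; apply: nearW => n.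
  by rewrite fc normr0 mul1r.
Qed.

Context (c : nat -> R).

Lemma measurable_dilated_sum N : lebesgue_measurable_fun setT (dilated_sum c f N).
Proof. by apply: measurable_lincomb_nat => k; exact: measurable_f. Qed.

Let Rint_dilated_sum_sin N n :
  Int (fun x => dilated_sum c f N x * trig 1 0 n x) /\
  \I (fun x => dilated_sum c f N x * trig 1 0 n x) =
    (\sum_(1 <= k < N.+1) c k * quot_powR a k n) / 2.
Proof.
have n1 : `|1 : R| + `|0 : R| <= 1 by rewrite normr1 normr0 addr0.
have mD := @measurable_unit_itv R.
have I0 k : Int (fun x => f (k.+1%:R * x) * trig 1 0 n x).
  apply: (Int_mul_bounded mD); last 2 first.
  - exact: measurable_trig.
  - by move=> x; exact: le_trans (trig_bound _ _ _ x) n1.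
  apply: (sqint_integrable mD lambda_unit_itv); first exact: measurable_dilated_series.
  exact: (sqint_dilated_series a2 A_le B_le).
(* The index shift keeps the dilation factor positive for every k, as [Rint_sum] needs integrability
   of all terms. *)
pose h k (x : R) := c k.+1 * (f (k.+1%:R * x) * trig 1 0 n x).
have Ih k : Int (h k) by exact: RintZ.
have [h1 h2] := Rint_sum (index_iota 0 N) xpredT Ih.
have -> : (fun x => dilated_sum c f N x * trig 1 0 n x) = (fun x => \sum_(0 <= k < N) h k x).
  apply/funext => x; rewrite /dilated_sum big_add1 /= mulr_suml; apply: eq_bigr => k _.
  by rewrite /h mulrA.
split=> //; rewrite h2 big_add1 /= mulr_suml; apply: eq_bigr => k _.
rewrite /h RintegralZl //.
rewrite -mulrA; congr (_ * _).
rewrite [LHS](Rint_dilated_series_trig a2 A_le B_le n (k := k.+1) isT n1) /quot_powR mulr_suml.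
by apply: eq_bigr => j _; rewrite mulr1 mulr0 addr0 mulrA.
Qed.

(* Duality against the sum of sin (2 pi n x) over the squarefree n composed of the primes in s. *)
Lemma dilated_sum_L2_lower (s : seq nat) (N : nat) (g t M : R) : all prime s -> uniq s -> 0 < t ->
  (forall k, 0 <= c k) -> 0 <= g ->
  {subset sqfree_divs s <= index_iota 1 N.+1} -> (forall k, k \in sqfree_divs s -> g <= c k) ->
  (\int[lambda]_(x in unit_itv) ((dilated_sum c f N x) ^+ 2)%:E <= M%:E)%E ->
  g * \prod_(p <- s) (2 + p%:R `^ (- a)) <= M / t + t * (2 ^+ size s / 2).
Proof.
move=> ps us t0 c0 g0 sN gc hM; set ds := sqfree_divs s in sN gc.
have uds : uniq ds by exact: sqfree_divs_uniq.
pose phi (x : lebesgueType R) := \sum_(n <- ds) trig 1 0 n x.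
have phi2 : (\int[lambda]_(x in unit_itv) ((phi x) ^+ 2)%:E = (2 ^+ size s / 2)%:E)%E.
  rewrite (@trig_sum_L2 _ _ ds id (fun=> 1) (fun=> 0)); last first.
    by move=> n; exact: sqfree_divs_gt0.
  congr EFin; rewrite -natrX -size_sqfree_divs -/ds (eq_big_seq (fun=> 1 / 2)) => [|i id].
    by rewrite big_const_seq count_predT iter_addr_0 -[LHS]mulr_natl mulrA mulr1.
  rewrite (bigD1_seq i) //= eqxx big1 ?addr0 => [|j /negbTE ji]; last by rewrite eq_sym ji mul0r.
  by rewrite mulr0 addr0 mulr1 [LHS]mul1r.
have mphi : measurable_fun unit_itv phi by apply: measurable_sum => n; exact: measurable_trig.
have mS : lebesgue_measurable_fun unit_itv (dilated_sum c f N).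
  exact: measurable_funTS (measurable_dilated_sum N).
have := @Rint_mul_le _ _ _ lambda _ (@measurable_unit_itv R) _ _ t M (2 ^+ size s / 2) t0 mS mphi hM.
rewrite phi2 => /(_ (lexx _)).
have [_ h2] := Rint_sum ds xpredT (fun n => (Rint_dilated_sum_sin N n).1).
rewrite (@eq_Rintegral _ _ _ lambda unit_itv
  (fun x : lebesgueType R => \sum_(n <- ds) dilated_sum c f N x * trig 1 0 n x)); last first.
  by move=> x _; rewrite mulr_sumr.
rewrite h2 (eq_bigr _ (fun n _ => (Rint_dilated_sum_sin N n).2)).
rewrite -mulr_suml ler_pM2r ?invr_gt0 //; apply: le_trans.
apply: le_trans (ler_wpM2l g0 (sum_quot_powR_ge a ps)) _.
rewrite mulr_sumr; apply: ler_sum => n _.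
apply: le_trans (sum_uniq_le uds sN (F := fun k => c k * quot_powR a k n) _); last first.
  by move=> k; rewrite mulr_ge0 ?quot_powR_ge0.
rewrite mulr_sumr big_seq [leRHS]big_seq; apply: ler_sum => k kd.
by rewrite ler_wpM2r ?quot_powR_ge0 // gc.
Qed.

End SineSeries.

Section DivergentSeries.
Context {R : realType} (a : R) (a2 : 1 / 2 < a) (a1 : a < 1).
Implicit Types (i k n I : nat).

Lemma nneseries_lt_pinfty (w : nat -> R) (S : R) : (forall k, 0 <= w k) ->
  (forall n, \sum_(1 <= k < n) w k <= S) -> (\sum_(1 <= k <oo) (w k)%:E < +oo)%E.
Proof.
move=> w0 h; apply: (@le_lt_trans _ _ S%:E); last exact: ltry.
apply: lime_le.
  by apply: is_cvg_nneseries => k _ _; rewrite lee_fin.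
by apply: nearW => n; rewrite sumEFin lee_fin.
Qed.

Lemma sum_mem_le (s : seq nat) (w : nat -> R) (C : R) n : uniq s -> 0 <= C ->
  (forall k, (0 < k)%N -> k \in s -> w k <= C) ->
  \sum_(1 <= k < n) (k \in s)%:R * w k <= (size s)%:R * C.
Proof.
move=> us C0 wC.
apply: (@le_trans _ _ (\sum_(k <- [seq k <- index_iota 1 n | k \in s]) C)).
  rewrite big_filter [leRHS]big_mkcond big_nat [leRHS]big_nat; apply: ler_sum => k /andP[k0 _].
  by case: ifP => ks; rewrite ?mul1r ?mul0r // wC.
rewrite big_const_seq count_predT iter_addr_0 -[leLHS]mulr_natl ler_wpM2r // ler_nat.
by apply: uniq_leq_size; [rewrite filter_uniq // iota_uniq|move=> k; rewrite mem_filter => /andP[]].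
Qed.

Let pw (p : nat) : R := p%:R `^ (- a).

Context (y : nat -> nat).
Hypothesis y_expo : forall i, i%:R <= level_expo a (y i).
Hypothesis y_psum : forall i, (1 - i.+2%:R^-1) * level_expo a (y i) <= psum pw (y i).

Local Notation E i := (level_expo a (y i)).
Local Notation divs i := (sqfree_divs (primes_upto (y i))).

Let E_ge0 i : 0 <= E i. Proof. exact: le_trans (ler0n _ _) (y_expo i). Qed.

Let term (e : R) i : R := i.+1%:R * expR ((1 - e) * E i - psum pw (y i)).

Let term_ge0 e i : 0 <= term e i. Proof. by rewrite mulr_ge0 ?expR_ge0. Qed.

(** For i >= 2 / e one has 1 / (i + 2) <= e / 2, so the exponent is at most - (e / 2) E i <= - (e /
    2) i; the earlier levels are finite in number. *)
Lemma level_sum_bounded (e : R) : 0 < e -> e < 1 ->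
  exists W, forall I, \sum_(0 <= i < I) term e i <= W.
Proof.
move=> e0 e1; pose rho := expR (- (e / 2)) : R.
have r1 : rho < 1 by rewrite /rho expR_lt1 oppr_lt0 divr_gt0.
have [W hW] := exp_poly_sum_le (expR_gt0 _ : 0 < rho) r1.
pose i0 := (Num.truncn (2 / e)).+1.
have W0 : 0 <= W by have := hW 0%N; rewrite big_geq.
exists (\sum_(0 <= i < i0) term e i + W) => I.
have [Ii|iI] := leqP I i0.
  apply: (@le_trans _ _ (\sum_(0 <= i < i0) term e i)); last by rewrite lerDl.
  rewrite [leRHS](@big_cat_nat _ _ _ I) //= lerDl; exact: sumr_ge0.
rewrite (@big_cat_nat _ _ _ i0 0 I) //=; last exact: ltnW.
rewrite lerD2l; apply: le_trans (hW I).
rewrite [leRHS](@big_cat_nat _ _ _ i0 0 I) //=; last exact: ltnW.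
apply: (@le_trans _ _ (\sum_(i0 <= i < I) i.+1%:R ^+ 6 * rho ^+ i)); last first.
  by rewrite lerDr sumr_ge0 // => i _; rewrite mulr_ge0 ?exprn_ge0 // expR_ge0.
rewrite big_nat [leRHS]big_nat; apply: ler_sum => i /andP[ii _].
apply: ler_pM => //.
  by rewrite ler_eXnr // ler1n.
rewrite /rho -expRM_natl ler_expR.
have q : i.+2%:R^-1 <= e / 2.
  rewrite -[leRHS]invrK lef_pV2 ?posrE ?invr_gt0 ?divr_gt0 ?ltr0n // invf_div.
  by apply: (le_trans (ltW (truncnS_gt _))); rewrite ler_nat (leq_trans ii) // -addn2 leq_addr.
have h1 := y_psum i; have h2 := ler_wpM2r (E_ge0 i) q.
have h3 := ler_wpM2l (ltW (divr_gt0 e0 (ltr0n R 2))) (y_expo i).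
set Q := i.+2%:R^-1 in h1 h2 q; rewrite mulrBl mul1r in h1.
rewrite mulrBl mul1r mulrN; move: h1 h2 h3; set EE := E i; set PP := psum _ _.
have : e * EE = e / 2 * EE + e / 2 * EE by field.
rewrite [i%:R * _]mulrC; move: (e / 2 * i%:R) (e / 2 * EE) (e * EE) (Q * EE) => u1 u2 u3 u4; lra.
Qed.

(* Level i spreads the squared mass (i + 1) * exp (- sum_(p <= y i) p^-a) evenly
   over the 2^(pi (y i)) divisors of the primorial of y i; the factor i + 1 makes
   the norms of the partial sums unbounded. *)
Let g2 i : R := i.+1%:R * expR (- psum pw (y i)) / 2 ^+ size (primes_upto (y i)).

Let g2_ge0 i : 0 <= g2 i.
Proof. by rewrite divr_ge0 ?exprn_ge0 // mulr_ge0 ?expR_ge0. Qed.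

Let part k I : R := \sum_(0 <= i < I) g2 i * (k \in divs i)%:R.

Let part_nd k : nondecreasing_seq (part k).
Proof.
move=> I J IJ; rewrite /part [leRHS](@big_cat_nat _ _ _ I) //= lerDl.
by apply: sumr_ge0 => i _; rewrite mulr_ge0.
Qed.

Let g2_le_term i : g2 i <= term (1 / 2) i.
Proof.
rewrite /g2 ler_pdivrMr ?exprn_gt0 //; apply: (@le_trans _ _ (term (1 / 2) i)).
  rewrite /term ler_wpM2l // ler_expR lerDr mulr_ge0 ?E_ge0 //; lra.
by rewrite ler_peMr // exprn_ege1 // ler1n.
Qed.

Let part_cvg k : cvgn (part k).
Proof.
(* Convergence at a fixed k needs the level bound for a single eps only; 1/2 is taken. *)
have [|| W hW] := @level_sum_bounded (1 / 2); [lra|lra|].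
apply: nondecreasing_is_cvgn; first exact: part_nd.
exists W => _ [I _ <-]; apply: le_trans (hW I); apply: ler_sum => i _.
apply: le_trans (g2_le_term i); rewrite -[leRHS]mulr1 ler_wpM2l //.
by case: (_ \in _).
Qed.

(** The squared masses of the levels are added, not the coefficients: c^2 is then linear in the
    levels, which suits the summability, while c still dominates sqrt (g2 i) on level i, which suits
    the lower bound. *)
Definition diverging_coef k : R := Num.sqrt (limn (part k)).
Local Notation c := diverging_coef.

Let part_le_lim k I : part k I <= limn (part k).
Proof. exact: nondecreasing_cvgn_le (@part_nd k) (@part_cvg k) I. Qed.

Let coef_sqr k : c k ^+ 2 = limn (part k).
Proof.
rewrite sqr_sqrtr //; apply: le_trans (part_le_lim k 0%N).
by rewrite /part big_geq.
Qed.

Let coef_ge i k : k \in divs i -> Num.sqrt (g2 i) <= c k.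
Proof.
move=> ki; apply: ler_wsqrtr; apply: le_trans (part_le_lim k i.+1).
rewrite /part big_nat_recr //= ki mulr1 lerDr; apply: sumr_ge0 => j _.
by rewrite mulr_ge0.
Qed.

(** After the sums over k and over the levels are exchanged, the number of divisors on level i
    cancels the denominator of [g2], and [log_weight_le_level] leaves at most [expR C] times
    [term e i]. *)
Lemma diverging_coef_summable (e : R) : 0 < e -> e < 1 ->
  (\sum_(1 <= k <oo) (c k ^+ 2 * expR ((1 - e) / (1 - a) *
     ((logm k%:R `^ (1 - a)) / logm (logm k%:R))))%:E < +oo)%E.
Proof.
move=> e0 e1; have [W hW] := level_sum_bounded e0 e1.
have [C C0 hC] := log_weight_le_level a2 a1.
pose w k : R := expR ((1 - e) / (1 - a) * ((logm k%:R `^ (1 - a)) / logm (logm k%:R))).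
apply: (@nneseries_lt_pinfty (fun k => c k ^+ 2 * w k) (expR C * W)).
  by move=> k; rewrite mulr_ge0 ?sqr_ge0 ?expR_ge0.
move=> n.
have h : \sum_(1 <= k < n) part k I * w k @[I --> \oo] --> \sum_(1 <= k < n) c k ^+ 2 * w k.
  apply: cvg_sum_nat => k _; rewrite coef_sqr; apply: cvgM; last exact: cvg_cst.
  exact: part_cvg.
rewrite -(cvg_lim (@Rhausdorff R) h).
apply: limr_le; first by apply/cvg_ex; eexists; exact: h.
apply: nearW => I; rewrite /part.
under eq_bigr do rewrite mulr_suml.
rewrite exchange_big /=; apply: le_trans (ler_wpM2l (expR_ge0 _) (hW I)).
rewrite mulr_sumr; apply: ler_sum => i _.
under eq_bigr do rewrite -mulrA.
rewrite -mulr_sumr.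
have pp := all_prime_upto (y i).
have h2 := @sum_mem_le (divs i) w (expR (C + (1 - e) * E i)) n
  (sqfree_divs_uniq pp (uniq_primes_upto (y i))) (expR_ge0 _).
apply: le_trans (ler_wpM2l (g2_ge0 i) (h2 _)) _.
  move=> k k0 ki; rewrite /w ler_expR; apply: hC => //.
  rewrite theta_primes_upto ler_ln ?posrE ?ltr0n //.
    by rewrite ler_nat dvdn_leq ?sqfree_divs_dvdn // prod_prime_gt0.
  exact: prod_prime_gt0.
rewrite size_sqfree_divs natrX /g2 /term mulrA divfK ?expf_neq0 // expRD.
rewrite [leRHS](_ : _ = i.+1%:R * expR (- psum pw (y i)) * (expR C * expR ((1 - e) * E i))) //.
by rewrite addrC expRD; ring.
Qed.

Lemma diverging_not_cvg : ~ cvg_L2_01 (dilated_sum c (sine_series a)).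
Proof.
move=> /(cvg_L2_01_bounded (measurable_dilated_sum a c)) [B [N0 hB]].
have [Z hZ] := prod_two_plus_ge a2.
(* The exponentials of half the prime sum cancel, which leaves sqrt (i + 1) against a bound
   independent of i. *)
have key i : Num.sqrt i.+1%:R * expR (- Z) <= B + 1 / 2.
  set s := primes_upto (y i); set P := (\prod_(p <- s) p)%N.
  (* The test polynomial has square norm r^2 / 2, so the duality parameter 1 / r makes both terms of
     the bound multiples of r. *)
  pose r := Num.sqrt (2 ^+ size s) : R.
  have r0 : 0 < r by rewrite sqrtr_gt0 exprn_gt0.
  have rr : r ^+ 2 = 2 ^+ size s by rewrite sqr_sqrtr // exprn_ge0.
  have ps : all prime s := all_prime_upto _.
  have P0 : (0 < P)%N := prod_prime_gt0 ps.
  (* The partial sum must contain every divisor of P and lie beyond N0; further terms only help, as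
     all coefficients are nonnegative. *)
  have dN : {subset sqfree_divs s <= index_iota 1 (maxn N0 P).+1}.
    move=> k kd; rewrite mem_index_iota (sqfree_divs_gt0 ps kd) ltnS leq_max.
    by rewrite (dvdn_leq P0 (sqfree_divs_dvdn kd)) orbT.
  have ri0 : 0 < r^-1 by rewrite invr_gt0.
  have := dilated_sum_L2_lower a2 ps (uniq_primes_upto _) ri0
    (fun k => sqrtr_ge0 _) (sqrtr_ge0 (g2 i)) dN (@coef_ge i) (hB _ (leq_maxl _ _)).
  rewrite invrK -rr => h.
  have gE : Num.sqrt (g2 i) = Num.sqrt i.+1%:R * expR (- (psum pw (y i) / 2)) / r.
    rewrite /g2 -/s -rr sqrtrM ?mulr_ge0 ?expR_ge0 // sqrtrM // sqrtrV ?exprn_ge0 ?ltW //.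
    rewrite sqrtr_sqr (gtr0_norm r0); congr (_ * _ / _).
    rewrite (_ : - psum pw (y i) = - (psum pw (y i) / 2) + - (psum pw (y i) / 2)); last by field.
    by rewrite expRD -expr2 sqrtr_sqr ger0_norm ?expR_ge0.
  have := ler_wpM2l (sqrtr_ge0 (g2 i)) (hZ (y i)).
  rewrite -/s -rr => /le_trans /(_ h); rewrite gE.
  have -> : Num.sqrt i.+1%:R * expR (- (psum pw (y i) / 2)) / r *
      (r ^+ 2 * expR (psum pw (y i) / 2 - Z)) = Num.sqrt i.+1%:R * expR (- Z) * r.
    rewrite expRD; set u := psum _ _ / 2.
    have : expR (- u) * expR u = 1 by rewrite -expRD addNr expR0.
    move: (expR (- u)) (expR u) (expR (- Z)) => u1 u2 u3 e.
    transitivity (Num.sqrt i.+1%:R * (u1 * u2) * u3 * r); last by rewrite e mulr1.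
    by field; rewrite gt_eqF.
  have -> : B * r + r^-1 * (r ^+ 2 / 2) = (B + 1 / 2) * r by field; rewrite gt_eqF.
  by rewrite ler_pM2r.
pose M := ((B + 1 / 2) * expR Z) ^+ 2.
have := key (Num.truncn M).
apply/negP; rewrite -ltNge -ltr_pdivrMr ?expR_gt0 // expRN invrK.
apply: le_lt_trans (ler_norm _) _; rewrite -sqrtr_sqr ltr_sqrt ?ltr0n //.
exact: truncnS_gt.
Qed.

End DivergentSeries.

Lemma exists_divergent_dilated_sum (R : realType) (a : R) : 1 / 2 < a -> a < 1 ->
  exists (f : R -> R) (c : nat -> R),
    [/\ class_C a f,
        (forall e : R, 0 < e -> e < 1 ->
           (\sum_(1 <= k <oo)
              (c k ^+ 2 * expR ((1 - e) / (1 - a)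
                 * ((logm k%:R `^ (1 - a)) / logm (logm k%:R))))%:E < +oo)%E) &
        ~ cvg_L2_01 (dilated_sum c f)].
Proof.
move=> a2 a1; have [y hy] := exists_levels a2 a1.
have h1 i : i%:R <= level_expo a (y i) by have [] := hy i.
have h2 i : (1 - i.+2%:R^-1) * level_expo a (y i) <= psum (fun p => p%:R `^ (- a)) (y i).
  by have [] := hy i.
exists (sine_series a), (diverging_coef a y); split.
- exact: sine_series_class_C.
- exact: diverging_coef_summable.
- exact: diverging_not_cvg.
Qed.

Theorem theorem1 (R : realType) (alpha : R)
    (halpha : 1 / 2 < alpha) (halpha1 : alpha < 1) :
  (forall (f : R -> R) (c : nat -> R),
     class_C alpha f ->
     let K := 3 / (1 - alpha) + 4 / Num.sqrt (2 * alpha - 1) in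
     (\sum_(1 <= k <oo)
        (c k ^+ 2 * expR (K * (logm k%:R `^ (1 - alpha))
                            / logm (logm k%:R)))%:E < +oo)%E ->
     cvg_L2_01 (dilated_sum c f) /\
     {ae @completed_lebesgue_measure R,
       forall x, cvgn (fun N : nat => dilated_sum c f N x)})
  /\
  (exists (f : R -> R) (c : nat -> R),
     [/\ class_C alpha f,
         (forall eps : R, 0 < eps -> eps < 1 ->
            (\sum_(1 <= k <oo)
               (c k ^+ 2 * expR ((1 - eps) / (1 - alpha)
                  * ((logm k%:R `^ (1 - alpha)) / logm (logm k%:R))))%:E
             < +oo)%E) &
         ~ cvg_L2_01 (dilated_sum c f)]).
Proof.
split; last exact: exists_divergent_dilated_sum.
by move=> f c; exact: dilated_sum_cvg.
Qed.
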